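(* Let $f\in\mathbb{C}\{X,Y\}$ be a nonzero power series without constant term. Then for every convenient power series $h\in\mathbb{C}\{X,Y\}$ without constant term: $$i_0(f,h)=[\Delta(f),\Delta(h)]+\sum_{\tau}i_0(f_\tau,h_\tau)$$ where the summation is over all quasi-tangents $\tau$ to the curve $h=0$.
   Context: $\mathbb{C}\{X,Y\}$ is the ring of convergent complex power series; $\mathbb{R}_+=[0,\infty)$. $i_0(f,g)=\dim_{\mathbb{C}}\mathbb{C}\{X,Y\}/(f,g)\in\mathbb{N}\cup\{\infty\}$. Newton diagrams. A Newton diagram is a set $\Delta(E)$, the convex hull of $E+\mathbb{R}_+^2$, with $\emptyset\neq E\subset\mathbb{N}^2$. Newton diagrams form a semigroup under Minkowski sum, with zero $\mathbb{R}_+^2$. For positive integers $a,b$ let $\{a/\!/b\}$ denote the Newton diagram with vertices $(0,b)$ and $(a,0)$, let $\{a/\!/\infty\}$ be the quadrant $(a,0)+\mathbb{R}_+^2$ and $\{\infty/\!/b\}$ the quadrant $(0,b)+\mathbb{R}_+^2$. Let $n(\Delta)$ be the set of compact one-dimensional faces of the boundary of $\Delta$, and $a(\Delta),b(\Delta)$ the distances of $\Delta$ to the vertical and horizontal axes. For a segment $S\in n(\Delta)$ with vertices $(\alpha,\beta),(\alpha',\beta')$, $\alpha<\alpha'$, $\beta'<\beta$, put $|S|_1=\alpha'-\alpha$, $|S|_2=\beta-\beta'$, $r(S)=\gcd(|S|_1,|S|_2)$, $m_S=|S|_1/r(S)$, $n_S=|S|_2/r(S)$, $a(S)=\alpha$,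 $b(S)=\beta'$. Every $\Delta$ has the minimal decomposition $\Delta=\{a(\Delta)/\!/\infty\}+\sum_{S\in n(\Delta)}\{|S|_1/\!/|S|_2\}+\{\infty/\!/b(\Delta)\}$ (terms with $a(\Delta)=0$ or $b(\Delta)=0$ being the zero diagram $\mathbb{R}_+^2$). The Minkowski double area $[\Delta,\Delta']\in\mathbb{N}\cup\{\infty\}$ is the symmetric function, additive in each argument, with $[\mathbb{R}_+^2,\Delta]=0$ and $[\{a/\!/b\},\{a'/\!/b'\}]=\inf\{ab',a'b\}$ (entries may be $\infty$, with $\infty\cdot x=\infty$ for $x>0$). For nonzero $f=\sum c_{\alpha\beta}X^\alpha Y^\beta$, $\Delta(f)=\Delta(\{(\alpha,\beta):c_{\alpha\beta}\neq0\})$; $f$ is convenient if $a(\Delta(f))=b(\Delta(f))=0$ (equivalently neither $X$ nor $Y$ divides $f$). For $S\in n(\Delta(f))$ the initial form is $\mathrm{in}(f,S)=\sum_{(\alpha,\beta)\in S}c_{\alpha\beta}X^\alpha Y^\beta=cX^{a(S)}Y^{b(S)}\prod_{i}(Y^{n_S}-a_iX^{m_S})^{d_i}$ with $c\ne0$ and $a_i\ne 0$ pairwise distinct. A binomial curve $\tau: Y^n-aX^m=0$ ($n,m>0$ coprime integers, $a\neq0$) is a quasi-tangent to $f=0$ if $Y^n-aX^m$ is a factor of some $\mathrm{in}(f,S)$. Strict transform. For any such binomial curve $\tau$, let $a^{1/n}=|a|^{1/n}\exp(i\theta/n)$ where $a=|a|\exp(i\theta)$, $0\le\theta<2\pi$.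 For nonzero $f$ without constant term, the strict transform $f_\tau\in\mathbb{C}\{X_\tau,Y_\tau\}$ is the unique power series such that $f(X_\tau^n,(a^{1/n}+Y_\tau)X_\tau^m)=X_\tau^kf_\tau(X_\tau,Y_\tau)$ for some integer $k>0$ and $f_\tau(0,Y_\tau)\neq0$. (If $\tau$ is not a quasi-tangent to $f=0$ then $f_\tau$ is a unit.) *)

(* Defs.v *)
From HB Require Import structures.
From mathcomp Require Import all_boot all_order all_algebra.
From mathcomp Require Import complex.
From mathcomp Require Import all_classical all_reals all_analysis.

Set Implicit Arguments.
Unset Strict Implicit.
Unset Printing Implicit Defensive.
Import Order.TTheory GRing.Theory Num.Theory.
Import numFieldNormedType.Exports.
Local Open Scope classical_set_scope.
Local Open Scope complex_scope.
Local Open Scope ring_scope.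

(* Convergent power series in two variables over K; K is meant to be R[i],   *)
(* whose order is partial: 0 < r forces r to be a positive real number.      *)
(* The coefficient of X^i Y^j is c i j.                                      *)

Section ConvergentPowerSeries.
Context {K : numFieldType}.
Implicit Types (c d e : nat -> nat -> K) (r : K).

Definition abs_psum c r (N : nat) : K :=
  \sum_(i < N) \sum_(j < N) `|c i j| * r ^+ (i + j).

(* Absolute convergence on a polydisc of positive radius. *)
Definition convergent_prop c : Prop :=
  exists r M : K, 0 < r /\ forall N, abs_psum c r N <= M.

Definition convergent : {pred (nat -> nat -> K)} :=
  fun c => `[< convergent_prop c >].

Lemma convergentP c : reflect (convergent_prop c) (c \in convergent).
Proof. exact: asboolP. Qed.

Lemma abs_psum_le c r s N : 0 <= r -> r <= s -> abs_psum c r N <= abs_psum c s N.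
Proof.
move=> r0 rs; apply: ler_sum => i _; apply: ler_sum => j _.
by apply: ler_wpM2l => //; apply: lerXn2r => //; rewrite nnegrE// (le_trans r0).
Qed.

Lemma common_radius c d : convergent_prop c -> convergent_prop d ->
  exists r M : K, 0 < r /\
    forall N, abs_psum c r N <= M /\ abs_psum d r N <= M.
Proof.
move=> [r [M [r0 cM]]] [s [M' [s0 dM]]].
have rs0 : 0 < r + s by rewrite addr_gt0.
have M0 : 0 <= M by have := cM 0; rewrite /abs_psum big_ord0.
have M'0 : 0 <= M' by have := dM 0; rewrite /abs_psum big_ord0.
have t0 : 0 < r * s / (r + s) by rewrite divr_gt0// mulr_gt0.
exists (r * s / (r + s)), (M + M'); split => // N; split.
  apply: (@le_trans _ _ M); last by rewrite lerDl.
  apply: le_trans (cM N); apply: abs_psum_le; first exact: ltW.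
  by rewrite ler_pdivrMr// ler_pM2l// lerDr ltW.
apply: (@le_trans _ _ M'); last by rewrite lerDr.
apply: le_trans (dM N); apply: abs_psum_le; first exact: ltW.
by rewrite ler_pdivrMr// mulrC ler_pM2l// lerDl ltW.
Qed.

Lemma convergent_zmod : zmod_closed convergent.
Proof.
split.
  apply/convergentP; exists 1, 0; split => // N.
  by rewrite /abs_psum big1// => i _; rewrite big1// => j _; rewrite normr0 mul0r.
move=> c d /convergentP cc /convergentP dd; apply/convergentP.
have [r [M [r0 H]]] := common_radius cc dd.
exists r, (M + M); split => // N; have [cM dM] := H N.
apply: le_trans (lerD cM dM).
rewrite /abs_psum -big_split/=; apply: ler_sum => i _.
rewrite -big_split/=; apply: ler_sum => j _.
by rewrite -mulrDl ler_wpM2r ?exprn_ge0 ?(ltW r0)// ler_normB.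
Qed.

HB.instance Definition _ :=
  GRing.isZmodClosed.Build (nat -> nat -> K) convergent convergent_zmod.

Definition mulc c d : nat -> nat -> K := fun i j =>
  \sum_(k < i.+1) \sum_(l < j.+1) c k l * d (i - k)%N (j - l)%N.

Definition monoc (a b : nat) : nat -> nat -> K :=
  fun i j => ((i == a) && (j == b))%:R.

Definition trunc (N : nat) c : {poly {poly K}} :=
  \poly_(i < N) \poly_(j < N) c i j.

Lemma coef_trunc N c i j : (i < N)%N -> (j < N)%N -> (trunc N c)`_i`_j = c i j.
Proof. by move=> iN jN; rewrite coef_poly iN coef_poly jN. Qed.

Lemma mulc_low c d c' d' i j :
  (forall k l, (k <= i)%N -> (l <= j)%N -> c k l = c' k l) ->
  (forall k l, (k <= i)%N -> (l <= j)%N -> d k l = d' k l) ->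
  mulc c d i j = mulc c' d' i j.
Proof.
move=> cc dd; apply: eq_bigr => k _; apply: eq_bigr => l _.
by rewrite cc ?dd// ?leq_subr// -ltnS ltn_ord.
Qed.

Lemma mulc_poly (p q : {poly {poly K}}) i j :
  mulc (fun i j => p`_i`_j) (fun i j => q`_i`_j) i j = (p * q)`_i`_j.
Proof.
rewrite coefM coef_sum; apply: eq_bigr => k _.
by rewrite coefM.
Qed.

Lemma mulc_trunc N c d i j : (i < N)%N -> (j < N)%N ->
  mulc c d i j = (trunc N c * trunc N d)`_i`_j.
Proof.
move=> iN jN; rewrite -mulc_poly; apply: mulc_low => k l ki lj;
  by rewrite coef_trunc// ?(leq_ltn_trans ki)// (leq_ltn_trans lj).
Qed.

Lemma mulcC c d : mulc c d = mulc d c.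
Proof.
apply/funext => i; apply/funext => j.
rewrite !(@mulc_trunc (maxn i j).+1) ?ltnS ?leq_maxl ?leq_maxr//.
by rewrite mulrC.
Qed.

Lemma mulcA c d e : mulc c (mulc d e) = mulc (mulc c d) e.
Proof.
apply/funext => i; apply/funext => j.
pose N := (maxn i j).+1.
have iN : (i < N)%N by rewrite ltnS leq_maxl.
have jN : (j < N)%N by rewrite ltnS leq_maxr.
transitivity ((trunc N c * (trunc N d * trunc N e))`_i`_j).
  rewrite -mulc_poly; apply: mulc_low => k l ki lj;
    have kN := leq_ltn_trans ki iN; have lN := leq_ltn_trans lj jN.
    by rewrite coef_trunc.
  exact: mulc_trunc.
rewrite mulrA -mulc_poly; apply: mulc_low => k l ki lj;
  have kN := leq_ltn_trans ki iN; have lN := leq_ltn_trans lj jN.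
  by rewrite -mulc_trunc.
by rewrite coef_trunc.
Qed.

Lemma mulcDl c d e : mulc (c + d) e = mulc c e + mulc d e.
Proof.
apply/funext => i; apply/funext => j.
rewrite -[RHS]/(mulc c e i j + mulc d e i j) /mulc -big_split/=.
apply: eq_bigr => k _.
by rewrite -big_split/=; apply: eq_bigr => l _; rewrite -mulrDl.
Qed.

Lemma mul1c c : mulc (monoc 0 0) c = c.
Proof.
apply/funext => i; apply/funext => j; rewrite /mulc.
rewrite big_ord_recl big_ord_recl /monoc/= mul1r !subn0.
rewrite !big1 ?addr0// => [k _|k _]; last by rewrite mul0r.
by rewrite big1// => l _; rewrite mul0r.
Qed.

Lemma ler_sum_triangle (A : nat -> nat -> K) N : (forall k l, 0 <= A k l) ->
  \sum_(i < N) \sum_(k < i.+1) A k (i - k)%N <= \sum_(k < N) \sum_(l < N) A k l.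
Proof.
move=> A0.
have -> : \sum_(i < N) \sum_(k < i.+1) A k (i - k)%N =
    \sum_(k < N) \sum_(i < N | (k <= i)%N) A k (i - k)%N.
  rewrite (exchange_big_dep xpredT)//=; apply: eq_bigr => i _.
  by rewrite (big_ord_widen_cond N xpredT (fun k => A k (i - k)%N)).
apply: ler_sum => k _.
rewrite -(big_mkord (fun i => (k <= i)%N) (fun i => A k (i - k)%N)).
rewrite -(big_mkord xpredT (fun l => A k l)).
have -> : \sum_(0 <= i < N | (k <= i)%N) A k (i - k)%N =
    \sum_(k <= i < N) A k (i - k)%N by rewrite (@big_nat_widenl _ _ _ k 0).
rewrite -[X in \sum_(X <= _ < _) _]add0n big_addn.
rewrite [leRHS](@big_cat_nat _ _ _ (N - k)) ?leq_subr//=.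
rewrite (eq_bigr (A k)) => [|i _]; last by rewrite addnK.
by rewrite lerDl sumr_ge0.
Qed.

Lemma abs_psum_mul c d r N : 0 < r ->
  abs_psum (mulc c d) r N <= abs_psum c r N * abs_psum d r N.
Proof.
move=> r0.
pose F i j := `|c i j| * r ^+ (i + j).
pose G i j := `|d i j| * r ^+ (i + j).
have F0 i j : 0 <= F i j by rewrite mulr_ge0 ?exprn_ge0 ?(ltW r0).
have G0 i j : 0 <= G i j by rewrite mulr_ge0 ?exprn_ge0 ?(ltW r0).
apply: (@le_trans _ _ (\sum_(i < N) \sum_(j < N) \sum_(k < i.+1)
    \sum_(l < j.+1) F k l * G (i - k)%N (j - l)%N)).
  apply: ler_sum => i _; apply: ler_sum => j _.
  apply: le_trans (_ : (\sum_(k < i.+1) \sum_(l < j.+1)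
      `|c k l * d (i - k)%N (j - l)%N|) * r ^+ (i + j) <= _).
    rewrite ler_wpM2r ?exprn_ge0 ?(ltW r0)//.
    apply: le_trans (ler_norm_sum _ _ _) _; apply: ler_sum => k _.
    exact: ler_norm_sum.
  rewrite mulr_suml; apply: ler_sum => k _.
  rewrite mulr_suml; apply: ler_sum => l _.
  rewrite normrM /F /G mulrACA -exprD addnACA !subnKC// -ltnS ltn_ord//.
under eq_bigr do rewrite exchange_big/=.
apply: le_trans (@ler_sum_triangle (fun k i => \sum_(j < N)
  \sum_(l < j.+1) F k l * G i (j - l)%N) N _) _.
  by move=> k i; do 2 (apply: sumr_ge0 => ? _); rewrite mulr_ge0.
rewrite [leRHS]mulr_suml; apply: ler_sum => k _.
apply: (@le_trans _ _ (\sum_(i < N) \sum_(l < N) \sum_(j < N) F k l * G i j)).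
  apply: ler_sum => i _.
  apply: (@ler_sum_triangle (fun l j => F k l * G i j)) => l j.
  by rewrite mulr_ge0.
rewrite exchange_big/= mulr_suml; apply: ler_sum => l _.
rewrite mulr_sumr; apply: ler_sum => i _.
by rewrite mulr_sumr.
Qed.

Lemma convergent_mul c d :
  c \in convergent -> d \in convergent -> mulc c d \in convergent.
Proof.
move=> /convergentP cc /convergentP dd; apply/convergentP.
have [r [M [r0 H]]] := common_radius cc dd.
exists r, (M * M); split => // N; have [cM dM] := H N.
apply: le_trans (abs_psum_mul _ _ _ r0) _.
apply: ler_pM => //; do 2 (apply: sumr_ge0 => ? _);
  by rewrite mulr_ge0 ?exprn_ge0 ?(ltW r0).
Qed.

Lemma convergent_mono a b : monoc a b \in convergent.
Proof.
apply/convergentP; exists 1, 1; split => // N.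
have -> : abs_psum (monoc a b) 1 N =
    \sum_(i < N) (nat_of_ord i == a)%:R * \sum_(j < N) (nat_of_ord j == b)%:R.
  apply: eq_bigr => i _; rewrite mulr_sumr; apply: eq_bigr => j _.
  by rewrite expr1n mulr1 /monoc normr_nat -natrM mulnb.
have le1 a' : \sum_(i < N) (nat_of_ord i == a')%:R <= 1 :> K.
  rewrite -natr_sum lern1.
  have -> : (\sum_(i < N) (i == a' :> nat) = #|[pred i : 'I_N | i == a' :> nat]|)%N.
    by rewrite -sum1_card [RHS]big_mkcond; apply: eq_bigr => i _; rewrite inE; case: eqP.
  by apply/card_le1P => x; rewrite inE => /eqP <- y; rewrite !inE.
rewrite -mulr_suml; apply: mulr_ile1 => //; exact: sumr_ge0.
Qed.

Lemma convergent_scale (a : K) c :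
  c \in convergent -> (fun i j => a * c i j) \in convergent.
Proof.
move=> /convergentP [r [M [r0 cM]]]; apply/convergentP.
exists r, (`|a| * M); split => // N.
apply: le_trans (ler_wpM2l (normr_ge0 a) (cM N)).
rewrite mulr_sumr; apply: ler_sum => i _.
by rewrite mulr_sumr; apply: ler_sum => j _; rewrite normrM mulrA.
Qed.

End ConvergentPowerSeries.

Arguments convergent {K}.

Record cps (K : numFieldType) := CPS {
  coefs :> nat -> nat -> K;
  _ : coefs \in convergent }.

HB.instance Definition _ (K : numFieldType) := [isSub for @coefs K].
HB.instance Definition _ (K : numFieldType) := [Choice of cps K by <:].
HB.instance Definition _ (K : numFieldType) :=
  [SubChoice_isSubZmodule of cps K by <:].

Section CpsAlgebra.
Context {K : numFieldType}.
Implicit Types f g h : cps K.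

Definition mul_cps f g : cps K :=
  CPS (convergent_mul (valP f) (valP g)).
Definition mono_cps (a b : nat) : cps K := CPS (convergent_mono a b).
Definition scale_cps (a : K) f : cps K := CPS (convergent_scale a (valP f)).

Let mulA : associative mul_cps.
Proof. by move=> f g h; apply/val_inj/mulcA. Qed.
Let mulC : commutative mul_cps.
Proof. by move=> f g; apply/val_inj/mulcC. Qed.
Let mul1 : left_id (mono_cps 0 0) mul_cps.
Proof. by move=> f; apply/val_inj/mul1c. Qed.
Let mulDl : left_distributive mul_cps +%R.
Proof. by move=> f g h; apply/val_inj/mulcDl. Qed.
Let one_neq0 : mono_cps 0 0 != 0.
Proof.
apply/eqP => /(congr1 (fun f : cps K => f 0%N 0%N)) /eqP.
by rewrite /= oner_eq0.
Qed.

HB.instance Definition _ :=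
  GRing.Zmodule_isComNzRing.Build (cps K) mulA mulC mul1 mulDl one_neq0.

Let scaleA a b f : scale_cps a (scale_cps b f) = scale_cps (a * b) f.
Proof.
by apply/val_inj/funext => i; apply/funext => j; rewrite /= mulrA.
Qed.
Let scale1 : left_id 1 scale_cps.
Proof.
by move=> f; apply/val_inj/funext => i; apply/funext => j; rewrite /= mul1r.
Qed.
Let scaleDr : right_distributive scale_cps +%R.
Proof.
by move=> a f g; apply/val_inj/funext => i; apply/funext => j; rewrite /= mulrDr.
Qed.
Let scaleDl f : {morph scale_cps^~ f : a b / a + b}.
Proof.
by move=> a b; apply/val_inj/funext => i; apply/funext => j; rewrite /= mulrDl.
Qed.

HB.instance Definition _ := GRing.Zmodule_isLmodule.Build K (cps K)
  scaleA scale1 scaleDr scaleDl.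

Let scaleAl (a : K) f g : a *: (f * g) = (a *: f) * g.
Proof.
apply/val_inj/funext => i; apply/funext => j.
rewrite /= /mulc mulr_sumr; apply: eq_bigr => k _.
by rewrite mulr_sumr; apply: eq_bigr => l _; rewrite /= mulrA.
Qed.

HB.instance Definition _ := GRing.Lmodule_isLalgebra.Build K (cps K) scaleAl.
HB.instance Definition _ := GRing.Lalgebra_isComAlgebra.Build K (cps K).

Definition cpsX : cps K := mono_cps 1 0.
Definition cpsY : cps K := mono_cps 0 1.

End CpsAlgebra.

(* A dimension in N u {oo} is recorded as an element of \bar R.               *)
Section IntersectionNumber.
Context {R : realType}.

Definition is_basis_mod (K : numFieldType) (V : lmodType K) (W : set V)
    (n : nat) (e : 'I_n -> V) : Prop :=
  (forall c : 'I_n -> K, W (\sum_i c i *: e i) -> forall i, c i = 0) /\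
  (forall v, exists c : 'I_n -> K, W (v - \sum_i c i *: e i)).

Definition has_codim (K : numFieldType) (V : lmodType K) (W : set V) (n : nat) :
  Prop := exists e : 'I_n -> V, is_basis_mod W e.

Definition codim (K : numFieldType) (V : lmodType K) (W : set V) : \bar R :=
  if pselect (exists n, has_codim W n) then (xget 0%N (has_codim W))%:R%:E
  else +oo%E.

Definition ideal2 (A : comNzRingType) (f g : A) : set A :=
  [set u * f + v * g | u in setT & v in setT].

Definition i0 (f g : cps R[i]) : \bar R := codim (ideal2 f g).

End IntersectionNumber.

Section NewtonDiagrams.
Context {R : realType}.
Local Notation plane := (R^o * R^o)%type.
Implicit Types (D : set plane) (p q : plane).

Definition quadrant : set plane := [set q | 0 <= q.1 /\ 0 <= q.2].

Definition msum D D' : set plane := [set p + q | p in D & q in D'].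

Definition lattice (P : nat * nat) : plane := (P.1%:R, P.2%:R).

Definition newton_diagram (E : set (nat * nat)) : set plane :=
  smallest (@convex_set R plane) (msum (lattice @` E) quadrant).

Definition is_newton_diagram D : Prop :=
  exists2 E : set (nat * nat), E !=set0 & D = newton_diagram E.

Definition a_dist D : R := inf [set p.1 | p in D].
Definition b_dist D : R := inf [set p.2 | p in D].

Definition segment p q : set plane :=
  [set t *: p + (1 - t) *: q | t in [set t : R | 0 <= t <= 1]].

Definition is_face D (F : set plane) : Prop :=
  [/\ F !=set0, @convex_set R plane F, F `<=` D &
    forall p q (t : R), D p -> D q -> 0 < t < 1 ->
      F (t *: p + (1 - t) *: q) -> F p /\ F q].

(* n(D); a segment is represented by its vertices (alpha, beta),              *)
(* (alpha', beta') with alpha < alpha' and beta' < beta, which are lattice    *)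
(* points when D is a Newton diagram.                                         *)
Definition edges D : set ((nat * nat) * (nat * nat)) :=
  [set S | [/\ (S.1.1 < S.2.1)%N, (S.2.2 < S.1.2)%N &
    is_face D (segment (lattice S.1) (lattice S.2))]].

(* Entries of elementary diagrams live in N u {oo}, None being oo.            *)
Definition entry (a : option nat) : \bar R :=
  if a is Some a' then a'%:R%:E else +oo%E.

(* {a // b}; this is the quadrant (a, 0) + R_+^2 for b = oo and               *)
(* (0, b) + R_+^2 for a = oo.                                                 *)
Definition elementary (a b : option nat) : set plane :=
  newton_diagram [set P | (a = Some P.1 /\ P.2 = 0%N) \/
                          (b = Some P.2 /\ P.1 = 0%N)].

Definition elementary_entries (a b : option nat) : Prop :=
  [/\ a <> Some 0%N, b <> Some 0%N & a <> None \/ b <> None].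

Definition is_double_area (A : set plane -> set plane -> \bar R) : Prop :=
  [/\ forall D D', is_newton_diagram D -> is_newton_diagram D' ->
        A D D' = A D' D,
      forall D1 D2 D, is_newton_diagram D1 -> is_newton_diagram D2 ->
        is_newton_diagram D -> A (msum D1 D2) D = (A D1 D + A D2 D)%E,
      forall D D1 D2, is_newton_diagram D -> is_newton_diagram D1 ->
        is_newton_diagram D2 -> A D (msum D1 D2) = (A D D1 + A D D2)%E,
      forall D, is_newton_diagram D -> A quadrant D = 0%E &
      forall a b a' b', elementary_entries a b -> elementary_entries a' b' ->
        A (elementary a b) (elementary a' b') =
        Order.min (entry a * entry b')%E (entry a' * entry b)%E].

(* is_double_area determines A on Newton diagrams, because each of them is a  *)
(* finite Minkowski sum of elementary ones; elsewhere the value is arbitrary. *)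
Definition double_area : set plane -> set plane -> \bar R :=
  xget (fun _ _ => 0%E) is_double_area.

End NewtonDiagrams.

Section QuasiTangents.
Context {R : realType}.
Local Notation C := R[i].
Implicit Types (f g h : cps C).

Definition diagram f : set (R^o * R^o)%type :=
  newton_diagram [set P | f P.1 P.2 != 0].

(* h != 0 is required since inf set0 = 0.                                     *)
Definition convenient h : Prop :=
  [/\ h != 0, a_dist (diagram h) = 0 & b_dist (diagram h) = 0].

(* In {poly {poly C}}, X is the outer variable 'X and Y the inner one 'Y.     *)
Definition initial_form f (S : (nat * nat) * (nat * nat)) : {poly {poly C}} :=
  \poly_(i < S.2.1.+1) \poly_(j < S.1.2.+1)
    (if `[< @segment R (lattice S.1) (lattice S.2) (lattice (i, j)) >]
     then f i j else 0).

(* The triple (n, m, a) stands for the binomial curve Y^n - a X^m = 0.        *)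
Definition is_binomial_curve (tau : nat * nat * C) : Prop :=
  let: (n, m, a) := tau in [/\ (0 < n)%N, (0 < m)%N, coprime n m & a != 0].

Definition binomial_poly (tau : nat * nat * C) : {poly {poly C}} :=
  let: (n, m, a) := tau in 'Y ^+ n - a%:P%:P * 'X ^+ m.

Definition quasi_tangents f : set (nat * nat * C) :=
  [set tau | is_binomial_curve tau /\
    exists2 S, edges (diagram f) S &
      exists q, initial_form f S = binomial_poly tau * q].

Definition argC (z : C) : R :=
  xget 0 [set t : R | 0 <= t < 2 * pi /\ z = `|z| * (cos t +i* sin t)].

(* |z|^(1/n) exp(i theta / n), with theta = argC z. *)
Definition root_arg (n : nat) (z : C) : C :=
  (complex.Re `|z| `^ n%:R^-1)%:C *
  (cos (argC z / n%:R) +i* sin (argC z / n%:R)).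

(* The coefficients of f(u, v) for u and v in the ideal (X): then u^a v^b is  *)
(* divisible by X^(a + b), so that terms with a > i or b > i do not           *)
(* contribute to the coefficient of X^i Y^j.                                  *)
Definition subst f (u v : cps C) : nat -> nat -> C := fun i j =>
  (\sum_(a < i.+1) \sum_(b < i.+1) f a b *: (u ^+ a * v ^+ b)) i j.

Definition is_strict_transform (tau : nat * nat * C) f g : Prop :=
  let: (n, m, a) := tau in
  exists2 k : nat, (0 < k)%N &
    subst f (cpsX ^+ n) (((root_arg n a)%:A + cpsY) * cpsX ^+ m)
      = cpsX ^+ k * g /\
    exists j, g 0%N j != 0.

Definition strict_transform (tau : nat * nat * C) f : cps C :=
  xget 0 (is_strict_transform tau f).

End QuasiTangents.

(* Main.v *)
(* Let b be the order of h(0, Y).  By Weierstrass division C{X,Y}/(h) is       *)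
(* spanned over C{X} by 1, ..., Y^(b-1), and each C{X,Y}/(h_tau) is spanned    *)
(* over C{X_tau^n} by n * d_tau monomials, d_tau being the order of            *)
(* h_tau(0, Y).  The substitutions defining the strict transforms induce a     *)
(* map Phi from C{X,Y}/(h) to the product of the C{X,Y}/(h_tau).  If a         *)
(* nonzero polynomial u of degree less than b in Y had Phi(u) = 0, each        *)
(* initial form of u would be divisible by the one of h along every edge of h, *)
(* and the Newton diagram of u would have height at least b: Phi is injective. *)
(* Moreover the numbers of generators agree, since n * d_tau sums to b over    *)
(* the quasi-tangents; so the determinant of Phi is a nonzero element of C{X}  *)
(* and Phi has a finite dimensional cokernel.  Hence multiplication by f has   *)
(* cokernels of equal dimension on both sides.  On the right f becomes         *)
(* X^k f_tau, which contributes k * d_tau + i_0(f_tau, h_tau); the terms       *)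
(* k * d_tau sum to the double area, read off the decomposition of the         *)
(* diagram of h into its edges.                                                *)
Require Import Defs.
From HB Require Import structures.
From mathcomp Require Import all_boot all_order all_algebra.
From mathcomp Require Import complex.
From mathcomp Require Import all_classical all_reals all_analysis.
From mathcomp Require Import ring lra zify.
Set Implicit Arguments.
Unset Strict Implicit.
Unset Printing Implicit Defensive.
Import Order.TTheory GRing.Theory Num.Theory.
Local Open Scope classical_set_scope.
Local Open Scope complex_scope.
Local Open Scope ring_scope.

(** * Norms of convergent power series *)

(** Write A for the ring of convergent series, V for the product of one copy of A per quasi-tangent
    tau of h, H for the product of the ideals (h_tau), and Phi : A -> V for all the substitutions
    [pi_tau] at once. Each [pi_tau] is a ring morphism, so V is an A-module and Phi is A-linear. Two
    facts about Phi carry the proof: the preimage of H is (h) ([in_idealP]), and V / (Phi(A) + H)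
    has finite dimension ([coker_finite]). The codimension of Phi(fA) + H in V is computed through
    Phi(A) + H and through fV + H; the finite cokernel cancels, and dim A/(f, h) becomes the sum
    over tau of dim A/(X^k f_tau, h_tau) ([codim_strict_transforms]). The factor X^k splits off k *
    d_tau, where d_tau is the order of h_tau(0, Y) ([edim_idealXM], [edim_idealX]).

    Both facts rest on one dictionary ([coef_pi_tau]): the rows of [pi_tau f] are the weighted
    homogeneous parts of f at X = 1, recentred at the chosen root [al]. Hence d_tau is the
    multiplicity of [al] in an initial form of h, and the n * d_tau add up to the order b of h(0,
    Y). By [weierstrass_division], A/(h) and V/H are both generated by b elements over the series in
    X, where X acts on a component as X^n. So Phi is described by a square matrix; its determinant
    is nonzero by [low_degree_zero], and Cramer's rule bounds the cokernel.

    Newton diagrams enter through their support functions ([min_weight]), which are additive under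
    Minkowski sums. These give the widths of initial forms ([slice_width]), the exponents k as
    weights of f, and the double area of a diagram with {a//b} as its support function at (b, a);
    the last point also shows that the double area is well defined ([double_areaP]). *)

Section Coefficients.
Context {K : numFieldType}.
Implicit Types (f g h : cps K) (i j : nat).

Lemma cpsP f g : (forall i j, f i j = g i j) -> f = g.
Proof. by move=> fg; apply/val_inj/funext => i; apply/funext => j; exact: fg. Qed.

Lemma coefs0 i j : (0 : cps K) i j = 0. Proof. by []. Qed.
Lemma coefsD f g i j : (f + g) i j = f i j + g i j. Proof. by []. Qed.
Lemma coefsN f i j : (- f) i j = - f i j. Proof. by []. Qed.
Lemma coefsB f g i j : (f - g) i j = f i j - g i j. Proof. by []. Qed.
Lemma coefsZ (a : K) f i j : (a *: f) i j = a * f i j. Proof. by []. Qed.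
Lemma coefs1 i j : (1 : cps K) i j = ((i == 0%N) && (j == 0%N))%:R.
Proof. by []. Qed.
Lemma coefsM f g i j :
  (f * g) i j = \sum_(k < i.+1) \sum_(l < j.+1) f k l * g (i - k)%N (j - l)%N.
Proof. by []. Qed.

Lemma coefs_sum (I : Type) (r : seq I) (P : pred I) (F : I -> cps K) i j :
  (\sum_(k <- r | P k) F k) i j = \sum_(k <- r | P k) F k i j.
Proof. by elim/big_rec2: _ => // k _ y _ <-. Qed.

Lemma coefsM_row0 f g i j : (forall k, (k < i)%N -> forall j, f k j = 0) ->
  (f * g) i j = \sum_(l < j.+1) f i l * g 0%N (j - l)%N.
Proof.
move=> f0; rewrite coefsM big_ord_recr/= subnn big1 ?add0r// => k _.
by rewrite big1// => l _; rewrite f0// mul0r.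
Qed.

Lemma mulc_mono (c : nat -> nat -> K) a b i j : Defs.mulc (monoc a b) c i j =
  if (a <= i)%N && (b <= j)%N then c (i - a)%N (j - b)%N else 0.
Proof.
rewrite /Defs.mulc /monoc.
have [ai|ai] := leqP a i; last first.
  apply: big1 => k _; apply: big1 => l _.
  by rewrite ltn_eqF ?mul0r// (leq_ltn_trans _ ai)// -ltnS.
rewrite (bigD1 (Ordinal (ai : (a < i.+1)%N)))//= eqxx/= addrC big1 ?add0r; last first.
  move=> k ka; apply: big1 => l _; rewrite (_ : (k == a :> nat) = false) ?mul0r//.
  by apply/negbTE; apply: contra ka => /eqP ka; apply/eqP/val_inj.
have [bj|bj] := leqP b j; last first.
  by apply: big1 => l _; rewrite ltn_eqF ?mul0r// (leq_ltn_trans _ bj)// -ltnS.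
rewrite (bigD1 (Ordinal (bj : (b < j.+1)%N)))//= eqxx mul1r big1 ?addr0// => l lb.
rewrite (_ : (l == b :> nat) = false) ?mul0r//.
by apply/negbTE; apply: contra lb => /eqP lb; apply/eqP/val_inj.
Qed.

Lemma mono_cpsM a b c d :
  mono_cps a b * mono_cps c d = mono_cps (a + c) (b + d) :> cps K.
Proof.
apply: cpsP => i j; rewrite [LHS]mulc_mono /= /monoc.
have [ai|ai] := leqP a i; have [bj|bj] := leqP b j => /=; last 3 first.
- by rewrite (_ : (j == _) = false) ?andbF//; lia.
- by rewrite (_ : (i == _) = false)//; lia.
- by rewrite (_ : (i == _) = false)//; lia.
by rewrite -(eqn_add2l a (i - a)) -(eqn_add2l b (j - b)) !subnKC.
Qed.

Lemma cpsXn a : cpsX ^+ a = mono_cps a 0 :> cps K.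
Proof. by elim: a => // a IHa; rewrite exprS IHa mono_cpsM. Qed.

Lemma cpsYn b : cpsY ^+ b = mono_cps 0 b :> cps K.
Proof. by elim: b => // b IHb; rewrite exprS IHb mono_cpsM. Qed.

Lemma coefsXnM a f i j :
  (cpsX ^+ a * f) i j = if (a <= i)%N then f (i - a)%N j else 0.
Proof. by rewrite cpsXn [LHS]mulc_mono /= subn0 andbT. Qed.

Lemma coefsYnM b f i j :
  (cpsY ^+ b * f) i j = if (b <= j)%N then f i (j - b)%N else 0.
Proof. by rewrite cpsYn [LHS]mulc_mono /= subn0. Qed.

End Coefficients.

(* The radii of the two variables are decoupled by rescaling the rows: [bnd]   *)
(* bounds the norm on the polydisc of radii [t * s] and [s].                   *)
Section Norms.
Context {K : numFieldType}.
Implicit Types (c d : nat -> nat -> K) (f g u v : cps K) (t s r C D : K).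

Lemma abs_psum_ge0 c s N : 0 <= s -> 0 <= abs_psum c s N.
Proof.
by move=> s0; do 2 (apply: sumr_ge0 => ? _); rewrite mulr_ge0 ?exprn_ge0.
Qed.

Lemma abs_psum_coef_le c d r s N :
  (forall i j, (i < N)%N -> (j < N)%N ->
    `|c i j| * r ^+ (i + j) <= `|d i j| * s ^+ (i + j)) ->
  abs_psum c r N <= abs_psum d s N.
Proof. by move=> cd; apply: ler_sum => i _; apply: ler_sum => j _; exact: cd. Qed.

Definition rowscale t c : nat -> nat -> K := fun i j => t ^+ i * c i j.

Definition bnd t s c C : Prop := forall N, abs_psum (rowscale t c) s N <= C.

Lemma bnd_ge0 t s c C : bnd t s c C -> 0 <= C.
Proof. by move/(_ 0%N); rewrite /abs_psum big_ord0. Qed.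

Lemma bnd_mul t s c d C D : 0 < s ->
  bnd t s c C -> bnd t s d D -> bnd t s (Defs.mulc c d) (C * D).
Proof.
move=> s0 cC dD N.
have -> : rowscale t (Defs.mulc c d) = Defs.mulc (rowscale t c) (rowscale t d).
  apply/funext => i; apply/funext => j; rewrite /rowscale /Defs.mulc mulr_sumr.
  apply: eq_bigr => k _; rewrite mulr_sumr; apply: eq_bigr => l _.
  by rewrite mulrACA -exprD subnKC// -ltnS.
apply: le_trans (abs_psum_mul _ _ _ s0) _.
by apply: ler_pM => //; apply: abs_psum_ge0; exact: ltW.
Qed.

Lemma bnd_opp t s c C : bnd t s c C -> bnd t s (- c) C.
Proof.
move=> cC N; apply: le_trans (cC N); apply: abs_psum_coef_le => i j _ _.
by rewrite /rowscale !fctE mulrN normrN.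
Qed.

Lemma bnd_convergent t s c C : 0 < t -> t <= 1 -> 0 < s ->
  bnd t s c C -> convergent_prop c.
Proof.
move=> t0 t1 s0 cC; exists (t * s), C; split=> [|N]; first exact: mulr_gt0.
apply: le_trans (cC N); apply: abs_psum_coef_le => i j _ _.
rewrite /rowscale normrM (ger0_norm (exprn_ge0 _ (ltW t0))) exprMn mulrA.
rewrite ler_wpM2r ?exprn_ge0 ?(ltW s0)// mulrC ler_wpM2r//.
by rewrite ler_wiXn2l ?leq_addr// ltW.
Qed.

Lemma abs_psum_bnd t s c C : 0 <= t -> t <= 1 -> 0 <= s ->
  (forall N, abs_psum c s N <= C) -> bnd t s c C.
Proof.
move=> t0 t1 s0 cC N; apply: le_trans (cC N); apply: abs_psum_coef_le => i j _ _.
rewrite ler_wpM2r ?exprn_ge0// normrM ler_piMl//.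
by rewrite ger0_norm ?exprn_ge0// exprn_ile1.
Qed.

Lemma cps_radius f : exists s C : K, 0 < s /\ forall N, abs_psum f s N <= C.
Proof. by have /convergentP := valP f. Qed.

(** Every term of [f] has positive degree, so multiplying the radius by some [e <= 1] multiplies the
    norm by at most [e]. *)
Lemma abs_psum_small f r : f 0%N 0%N = 0 -> 0 < r ->
  exists s : K, 0 < s /\ forall N, abs_psum f s N <= r.
Proof.
move=> f0 r0; have [s [C [s0 fC]]] := cps_radius f.
have C0 : 0 <= C by have := fC 0%N; rewrite /abs_psum big_ord0.
have Cr : 0 < C + r by rewrite ltr_wpDl.
(* This denominator gives [e <= 1] and [e * C <= r] together, and it stays positive when [C = 0]. *)
pose e := r / (C + r); have e0 : 0 < e by rewrite divr_gt0.
have e1 : e <= 1 by rewrite ler_pdivrMr// mul1r lerDr.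
exists (e * s); split=> [|N]; first exact: mulr_gt0.
apply: (@le_trans _ _ (e * abs_psum f s N)); last first.
  apply: (@le_trans _ _ (e * C)); first by rewrite ler_wpM2l// ltW.
  by rewrite mulrAC ler_pdivrMr// ler_wpM2l ?(ltW r0)// lerDl ltW.
rewrite mulr_sumr; apply: ler_sum => i _; rewrite mulr_sumr; apply: ler_sum => j _.
rewrite mulrCA; case: (posnP (i + j)) => [ij0|ij].
  have [-> ->] : (i = 0 :> nat) /\ (j = 0 :> nat) by lia.
  by rewrite f0 normr0 !mul0r.
rewrite ler_wpM2l// exprMn ler_wpM2r ?exprn_ge0 ?(ltW s0)//.
by case: (i + j)%N ij => // n _; rewrite exprS ler_piMr ?(ltW e0)// exprn_ile1// ltW.
Qed.

Lemma abs_psum1 s N : 0 <= s -> abs_psum (1 : cps K) s N <= 1.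
Proof.
move=> s0; case: N => [|N]; first by rewrite /abs_psum big_ord0.
rewrite /abs_psum big_ord_recl [X in _ + X]big1 ?addr0 => [|i _]; last first.
  by rewrite big1// => j _; rewrite coefs1/= normr0 mul0r.
rewrite big_ord_recl [X in _ + X]big1 ?addr0 => [|j _]; last first.
  by rewrite coefs1/= normr0 mul0r.
by rewrite coefs1/= expr0 mulr1 normr1.
Qed.

Lemma sum_half (n : nat) C : 0 <= C -> \sum_(k < n) C / 2 ^+ k <= 2 * C.
Proof.
move=> C0; have -> : \sum_(k < n) C / 2 ^+ k = 2 * C - 2 * C / 2 ^+ n.
  elim: n => [|n IHn]; first by rewrite big_ord0 expr0 divr1 subrr.
  rewrite big_ord_recr/= IHn exprS; field.
  by rewrite expf_neq0//= pnatr_eq0.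
by rewrite gerBl divr_ge0 ?mulr_ge0 ?exprn_ge0// ?ler0n.
Qed.

(* The solution is the Neumann series [sum_k N^k u]; nilpotency of [N] for the *)
(* filtration by [mu] makes each of its coefficients a finite sum.            *)
Lemma neumann (N : cps K -> cps K) (mu : nat -> nat -> nat) t s u C :
  0 < t -> t <= 1 -> 0 < s ->
  (forall v w, N (v + w) = N v + N w) ->
  (forall i j, (mu i j <= i + j)%N) ->
  (forall v k, (forall i j, (mu i j < k)%N -> v i j = 0) ->
     forall i j, (mu i j < k.+1)%N -> N v i j = 0) ->
  (forall v D, bnd t s v D -> bnd t s (N v) (D / 2)) ->
  bnd t s u C -> exists U, U = u + N U.
Proof.
move=> t0 t1 s0 ND mu_le N_mu N_bnd uC.
have N0 : N 0 = 0 by apply: (addrI (N 0)); rewrite -ND !addr0.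
pose it k := iter k N u.
have it_mu k i j : (mu i j < k)%N -> it k i j = 0.
  by elim: k i j => [//|k IHk] i j; apply: N_mu.
have it_bnd k : bnd t s (it k) (C / 2 ^+ k).
  elim: k => [|k IHk]; first by rewrite expr0 divr1.
  rewrite exprSr invfM mulrA; exact: N_bnd.
(* The iterates of index greater than [mu i j] vanish at [(i, j)], so this finite sum is the whole
   series there. *)
pose U i j := \sum_(k < (mu i j).+1) it k i j.
have UE n i j : (mu i j < n)%N -> U i j = \sum_(k < n) it k i j.
  move=> mun; rewrite /U (big_ord_widen _ (fun k => it k i j) mun).
  rewrite [RHS](bigID (fun k : 'I_n => (k < (mu i j).+1)%N))/=.
  by rewrite [X in _ + X]big1 ?addr0// => k; rewrite -leqNgt => /it_mu.
have U_conv : U \in convergent.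
  apply/convergentP/(bnd_convergent t0 t1 s0 (C := 2 * C)) => M.
  (* On the square of side [M] one has [mu i j <= i + j < M + M], so [M + M] iterates give all its
     coefficients at once. *)
  apply: le_trans (sum_half (M + M) (bnd_ge0 uC)).
  apply: (@le_trans _ _ (\sum_(k < M + M) abs_psum (rowscale t (it k)) s M)); last first.
    by apply: ler_sum => k _; exact: it_bnd.
  rewrite exchange_big/=; apply: ler_sum => i _.
  rewrite exchange_big/=; apply: ler_sum => j _.
  rewrite -mulr_suml ler_wpM2r ?exprn_ge0 ?(ltW s0)// /rowscale (UE (M + M)%N).
    by rewrite mulr_sumr; exact: ler_norm_sum.
  by apply: leq_ltn_trans (mu_le i j) _; rewrite -addnS leq_add// ltnW.
exists (CPS U_conv); apply: cpsP => i j; set V := CPS U_conv.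
(* [V - S] vanishes up to level [mu i j], so [N (V - S)] vanishes at [(i, j)]. *)
pose S := \sum_(k < (mu i j).+1) it k.
have NV : N V i j = N S i j.
  rewrite -[V](subrK S) ND coefsD (N_mu _ (mu i j).+1) ?add0r//.
  move=> i' j' lt'; rewrite coefsB [V i' j'](UE (mu i j).+1)// /S.
  by rewrite coefs_sum subrr.
rewrite coefsD NV /S (big_morph N ND N0) coefs_sum/=.
rewrite [LHS](UE (mu i j).+2)// [in LHS]big_ord_recl/=.
rewrite big_ord_recr/= -[N _]/(it (mu i j).+1) [X in _ + (_ + X)]it_mu// addr0.
Qed.

End Norms.

(** * Units and Weierstrass division *)

Section Domain.
Context {K : numFieldType}.
Implicit Types (f g h : cps K) (s t C : K).

(** After division by the constant term, [f] is [1 + p] with [p] without constant term. The inverse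
    solves [U = 1 - p * U] by [neumann], for the filtration by total degree and on a polydisc where
    [p] has norm at most 1/2. *)
Lemma cps_unit_exists f : f 0%N 0%N != 0 -> exists g, g * f = 1.
Proof.
move=> f0; set c := f 0%N 0%N in f0.
pose p := c^-1 *: f - 1.
have p00 : p 0%N 0%N = 0 by rewrite coefsB coefsZ coefs1 mulVf ?subrr.
have half0 : 0 < 2^-1 :> K by rewrite invr_gt0 ltr0n.
have [s [s0 ps]] := abs_psum_small p00 half0.
have pb : bnd 1 s p 2^-1 := abs_psum_bnd ler01 (lexx _) (ltW s0) ps.
have [|||v D vD||U UE] := @neumann K (fun v => - (p * v)) addn 1 s 1 1 ltr01 (lexx _) s0.
- by move=> v w; rewrite mulrDr opprD.
- by [].
- move=> v k vk i j ijk; rewrite coefsN coefsM big1 ?oppr0// => a _; rewrite big1// => b _.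
  case: (posnP (a + b)) => [ab0|ab].
    have [-> ->] : (a = 0 :> nat) /\ (b = 0 :> nat) by lia.
    by rewrite p00 mul0r.
  by rewrite vk ?mulr0//; have := ltn_ord a; have := ltn_ord b; lia.
- by apply: bnd_opp; rewrite (mulrC p); apply: bnd_mul.
- by apply: abs_psum_bnd ler01 (lexx _) (ltW s0) _ => N; exact: abs_psum1 (ltW s0).
exists (c^-1 *: U); rewrite -scalerAl scalerAr.
have -> : c^-1 *: f = 1 + p by rewrite /p addrC subrK.
by rewrite mulrDr mulr1 {1}UE mulrC subrK.
Qed.

Definition cps_unit : pred (cps K) := fun f => f 0%N 0%N != 0.
Definition cps_inv f : cps K :=
  if pselect (exists g, g * f = 1) is left fV then sval (cid fV) else f.

Lemma coef00M f g : (f * g) 0%N 0%N = f 0%N 0%N * g 0%N 0%N.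
Proof. by rewrite coefsM !big_ord1 !subnn. Qed.

Lemma cps_mulVr : {in cps_unit, left_inverse 1 cps_inv *%R}.
Proof.
move=> f /cps_unit_exists fV; rewrite /cps_inv.
by case: pselect => // fV'; exact: (svalP (cid fV')).
Qed.

Lemma cps_unitP f g : g * f = 1 -> cps_unit f.
Proof.
move=> gf; apply/eqP => f0; have := congr1 (fun u : cps K => u 0%N 0%N) gf.
by rewrite coef00M f0 mulr0 coefs1/= => /eqP; rewrite eq_sym oner_eq0.
Qed.

Lemma cps_inv_out : {in [predC cps_unit], cps_inv =1 id}.
Proof.
move=> f; rewrite inE /= => fU; rewrite /cps_inv; case: pselect => // -[g gf].
by have := cps_unitP gf; rewrite -[cps_unit f]/(f \in cps_unit) (negbTE fU).
Qed.

HB.instance Definition _ := GRing.ComNzRing_hasMulInverse.Build (cps K)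
  cps_mulVr cps_unitP cps_inv_out.

Lemma cps_unitE f : (f \is a GRing.unit) = (f 0%N 0%N != 0).
Proof. by []. Qed.

Lemma low_row f : f != 0 -> exists i, (exists j, f i j != 0) /\
  forall k, (k < i)%N -> forall j, f k j = 0.
Proof.
move=> f0; have ex : exists i, `[< exists j, f i j != 0 >].
  apply/not_existsP => H; move/eqP: f0; apply; apply: cpsP => i j.
  by apply/eqP/negPn/negP => fij; apply: (H i); apply/asboolP; exists j.
case: (ex_minnP ex) => i /asboolP fi imin; exists i; split=> // k ki j.
apply/eqP/negPn/negP => fkj; have := imin k; rewrite leqNgt ki => /implyP.
by rewrite implybF => /asboolP; apply; exists j.
Qed.

Definition yorder (c : nat -> K) d := (forall j, (j < d)%N -> c j = 0) /\ c d != 0.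

Lemma yorder_exists (c : nat -> K) : (exists j, c j != 0) -> exists d, yorder c d.
Proof.
move=> ex; case: (ex_minnP ex) => d cd dmin; exists d; split=> // j jd.
by apply/eqP/negPn/negP => /dmin; rewrite leqNgt jd.
Qed.

Lemma yorder_conv (c e : nat -> K) d d' : yorder c d -> yorder e d' ->
  yorder (fun j => \sum_(l < j.+1) c l * e (j - l)%N) (d + d').
Proof.
move=> [c0 cd] [e0 ed]; split=> [j jd|].
  apply: big1 => l _; have [ld|ld] := ltnP l d; first by rewrite c0// mul0r.
  by rewrite e0 ?mulr0//; have := ltn_ord l; lia.
have dd : (d < (d + d').+1)%N by lia.
rewrite (bigD1 (Ordinal dd))//= addKn big1 ?addr0 ?mulf_neq0// => l lNd.
have {}lNd : (l != d :> nat) by apply: contra lNd => /eqP ld; apply/eqP/val_inj.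
have [ld|ld] := ltnP l d; first by rewrite c0// mul0r.
by rewrite e0 ?mulr0//; have := ltn_ord l; lia.
Qed.

(** The lowest nonzero rows of the factors multiply as series in [Y], whose orders add. *)
Lemma cps_integral f g : f * g = 0 -> (f == 0) || (g == 0).
Proof.
move=> fg; apply/negPn/negP; rewrite negb_or => /andP[/low_row[i [fi fi0]] /low_row[k [gk gk0]]].
have [d fd] := yorder_exists fi; have [d' gd] := yorder_exists gk.
have [_] := yorder_conv fd gd; rewrite (_ : \sum_(l < _) _ = (f * g) (i + k)%N (d + d')%N).
  by rewrite fg coefs0 eqxx.
have ik : (i < (i + k).+1)%N by lia.
rewrite coefsM (bigD1 (Ordinal ik))//= addKn [X in _ + X]big1 ?addr0// => l lNi.
have {}lNi : (l != i :> nat) by apply: contra lNi => /eqP ld; apply/eqP/val_inj.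
apply: big1 => j _; have [ld|ld] := ltnP l i; first by rewrite fi0// mul0r.
by rewrite gk0 ?mulr0//; have := ltn_ord l; lia.
Qed.

HB.instance Definition _ :=
  GRing.ComUnitRing_isIntegral.Build (cps K) cps_integral.

Definition yshift d (c : nat -> nat -> K) : nat -> nat -> K :=
  fun i j => c i (d + j)%N.

(** The cost [s ^- d] does not depend on the radius in [X]; Weierstrass division exploits this by
    shrinking [t] alone. *)
Lemma bnd_yshift d t s c C : 0 < t -> 0 < s ->
  bnd t s c C -> bnd t s (yshift d c) (C / s ^+ d).
Proof.
move=> t0 s0 cC N; rewrite ler_pdivlMr ?exprn_gt0//.
apply: le_trans (cC (d + N)%N); rewrite /abs_psum addnC [leRHS]big_split_ord/= addnC.
rewrite -[leLHS]addr0 lerD ?sumr_ge0//; last first.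
  by move=> i _; rewrite sumr_ge0// => j _; rewrite mulr_ge0 ?exprn_ge0 ?(ltW s0).
rewrite mulr_suml; apply: ler_sum => i _; rewrite [leRHS]big_split_ord/= mulr_suml.
rewrite -[leLHS]add0r lerD ?sumr_ge0//.
  by move=> j _; rewrite mulr_ge0 ?exprn_ge0 ?(ltW s0).
by apply: ler_sum => j _; rewrite -mulrA -exprD (addnC (i + j)%N) addnCA.
Qed.

Lemma convergent_yshift d f : yshift d f \in convergent.
Proof.
have [s [C [s0 fC]]] := cps_radius f.
apply/convergentP/(bnd_convergent ltr01 (lexx _) s0).
by apply: bnd_yshift => //; apply: abs_psum_bnd (ltW s0) fC.
Qed.

Definition yshift_cps d f : cps K := CPS (convergent_yshift d f).

(** Up to the unit [e], [g] is [Y^d + p] with [p] divisible by [X]. Let [U] solve [U = u - p W],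
    where [W] is [U] with the terms below [Y^d] dropped, divided by [Y^d]. Then
    [u = (Y^d + p) W + r], where [r] consists of the dropped terms. The equation is solved by
    [neumann] for the filtration by powers of [X]. *)
Theorem weierstrass_division g d u : yorder (g 0%N) d ->
  exists q r, u = q * g + r /\ forall i j, (d <= j)%N -> r i j = 0.
Proof.
move=> [g0 gd]; pose e := yshift_cps d g.
have eU : e \is a GRing.unit by rewrite cps_unitE /e /= /yshift addn0.
pose p := (g - cpsY ^+ d * e) / e.
have p0 j : p 0%N j = 0.
  rewrite coefsM big_ord1 big1// => l _; rewrite coefsB coefsYnM/= /yshift.
  by case: leqP => [dl|ld]; rewrite ?subnKC ?subrr ?g0 ?subr0 ?mul0r.
have [s [C [s0 puC]]] := common_radius (convergentP _ (valP p)) (convergentP _ (valP u)).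
have pC N : abs_psum p s N <= C := (puC N).1.
have uC N : abs_psum u s N <= C := (puC N).2.
have C0 : 0 <= C by have := pC 0%N; rewrite /abs_psum big_ord0.
have C1 : 0 < C + 1 by rewrite ltr_wpDl.
have sd0 : 0 < s ^+ d by rewrite exprn_gt0.
(* Division by [Y^d] costs [s ^- d], so [p] must have norm at most [s ^+ d / 2]. As [X] divides [p],
   its norm is at most [t * C]; and [a / (1 + a)] lies below both [a] and 1. *)
pose a := s ^+ d / (2 * (C + 1)); pose t := a / (1 + a).
have a0 : 0 < a by rewrite divr_gt0 ?mulr_gt0.
have a1 : 0 < 1 + a by rewrite addr_gt0.
have t0 : 0 < t by rewrite divr_gt0.
have t1 : t <= 1 by rewrite ler_pdivrMr// mul1r lerDr.
have ta : t <= a by rewrite ler_pdivrMr// mulrDr mulr1 lerDl mulr_ge0 ?ltW.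
have pb : bnd t s p (s ^+ d / 2).
  move=> N; apply: (@le_trans _ _ (t * abs_psum p s N)); last first.
    apply: (@le_trans _ _ (a * (C + 1))).
      apply: ler_pM; rewrite ?(ltW t0)// ?(abs_psum_ge0 _ _ (ltW s0))//.
      by apply: le_trans (pC N) _; rewrite lerDl.
    by rewrite /a invfM mulrA mulfVK// gt_eqF.
  rewrite mulr_sumr; apply: ler_sum => i _; rewrite mulr_sumr; apply: ler_sum => j _.
  rewrite /rowscale; case: (nat_of_ord i) => [|n].
    by rewrite p0 mulr0 normr0 !mul0r mulr0.
  rewrite mulrA ler_wpM2r ?exprn_ge0 ?(ltW s0)// normrM ler_wpM2r//.
  rewrite ger0_norm ?exprn_ge0 ?(ltW t0)// exprS ler_piMr ?(ltW t0)//.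
  by rewrite exprn_ile1// ltW.
have [|||v D vD||U UE] := @neumann K (fun v => - (p * yshift_cps d v))
    (fun i j => i) t s u C t0 t1 s0.
- by move=> v w; rewrite -opprD -mulrDr; congr (- (_ * _)); apply: cpsP.
- by move=> i j; exact: leq_addr.
- move=> v k vk i j ijk; rewrite coefsN coefsM big1 ?oppr0// => -[[|b] bi] _.
    by apply: big1 => l _; rewrite [p _ _](p0 l) mul0r.
  apply: big1 => l _; rewrite [yshift_cps d v _ _](_ : _ = 0) ?mulr0//.
  by apply: vk => /=; clear -ijk bi; lia.
- have := bnd_mul s0 pb (bnd_yshift d t0 s0 vD).
  rewrite mulrC -mulrA mulKf ?gt_eqF// => /bnd_opp; exact.
- exact: abs_psum_bnd (ltW t0) t1 (ltW s0) uC.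
exists (e^-1 * yshift_cps d U), (U - cpsY ^+ d * yshift_cps d U); split; last first.
  by move=> i j dj; rewrite coefsB coefsYnM dj /= /yshift subnKC ?subrr.
rewrite mulrAC; set W := yshift_cps d U.
have -> : e^-1 * g = p + cpsY ^+ d.
  apply: (mulrI eU); rewrite mulVKr// mulrDr /p mulrCA mulrV// mulr1 mulrC.
  by rewrite (mulrC _ (cpsY ^+ d)) subrK.
have -> : u = U + p * W by rewrite {1}UE subrK.
by ring.
Qed.

End Domain.

(** * Substitution *)

Section Substitution.
Context {K : numFieldType}.
Implicit Types (f g u v w : cps K) (s : K).

Definition rows_from n f := forall i, (i < n)%N -> forall j, f i j = 0.

Lemma rows_fromM m n f g : rows_from m f -> rows_from n g ->
  rows_from (m + n) (f * g).
Proof.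
move=> fm gn i imn j; rewrite coefsM; apply: big1 => k _; apply: big1 => l _.
have [km|km] := ltnP k m; first by rewrite fm// mul0r.
by rewrite gn ?mulr0//; have := ltn_ord k; lia.
Qed.

Lemma rows_fromX n f : rows_from 1 f -> rows_from n (f ^+ n).
Proof.
by move=> f1; elim: n => // n IHn; rewrite exprS -add1n; exact: rows_fromM.
Qed.

Lemma coefsM_rows f f' g g' n : rows_from n (f - f') -> rows_from n (g - g') ->
  rows_from n (f * g - f' * g').
Proof.
move=> ff gg i iN j; rewrite coefsB !coefsM -sumrB big1// => k _.
rewrite -sumrB big1// => l _; have kn : (k < n)%N by have := ltn_ord k; lia.
have := ff k kn l; rewrite coefsB => /subr0_eq ->.
have ikn : (i - k < n)%N by lia.
by have := gg _ ikn (j - l)%N; rewrite coefsB => /subr0_eq ->; rewrite subrr.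
Qed.

Context (u v : cps K) (u1 : rows_from 1 u) (v1 : rows_from 1 v).

Definition psubst_coefs f : nat -> nat -> K := fun i j =>
  (\sum_(a < i.+1) \sum_(b < i.+1) f a b *: (u ^+ a * v ^+ b)) i j.

Definition psubst_sum n f : cps K :=
  \sum_(a < n) \sum_(b < n) f a b *: (u ^+ a * v ^+ b).

Lemma term_rows a b : rows_from (a + b) (u ^+ a * v ^+ b).
Proof. by apply: rows_fromM; exact: rows_fromX. Qed.

(** [u^a v^b] is divisible by [X^(a + b)], so a term with an exponent at least [n] does not reach
    row [i]. *)
Lemma double_sum_widen (c : nat -> nat -> K) n N i j : (i < n)%N -> (n <= N)%N ->
  (\sum_(a < n) \sum_(b < n) c a b *: (u ^+ a * v ^+ b)) i j =
  (\sum_(a < N) \sum_(b < N) c a b *: (u ^+ a * v ^+ b)) i j.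
Proof.
move=> iN nN; rewrite !coefs_sum.
rewrite (big_ord_widen _ (fun a => (\sum_(b < n) c a b *: (u ^+ a * v ^+ b)) i j) nN).
rewrite [RHS](bigID (fun k : 'I_N => (k < n)%N))/=.
rewrite [X in _ + X]big1 ?addr0 => [|a an]; last first.
  by rewrite coefs_sum big1// => b _; rewrite coefsZ term_rows ?mulr0//; lia.
apply: eq_bigr => a _; rewrite !coefs_sum.
rewrite (big_ord_widen _ (fun b => (c a b *: (u ^+ a * v ^+ b)) i j) nN).
rewrite [RHS](bigID (fun k : 'I_N => (k < n)%N))/=.
rewrite [X in _ + X]big1 ?addr0// => b bn.
by rewrite -[Defs.mulc _ _ _ _]/((u ^+ a * v ^+ b) i j) term_rows ?mulr0//; lia.
Qed.

Lemma psubst_sumE n f i j : (i < n)%N -> psubst_coefs f i j = psubst_sum n f i j.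
Proof. by move=> iN; exact: double_sum_widen. Qed.

Lemma abs_psum_term s r a b N : 0 < s -> (forall N, abs_psum u s N <= r) ->
  (forall N, abs_psum v s N <= r) -> abs_psum (u ^+ a * v ^+ b) s N <= r ^+ (a + b).
Proof.
move=> s0 ur vr; have s0' := ltW s0.
have power w n : (forall N, abs_psum w s N <= r) -> abs_psum (w ^+ n) s N <= r ^+ n.
  move=> wr; elim: n => [|n IHn]; first exact: abs_psum1.
  rewrite !exprS; apply: le_trans (abs_psum_mul _ _ _ s0) _.
  by apply: ler_pM; rewrite ?abs_psum_ge0.
apply: le_trans (abs_psum_mul _ _ _ s0) _; rewrite exprD.
by apply: ler_pM; rewrite ?abs_psum_ge0 ?power.
Qed.

(** [u] and [v] have no constant term, so on a small polydisc both have norm at most a radius [r] of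
    convergence of [f], and the terms are dominated by those of [f] at [r]. *)
Lemma convergent_psubst f : psubst_coefs f \in convergent.
Proof.
have [r [C [r0 fC]]] := cps_radius f; apply/convergentP.
have [s [s0 us]] := abs_psum_small (u1 (ltnSn 0) 0%N) r0.
have [t [t0 vt]] := abs_psum_small (v1 (ltnSn 0) 0%N) r0.
have st0 : 0 < s + t by rewrite addr_gt0.
pose e := s * t / (s + t).
have e0 : 0 < e by rewrite divr_gt0// mulr_gt0.
have es : e <= s by rewrite ler_pdivrMr// ler_pM2l// lerDr ltW.
have et : e <= t by rewrite ler_pdivrMr// mulrC ler_pM2l// lerDl ltW.
have ue N : abs_psum u e N <= r.
  exact: le_trans (abs_psum_le _ _ (ltW e0) es) (us N).
have ve N : abs_psum v e N <= r.
  exact: le_trans (abs_psum_le _ _ (ltW e0) et) (vt N).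
exists e, C; split=> // N; apply: le_trans (fC N).
apply: (@le_trans _ _ (\sum_(a < N) \sum_(b < N)
    `|f a b| * abs_psum (u ^+ a * v ^+ b) e N)); last first.
  apply: ler_sum => a _; apply: ler_sum => b _.
  by rewrite ler_wpM2l// abs_psum_term.
under [leRHS]eq_bigr do under eq_bigr do rewrite mulr_sumr.
under [leRHS]eq_bigr do rewrite exchange_big.
rewrite exchange_big/=; apply: ler_sum => i _.
under [leRHS]eq_bigr do under eq_bigr do rewrite mulr_sumr.
under [leRHS]eq_bigr do rewrite exchange_big.
rewrite exchange_big/=; apply: ler_sum => j _.
rewrite (psubst_sumE _ _ (ltn_ord i)) coefs_sum.
under [leRHS]eq_bigr do under eq_bigr do rewrite mulrA.
under [leRHS]eq_bigr do rewrite -mulr_suml.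
rewrite -mulr_suml ler_wpM2r ?exprn_ge0 ?(ltW e0)//.
apply: le_trans (ler_norm_sum _ _ _) _; apply: ler_sum => a _.
rewrite coefs_sum; apply: le_trans (ler_norm_sum _ _ _) _; apply: ler_sum => b _.
by rewrite coefsZ normrM.
Qed.

Definition psubst f : cps K := CPS (convergent_psubst f).

(** For polynomials, evaluation at [(u, v)] is a ring morphism. [psubst] agrees with it on
    truncations modulo powers of [X], and this is how [psubst] becomes multiplicative. *)
Definition poly2_eval (p : {poly {poly K}}) : cps K :=
  (map_poly (horner_eval v \o map_poly (in_alg (cps K))) p).[u].

Lemma poly2_evalM p q : poly2_eval (p * q) = poly2_eval p * poly2_eval q.
Proof. by rewrite /poly2_eval rmorphM hornerM. Qed.

Lemma poly2_evalE (p : {poly {poly K}}) N : (size p <= N)%N -> (forall a, (size (p`_a)%R <= N)%N) ->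
  poly2_eval p = \sum_(a < N) \sum_(b < N) p`_a`_b *: (u ^+ a * v ^+ b).
Proof.
move=> pN pN'; rewrite /poly2_eval (horner_coef_wide _ (n := N)); last first.
  exact: leq_trans (size_poly _ _) pN.
apply: eq_bigr => a _; rewrite coef_map /= /horner_eval (horner_coef_wide _ (n := N)); last first.
  exact: leq_trans (size_poly _ _) (pN' _).
rewrite mulr_suml; apply: eq_bigr => b _; rewrite coef_map /=.
by rewrite -!scalerAl mul1r mulrC.
Qed.

Lemma poly2_eval_trunc n f : poly2_eval (trunc n f) = psubst_sum n f.
Proof.
rewrite (poly2_evalE (N := n)) ?size_poly// => [|a].
  by apply: eq_bigr => a _; apply: eq_bigr => b _; rewrite coef_trunc.
by rewrite coef_poly; case: ifP => _; rewrite ?size_poly// size_polyC eqxx.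
Qed.

Lemma psubst_rows n f : rows_from n (psubst f - psubst_sum n f).
Proof. by move=> i iN j; rewrite coefsB [psubst f i j](psubst_sumE _ _ iN) subrr. Qed.

Lemma psubstM f g : psubst (f * g) = psubst f * psubst g.
Proof.
apply: cpsP => i j.
have := coefsM_rows (@psubst_rows i.+1 f) (@psubst_rows i.+1 g) (ltnSn i) j.
rewrite coefsB => /subr0_eq ->.
rewrite -!poly2_eval_trunc -poly2_evalM; set p := trunc _ f * trunc _ g.
rewrite [LHS](psubst_sumE _ _ (ltnSn i)).
pose N := maxn (maxn i.+1 (size p)) (\max_(a < size p) size (p`_a)%R).
have pN a : (size (p`_a)%R <= N)%N.
  have [pa|pa] := leqP (size p) a; first by rewrite nth_default ?size_poly0.
  by rewrite /N leq_max (leq_bigmax (Ordinal pa)) orbT.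
have pN' : (size p <= N)%N by rewrite /N !leq_max leqnn orbT.
rewrite (poly2_evalE pN' pN).
have iN : (i.+1 <= N)%N by rewrite /N !leq_max leqnn.
rewrite -(double_sum_widen (fun a b => p`_a`_b) j (ltnSn i) iN).
rewrite !coefs_sum; apply: eq_bigr => a _; rewrite !coefs_sum; apply: eq_bigr => b _.
by rewrite !coefsZ; congr (_ * _); exact: mulc_trunc.
Qed.

Lemma psubst1 : psubst 1 = 1.
Proof.
apply: cpsP => i j; rewrite [LHS](psubst_sumE _ _ (ltnSn i)).
rewrite /psubst_sum big_ord_recl [X in _ + X]big1 ?addr0 => [|a _]; last first.
  by rewrite big1// => b _; rewrite coefs1/= scale0r.
rewrite big_ord_recl [X in _ + X]big1 ?addr0 => [|b _]; last first.
  by rewrite coefs1/= scale0r.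
by rewrite coefs1 scale1r !expr0 mul1r.
Qed.

Lemma psubst_linear : linear psubst.
Proof.
move=> a f g; apply: cpsP => i j; rewrite coefsD coefsZ /= /psubst_coefs !coefs_sum.
rewrite mulr_sumr -big_split; apply: eq_bigr => k _.
rewrite !coefs_sum mulr_sumr -big_split; apply: eq_bigr => l _.
by rewrite !coefsZ coefsD coefsZ mulrDl mulrA.
Qed.

HB.instance Definition _ := GRing.isLinear.Build K (cps K) (cps K) _ psubst
  psubst_linear.
HB.instance Definition _ := GRing.isMonoidMorphism.Build (cps K) (cps K) psubst
  (psubst1, psubstM).

End Substitution.

(** * Relative dimension *)

Section RelativeDimension.
Context {R : realType} {K : numFieldType}.
Implicit Types (V : lmodType K) (n m : nat).

Definition is_submod V (U : set V) : Prop :=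
  U 0 /\ forall (a : K) u v, U u -> U v -> U (a *: u + v).

Section Subspace.
Context {V : lmodType K} {U : set V} (sU : is_submod U).

Lemma submodD u v : U u -> U v -> U (u + v).
Proof. by move=> Uu Uv; rewrite -[u]scale1r; exact: sU.2. Qed.

Lemma submodZ (a : K) u : U u -> U (a *: u).
Proof. by move=> Uu; rewrite -[_ *: _]addr0; apply: sU.2 => //; exact: sU.1. Qed.

Lemma submodB u v : U u -> U v -> U (u - v).
Proof. by move=> Uu Uv; apply: submodD => //; rewrite -scaleN1r; exact: submodZ. Qed.

Lemma submodBr u v : U (u - v) -> U v -> U u.
Proof. by move=> uv Uv; rewrite -[u](subrK v); exact: submodD. Qed.

Lemma submod_sum (I : Type) (r : seq I) (P : pred I) (F : I -> V) :
  (forall i, P i -> U (F i)) -> U (\sum_(i <- r | P i) F i).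
Proof. by move=> UF; elim/big_ind: _ => //; [exact: sU.1|exact: submodD]. Qed.

End Subspace.

Definition indep_mod V (U : set V) n (e : 'I_n -> V) : Prop :=
  forall c : 'I_n -> K, U (\sum_i c i *: e i) -> forall i, c i = 0.

Definition span_mod V (W U : set V) n (e : 'I_n -> V) : Prop :=
  forall v, W v -> exists c : 'I_n -> K, U (v - \sum_i c i *: e i).

(** [U] may stick out of [W]: the dimension is that of the image of [W] in [V / U]. *)
Definition fdim V (W U : set V) n : Prop := exists e : 'I_n -> V,
  [/\ forall i, W (e i), indep_mod U e & span_mod W U e].

(** If [m] exceeded [n], the matrix expressing [d] through [e] modulo [U] would have a nonzero left
    kernel, hence a relation among the [d i]. *)
Lemma span_indep_le V (W U : set V) n m (e : 'I_n -> V) (d : 'I_m -> V) :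
  is_submod U -> span_mod W U e -> (forall i, W (d i)) -> indep_mod U d ->
  (m <= n)%N.
Proof.
move=> sU eW Wd dU; rewrite leqNgt; apply/negP => nm.
have [M MP] := choice (fun i => eW _ (Wd i)).
pose A := \matrix_(i, j) M i j.
have : kermx A != 0.
  rewrite -mxrank_eq0 mxrank_ker -lt0n subn_gt0.
  exact: leq_ltn_trans (rank_leq_col _) nm.
case/rowV0Pn => v /sub_kermxP vA0 v0; move/eqP: v0; apply; apply/rowP => i; rewrite mxE.
have vA j : \sum_i v 0 i * M i j = 0.
  have := congr1 (fun B : 'rV_n => B 0 j) vA0; rewrite !mxE => vA0j.
  by rewrite -[RHS]vA0j; apply: eq_bigr => k _; rewrite mxE.
apply: (dU (fun i => v 0 i)); have -> : \sum_i v 0 i *: d i =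
    \sum_i v 0 i *: (d i - \sum_j M i j *: e j).
  under [RHS]eq_bigr do rewrite scalerBr.
  rewrite sumrB [X in _ - X](_ : _ = 0) ?subr0//.
  under eq_bigr do rewrite scaler_sumr.
  rewrite exchange_big big1// => j _; under eq_bigr do rewrite scalerA.
  by rewrite -scaler_suml vA scale0r.
by apply: submod_sum => // k _; apply: submodZ.
Qed.

Lemma fdim_uniq V (W U : set V) n m : is_submod U ->
  fdim W U n -> fdim W U m -> n = m.
Proof.
move=> sU [e [We eU eW]] [d [Wd dU dW]]; apply/eqP; rewrite eqn_leq.
by rewrite (span_indep_le sU dW We eU) (span_indep_le sU eW Wd dU).
Qed.

(** An independent family of maximal size spans, since any further vector makes it dependent. *)
Lemma bounded_fdim V (W U : set V) n : is_submod W -> is_submod U ->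
  (forall m (e : 'I_m -> V), (forall i, W (e i)) -> indep_mod U e -> (m <= n)%N) ->
  exists2 m, (m <= n)%N & fdim W U m.
Proof.
move=> sW sU bd.
pose P m := `[< exists2 e : 'I_m -> V, forall i, W (e i) & indep_mod U e >].
have exP : exists m, P m.
  exists 0%N; apply/asboolP; exists (fun => 0) => [i|c _ []//]; exact: sW.1.
have Pn m : P m -> (m <= n)%N by move=> /asboolP[e We eU]; exact: bd We eU.
case: (ex_maxnP exP Pn) => m Pm mmax.
exists m; first exact: Pn.
case/asboolP: Pm => e We eU; exists e; split=> // v Wv.
have : ~ exists2 d : 'I_m.+1 -> V, forall i, W (d i) & indep_mod U d.
  by move=> H; have /mmax := asboolT H; rewrite ltnn.
(* This family is [e] with [v] appended at the last index. *)
move/forall2NP => /(_ (fun i => oapp e v (unlift ord_max i))) [[]|].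
  by move=> i; case: unliftP => [j|] _ /=.
move=> /existsNP[c /not_implyP[Uc /existsNP[i ci]]].
have wl (k : 'I_m) : widen_ord (leqnSn m) k = lift ord_max k.
  by apply: val_inj; rewrite /= /bump leqNgt ltn_ord.
move: Uc; rewrite big_ord_recr/= unlift_none/=.
under eq_bigr => k _ do rewrite wl liftK/=.
move=> Uc; have c0 : c ord_max != 0.
  apply/eqP => c0; apply: ci; move: Uc; rewrite c0 scale0r addr0 => /eU cw.
  by case: (unliftP ord_max i) => [j ->|->].
exists (fun k => - ((c ord_max)^-1 * c (lift ord_max k))).
move/(submodZ sU (c ord_max)^-1): Uc.
rewrite scalerDr scalerA mulVf// scale1r addrC scaler_sumr -sumrN.
by under eq_bigr do rewrite scalerA -[_ *: _]opprK -scaleNr.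
Qed.

Lemma fdim_add V (Z W U : set V) a b : is_submod W ->
  U `<=` W -> W `<=` Z -> fdim Z W a -> fdim W U b -> fdim Z U (a + b)%N.
Proof.
move=> sW UW WZ [e [Ze eW We]] [d [Wd dU Ud]].
exists (fun i => match fintype.split i with inl i => e i | inr j => d j end); split.
- by move=> i; case: (fintype.split i) => // j; exact: WZ.
- move=> c; rewrite big_split_ord/=.
  under eq_bigr => i _ do rewrite (fintype.unsplitK (inl i)).
  under [X in U (_ + X)]eq_bigr => i _ do rewrite (fintype.unsplitK (inr i)).
  set A := (X in U (X + _)); set B := (X in U (_ + X)) => UAB.
  have WB : W B by apply: submod_sum => // i _; exact: submodZ.
  have WA : W A by have := submodB sW (UW _ UAB) WB; rewrite addrK.
  have cl := eW _ WA.
  have A0 : A = 0 by rewrite /A big1// => i _; rewrite cl scale0r.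
  move: UAB; rewrite A0 add0r => /dU cr i.
  by rewrite -(fintype.splitK i); case: (fintype.split i) => j; [exact: cl|exact: cr].
- move=> v Zv; have [c vc] := We v Zv; have [c' vc'] := Ud _ vc.
  exists (fun i => match fintype.split i with inl i => c i | inr j => c' j end).
  rewrite big_split_ord/= opprD addrA.
  under eq_bigr => i _ do rewrite (fintype.unsplitK (inl i)).
  by under [X in U (_ - X)]eq_bigr => i _ do rewrite (fintype.unsplitK (inr i)).
Qed.

Lemma fdim_bound V (W U : set V) n m (e : 'I_m -> V) : is_submod U ->
  fdim W U n -> (forall i, W (e i)) -> indep_mod U e -> (m <= n)%N.
Proof. by move=> sU [d [_ _ dW]]; exact: span_indep_le sU dW. Qed.

Lemma fdim_sub V (Z W U : set V) n : is_submod W -> is_submod U ->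
  W `<=` Z -> fdim Z U n -> exists m, fdim W U m.
Proof.
move=> sW sU WZ ZU.
have [|m _ mU] := @bounded_fdim _ W U n sW sU; last by exists m.
by move=> m e We; apply: fdim_bound sU ZU _ => i; exact: WZ.
Qed.

Lemma fdim_quo V (Z W U : set V) n : is_submod Z -> is_submod W -> is_submod U ->
  U `<=` W -> fdim Z U n -> exists m, fdim Z W m.
Proof.
move=> sZ sW sU UW ZU.
have [|m _ mU] := @bounded_fdim _ Z W n sZ sW; last by exists m.
by move=> m e Ze eW; apply: fdim_bound sU ZU Ze _ => c /UW/eW.
Qed.

Definition edim V (W U : set V) : \bar R :=
  if pselect (exists n, fdim W U n) then (xget 0%N (fdim W U))%:R%:E else +oo%E.

Lemma edim_fin V (W U : set V) n : is_submod U -> fdim W U n ->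
  edim W U = n%:R%:E.
Proof.
move=> sU WUn; rewrite /edim; case: pselect => [ex|[]]; last by exists n.
have WUm := xgetPex 0%N (ex_intro (fdim W U) n WUn).
by rewrite -(fdim_uniq sU WUn WUm).
Qed.

Lemma edim_infty V (W U : set V) : ~ (exists n, fdim W U n) -> edim W U = +oo%E.
Proof. by rewrite /edim; case: pselect. Qed.

Lemma edim_ge0 V (W U : set V) : (0 <= edim W U)%E.
Proof. by rewrite /edim; case: pselect => ex; rewrite ?lee_fin ?ler0n ?leey. Qed.

Lemma edim_fdim V (W U : set V) (x : R) : edim W U = x%:E -> exists n, fdim W U n.
Proof. by rewrite /edim; case: pselect. Qed.

Lemma edim_chain V (Z W U : set V) : is_submod Z -> is_submod W -> is_submod U ->
  U `<=` W -> W `<=` Z -> edim Z U = (edim Z W + edim W U)%E.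
Proof.
move=> sZ sW sU UW WZ.
have [[n Zn]|ninf] := pselect (exists n, fdim Z U n).
  have [b WUb] := fdim_sub sW sU WZ Zn; have [a ZWa] := fdim_quo sZ sW sU UW Zn.
  rewrite (edim_fin sU WUb) (edim_fin sW ZWa) (edim_fin sU (fdim_add sW UW WZ ZWa WUb)).
  by rewrite natrD EFinD.
rewrite (edim_infty ninf).
have [[a ZWa]|/edim_infty ->] := pselect (exists n, fdim Z W n); last first.
  by rewrite addye// gt_eqF// (lt_le_trans _ (edim_ge0 W U)).
have [[b WUb]|/edim_infty ->] := pselect (exists n, fdim W U n); last first.
  by rewrite addey// gt_eqF// (lt_le_trans _ (edim_ge0 Z W)).
by case: ninf; exists (a + b)%N; exact: fdim_add sW UW WZ ZWa WUb.
Qed.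

Lemma edim_codim V (U : set V) : codim U = edim setT U.
Proof.
have E n : has_codim U n = fdim setT U n.
  apply/propext; split=> [[e [eU Ue]]|[e [_ eU Ue]]]; exists e.
    by split=> // v _; exact: Ue.
  by split=> // v; exact: Ue.
by rewrite /codim /edim; congr (if pselect (exists n, _) then (xget _ _)%:R%:E else _);
  apply/funext.
Qed.

Section Transport.
Context {V V' : lmodType K} (phi : {linear V -> V'}).
Context {W U : set V} {W' U' : set V'}.
Hypotheses (sU' : is_submod U')
  (phiW : forall w, W w -> W' (phi w))
  (phi_surj : forall w', W' w' -> exists2 w, W w & U' (w' - phi w)).

Lemma span_mod_map n (e : 'I_n -> V) : (forall w, W w -> U w -> U' (phi w)) ->
  is_submod W -> (forall i, W (e i)) ->
  span_mod W U e -> span_mod W' U' (phi \o e).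
Proof.
move=> phiU sW We eU w' /phi_surj[w Ww ww']; have [c Uc] := eU w Ww.
exists c; rewrite -(subrK (phi w) w') -addrA; apply: submodD => //.
have Wc : W (w - \sum_i c i *: e i).
  apply: submodB => //; apply: submod_sum => // i _; exact: submodZ.
have := phiU _ Wc Uc; rewrite linearB linear_sum/=.
by under eq_bigr do rewrite linearZ/=.
Qed.

(** [phi] induces an isomorphism between the image of [W] in [V / U] and that of [W'] in [V' / U'].
    Bases are pushed forward by [phi] and lifted back by [phi_surj], so infinite dimension is
    transported too. *)
Lemma edim_transport : is_submod W -> is_submod U -> is_submod W' ->
  (forall w, W w -> U w <-> U' (phi w)) ->
  edim W U = edim W' U'.
Proof.
move=> sW sU sW' phiU.
have sub (v : V) (w : V') : U' (w - phi v) -> U' w <-> U' (phi v).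
  move=> vw; split=> H; last exact: submodBr vw H.
  by rewrite -[phi v](subKr w); exact: submodB.
have phi_lc n (c : 'I_n -> K) (e : 'I_n -> V) :
    phi (\sum_i c i *: e i) = \sum_i c i *: phi (e i).
  by rewrite linear_sum; apply: eq_bigr => i _; rewrite linearZ.
have W_lc n (c : 'I_n -> K) (e : 'I_n -> V) : (forall i, W (e i)) ->
    W (\sum_i c i *: e i).
  by move=> We; apply: submod_sum => // i _; exact: submodZ.
have [[n WUn]|ninf] := pselect (exists n, fdim W U n).
  rewrite (edim_fin sU WUn); apply/esym/(edim_fin sU').
  case: WUn => e [We eU Ue]; exists (phi \o e); split=> [i|c|].
  - exact: phiW.
  - by rewrite -phi_lc => /phiU-/(_ (W_lc _ _ _ We)) /eU.
  - by apply: span_mod_map => // w Ww /phiU; exact.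
rewrite (edim_infty ninf) edim_infty// => -[n [e' [We' eU' Ue']]].
apply: ninf; exists n.
have e_ex i : exists w, W w /\ U' (e' i - phi w).
  by have [w Ww ww] := phi_surj (We' i); exists w.
have [e eP] := choice e_ex.
have We i : W (e i) := (eP i).1; have ee i : U' (e' i - phi (e i)) := (eP i).2.
have sum_ee c : U' (\sum_i c i *: e' i - \sum_i c i *: phi (e i)).
  rewrite -sumrB; apply: submod_sum => // i _; rewrite -scalerBr.
  exact: submodZ.
exists e; split=> // [c Uc|v Wv].
  apply: eU'; apply: (submodBr sU' (sum_ee c)); rewrite -phi_lc.
  by apply/phiU => //; exact: W_lc.
have [c Uc] := Ue' _ (phiW Wv); exists c; apply/phiU.
  by apply: submodB => //; exact: W_lc.
rewrite linearB/= phi_lc -(subrK (\sum_i c i *: e' i) (phi v)) -addrA.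
exact: submodD.
Qed.
End Transport.

Definition coord_fun t V (k : 'I_t) (v : 'I_t -> V) : V := v k.

Lemma coord_fun_linear t V (k : 'I_t) : linear (@coord_fun t V k).
Proof. by []. Qed.

HB.instance Definition _ t V (k : 'I_t) :=
  GRing.isLinear.Build K ('I_t -> V) V _ (@coord_fun t V k) (@coord_fun_linear t V k).

Lemma submodT V : is_submod (@setT V). Proof. by []. Qed.

Lemma submod_prod t V (U : 'I_t -> set V) : (forall i, is_submod (U i)) ->
  is_submod [set v : 'I_t -> V | forall i, U i (v i)].
Proof.
move=> sU; split=> [i|a u v Uu Uv i]; first exact: (sU i).1.
exact: (sU i).2.
Qed.

(** The conditions are imposed one coordinate at a time: in the filtration [Z], each step is
    isomorphic through one coordinate to the quotient by a single [U i]. *)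
Lemma edim_prod t V (U : 'I_t -> set V) : (forall i, is_submod (U i)) ->
  edim setT [set v : 'I_t -> V | forall i, U i (v i)] =
  (\sum_(i < t) edim setT (U i))%E.
Proof.
move=> sU; pose Z n := [set v : 'I_t -> V | forall i : 'I_t, (i < n)%N -> U i (v i)].
have sZ n : is_submod (Z n).
  split=> [i _|a u v Uu Uv i ni]; first exact: (sU i).1.
  by apply: (sU i).2; [exact: Uu|exact: Uv].
have ZS n : Z n.+1 `<=` Z n by move=> v Zv i ni; apply: Zv; exact: ltnW.
have Z0 : Z 0%N = setT by apply/seteqP; split=> // v _ i.
have Zt : Z t = [set v : 'I_t -> V | forall i, U i (v i)].
  by apply/seteqP; split=> v Zv i; [apply: Zv|move=> _; exact: Zv].
pose G i := oapp (fun k : 'I_t => edim setT (U k)) 0%E (insub i).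
transitivity (\sum_(0 <= i < t) G i)%E; last first.
  by rewrite big_mkord; apply: eq_bigr => i _; rewrite /G valK.
suff H n : (n <= t)%N -> edim setT (Z n) = (\sum_(0 <= i < n) G i)%E.
  by rewrite -Zt H.
elim: n => [_|n IHn nt].
  rewrite big_geq// Z0 (@edim_fin _ _ _ 0)//.
  by exists (fun=> 0); split=> // [c _ []//|v _]; exists (fun=> 0).
rewrite big_nat_recr//= -(IHn (ltnW nt)) /G insubT/=.
rewrite (@edim_chain _ setT (Z n) (Z n.+1))//; congr (_ + _)%E.
apply: (@edim_transport _ _ (coord_fun (Ordinal nt))) => //.
  move=> v _; exists (fun i => if i == Ordinal nt then v else 0).
    move=> i; case: eqP => [->|_ _]; last exact: (sU i).1.
    by rewrite /= ltnn.
  by rewrite /= /coord_fun eqxx subrr; exact: (sU _).1.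
move=> v Zv; split=> [|Uv i]; first exact.
rewrite ltnS leq_eqVlt => /orP[/eqP ni|]; last exact: Zv.
by rewrite (_ : i = Ordinal nt)//; exact: val_inj.
Qed.

End RelativeDimension.

(** * Weighted initial forms and strict transforms *)

Section RowDivision.
Context {K : numFieldType}.
Implicit Types (f g q : cps K).

Definition xshift k (c : nat -> nat -> K) : nat -> nat -> K :=
  fun i j => c (k + i)%N j.

Lemma convergent_xshift k f : xshift k f \in convergent.
Proof.
have [s [C [s0 fC]]] := cps_radius f.
apply/convergentP; exists s, (C / s ^+ k); split=> // N.
rewrite ler_pdivlMr ?exprn_gt0//; apply: le_trans (fC (k + N)%N).
rewrite /abs_psum [leRHS]big_split_ord/= -[leLHS]add0r lerD//.
  apply: sumr_ge0 => i _; apply: sumr_ge0 => j _.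
  by rewrite mulr_ge0// exprn_ge0// ltW.
rewrite mulr_suml; apply: ler_sum => i _.
rewrite addnC [leRHS]big_split_ord/= -[leLHS]addr0 lerD//; last first.
  by apply: sumr_ge0 => j _; rewrite mulr_ge0// exprn_ge0// ltW.
rewrite mulr_suml; apply: ler_sum => j _.
by rewrite -mulrA -exprD addnC addnA.
Qed.

Lemma rows_divX k f : rows_from k f -> exists g, f = cpsX ^+ k * g.
Proof.
move=> fk; exists (CPS (convergent_xshift k f)); apply: cpsP => i j.
rewrite coefsXnM; case: leqP => [ki|ik]; last by rewrite fk.
by rewrite /= /xshift subnKC.
Qed.

(** [X] is regular modulo [g] because [g(0, Y)] is nonzero: the lowest nonzero row of [q] times
    [g(0, Y)] is a nonzero row of [q * g]. *)
Lemma rows_torsion k p q g d : yorder (g 0%N) d -> cpsX ^+ k * p = q * g ->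
  rows_from k q.
Proof.
move=> gd pq; elim/ltn_ind => i IHi ik j; apply/eqP/negPn/negP => qij.
have [e qe] := yorder_exists (ex_intro (fun j => q i j != 0) j qij).
have [_] := yorder_conv qe gd; rewrite -coefsM_row0.
  by rewrite -pq coefsXnM leqNgt ik eqxx.
by move=> l li b; apply: IHi => //; exact: ltn_trans ik.
Qed.

(** By [rows_torsion], [X^k] divides [q] itself, so row [k] of the product is a multiple of
    [g(0, Y)]. *)
Lemma mult_row_low k q g d j : yorder (g 0%N) d -> rows_from k (q * g) ->
  (j < d)%N -> (q * g) k j = 0.
Proof.
move=> gd qgk jd; have [p pE] := rows_divX qgk.
rewrite coefsM_row0; last exact: rows_torsion gd (esym pE).
by apply: big1 => l _; rewrite gd.1 ?mulr0// (leq_ltn_trans (leq_subr _ _)).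
Qed.

End RowDivision.

Section Slices.
Context {K : numClosedFieldType}.
Implicit Types (f g h : cps K) (n m k : nat) (a al : K).

(* The part of weighted degree [k] of [f], for the weights [n] of [X] and [m] *)
(* of [Y], evaluated at [X = 1].                                              *)
Definition slice n m f k : {poly K} := \poly_(b < k.+1)
  (if (m * b <= k)%N && (n %| k - m * b)%N then f ((k - m * b) %/ n)%N b else 0).

Lemma coef_slice n m f i j : (0 < n)%N -> (0 < m)%N ->
  (slice n m f (n * i + m * j))`_j = f i j.
Proof.
move=> n0 m0; rewrite coef_poly ifT; last by nia.
by rewrite leq_addl addnK dvdn_mulr// mulKn.
Qed.

Lemma coef_slice_neq0 n m f k j : (0 < n)%N -> (slice n m f k)`_j != 0 ->
  exists2 i, k = (n * i + m * j)%N & f i j != 0.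
Proof.
move=> n0; rewrite coef_poly; case: ifP => _; last by rewrite eqxx.
case: ifP => [/andP[mj /dvdnP[q nq]]|_]; last by rewrite eqxx.
rewrite nq mulnK// => fq; exists q => //.
by rewrite mulnC -nq subnK.
Qed.

(** The value at [(n, m)] of the support function of the Newton diagram, as [weight_min_weight]
    confirms. *)
Definition is_weight n m f k :=
  (exists i j, f i j != 0 /\ k = (n * i + m * j)%N) /\
  forall i j, f i j != 0 -> (k <= n * i + m * j)%N.

Lemma weight_exists n m f : f != 0 -> exists k, is_weight n m f k.
Proof.
move=> /low_row[i0 [[j0 f0] _]].
have ex : exists k, `[< exists i j, f i j != 0 /\ k = (n * i + m * j)%N >].
  by exists (n * i0 + m * j0)%N; apply/asboolP; exists i0, j0.
case: (ex_minnP ex) => k /asboolP kf kmin; exists k; split=> // i j fij.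
by apply: kmin; apply/asboolP; exists i, j.
Qed.

Lemma slice_weight n m f k : (0 < n)%N -> (0 < m)%N -> is_weight n m f k ->
  slice n m f k != 0 /\ forall i, (i < k)%N -> slice n m f i = 0.
Proof.
move=> n0 m0 [[i [j [fij ->]]] kmin]; split.
  by apply: contraNneq fij => s0; rewrite -(coef_slice f i j n0 m0) s0 coef0.
move=> l lk; apply/polyP => b; rewrite coef0; apply/eqP/negPn/negP.
by case/(coef_slice_neq0 n0) => q lE /kmin; rewrite leqNgt -lE lk.
Qed.

Lemma coef_YDC al b i j : ((al%:A + cpsY) ^+ b : cps K) i j =
  if i == 0%N then (('X + al%:P) ^+ b)`_j else 0.
Proof.
elim: b i j => [|b IHb] i j.
  by rewrite !expr0 coefs1 coefC; case: (i == 0%N); case: j.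
rewrite !exprS mulrDl coefsD -scalerAl coefsZ mul1r -[cpsY]expr1 coefsYnM.
rewrite !IHb; case: eqP => _; last by rewrite mulr0 if_same addr0.
rewrite mulrDl coefD coefXM coefCM addrC.
by case: j => //= j; rewrite subn1.
Qed.

Context (n m : nat) (n0 : (0 < n)%N) (m0 : (0 < m)%N) (al : K).

Let u : cps K := cpsX ^+ n.
Let v : cps K := (al%:A + cpsY) * cpsX ^+ m.

Lemma rows_tau_u : rows_from 1 u.
Proof. by move=> [|//] _ j; rewrite /u -[cpsX ^+ n]mulr1 coefsXnM leqNgt n0. Qed.

Lemma rows_tau_v : rows_from 1 v.
Proof. by move=> [|//] _ j; rewrite /v mulrC coefsXnM leqNgt m0. Qed.

Definition pi_tau : cps K -> cps K := psubst rows_tau_u rows_tau_v.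
HB.instance Definition _ := GRing.LRMorphism.on pi_tau.

Lemma coef_comp_XDC (p : {poly K}) N j : (size p <= N)%N ->
  (p \Po ('X + al%:P))`_j = \sum_(b < N) p`_b * (('X + al%:P) ^+ b)`_j.
Proof.
move=> pN; rewrite /comp_poly (horner_coef_wide _ (n := N)); last first.
  exact: leq_trans (size_poly _ _) pN.
by rewrite coef_sum; apply: eq_bigr => b _; rewrite coef_map/= coefCM.
Qed.

(** [X^a Y^b] is sent to [X^(n a + m b) (al + Y)^b], so the weighted degree turns into the exponent
    of [X]. Everything about strict transforms is read off initial forms through this identity. *)
Lemma coef_pi_tau f i j :
  pi_tau f i j = (slice n m f i \Po ('X + al%:P))`_j.
Proof.
rewrite (coef_comp_XDC (N := i.+1)) ?size_poly//.
rewrite [LHS]coefs_sum; under eq_bigr do rewrite coefs_sum.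
rewrite exchange_big; apply: eq_bigr => b _.
have E (a : 'I_i.+1) : (f a b *: (u ^+ a * v ^+ b)) i j =
    if i == (n * a + m * b)%N then f a b * (('X + al%:P) ^+ b)`_j else 0.
  have -> : u ^+ a * v ^+ b = cpsX ^+ (n * a + m * b) * (al%:A + cpsY) ^+ b.
    by rewrite /u /v exprMn -!exprM mulrCA -exprD mulrC.
  rewrite coefsZ coefsXnM coef_YDC subn_eq0.
  by case: ltngtP => _; rewrite ?mulr0.
rewrite (eq_bigr (fun a : 'I_i.+1 => if i == (n * a + m * b)%N
  then f a b * (('X + al%:P) ^+ b)`_j else 0)); last by move=> a _; exact: E.
rewrite -big_mkcond.
have [s0|/(coef_slice_neq0 n0)[q iE _]] := eqVneq (slice n m f i)`_b 0.
  rewrite s0 mul0r big1// => a /eqP iE.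
  by have := coef_slice f a b n0 m0; rewrite -iE s0 => <-; rewrite mul0r.
have qi : (q < i.+1)%N by nia.
rewrite (big_pred1 (Ordinal qi)) => [|a].
  by have := coef_slice f q b n0 m0; rewrite -iE => ->.
rewrite /= -val_eqE/= {1}iE eqn_add2r eqn_pmul2l// eq_sym.
Qed.

Lemma pi_tau_rows f k : is_weight n m f k -> rows_from k (pi_tau f).
Proof.
move=> fk i ik j; rewrite coef_pi_tau.
by rewrite (slice_weight n0 m0 fk).2// comp_poly0 coef0.
Qed.

End Slices.

(** * Binomial factors of slices and multiplicities of their roots *)

Section Roots.
Context {K : numClosedFieldType}.
Implicit Types (p q : {poly K}) (a al : K) (rs : seq K).

Lemma yorder_mup p al : p != 0 ->
  yorder (fun j => (p \Po ('X + al%:P))`_j) (mup al p).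
Proof.
move=> p0; have [d [q]] := multiplicity_XsubC p al; rewrite p0/= => qal pE.
have q0 : q != 0 by apply: contraNneq qal => ->; rewrite root0.
have -> : mup al p = d.
  by rewrite pE mupMr// mup_XsubCX eqxx.
have cE : p \Po ('X + al%:P) = (q \Po ('X + al%:P)) * 'X^d.
  by rewrite pE comp_polyM rmorphXn/= comp_polyB comp_polyX comp_polyC addrK.
split=> [j jd|]; first by rewrite cE coefMXn jd.
rewrite cE coefMXn ltnn subnn -horner_coef0 horner_comp !hornerE.
exact: qal.
Qed.

Lemma mup_ge p al d : p != 0 ->
  (forall j, (j < d)%N -> (p \Po ('X + al%:P))`_j = 0) -> (d <= mup al p)%N.
Proof.
move=> p0 pd; have [_] := yorder_mup al p0; rewrite leqNgt.
by apply: contra => /pd ->.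
Qed.

Definition binomials n rs : {poly K} := \prod_(a <- rs) ('X^n - a%:P).

Lemma binomial_neq0 n a : (0 < n)%N -> 'X^n - a%:P != 0 :> {poly K}.
Proof. by move=> n0; rewrite -size_poly_eq0 size_XnsubC. Qed.

(** In characteristic zero a nonzero root of ['X^n - a] is simple, so each copy of [al ^+ n] in [rs]
    contributes exactly one. *)
Lemma mup_binomials n al rs : (0 < n)%N -> al != 0 ->
  mup al (binomials n rs) = count_mem (al ^+ n) rs.
Proof.
move=> n0 al0; elim: rs => [|a rs IHrs]; rewrite /binomials (big_nil, big_cons)/=.
  by rewrite mupNroot// root1.
rewrite mupM ?binomial_neq0//; last first.
  by rewrite prodf_seq_neq0; apply/allP => b _; exact: binomial_neq0.
rewrite -/(binomials n rs) IHrs; congr (_ + _)%N.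
have [->|aNal] := eqVneq a (al ^+ n); last first.
  by rewrite mupNroot// /root !hornerE subr_eq0 eq_sym.
rewrite -['X^n - _]/('X^n - (al ^+ n)%:P) rmorphXn/= subrXX mupMl.
  by rewrite -[_ - _]expr1 mup_XsubCX eqxx.
(* At [al] the cofactor of ['X - al] takes the value [n al^(n-1)], which is nonzero. *)
rewrite /root horner_sum (eq_bigr (fun=> al ^+ n.-1)) => [|i _].
  by rewrite sumr_const card_ord -mulr_natl mulf_neq0 ?expf_neq0// pnatr_eq0 -lt0n.
rewrite !hornerE/= -exprD; congr (_ ^+ _).
by have := ltn_ord i; lia.
Qed.

(** The factorisation of an initial form at [X = 1]: [rs] lists the [a_i] repeated [d_i] times, and
    [lo] is the exponent of [Y] at the lower end of the face. *)
Definition slice_factor n p c lo rs : Prop :=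
  [/\ c != 0, all (predC1 0) rs & p = c *: ('X^lo * binomials n rs)].

(** Exponents congruent modulo [n] make [p] equal to ['X^lo] times some [G] in ['X^n], and [G]
    splits. Its roots are nonzero because its constant term is the lowest nonzero coefficient of
    [p]. *)
Lemma slice_factor_exists n p : (0 < n)%N -> p != 0 ->
  (forall b b', p`_b != 0 -> p`_b' != 0 -> b = b' %[mod n]) ->
  exists c lo rs, slice_factor n p c lo rs.
Proof.
move=> n0 p0 pmod.
have ex : exists b, p`_b != 0 by exists (size p).-1; rewrite -lead_coefE lead_coef_eq0.
case: (ex_minnP ex) => lo plo lomin.
pose G := \poly_(l < size p) p`_(lo + n * l).
have GE : p = 'X^lo * (G \Po 'X^n).
  apply/polyP => b; rewrite coefXnM; case: ltnP => [blo|lob].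
    by apply/eqP/negPn/negP => /lomin; rewrite leqNgt blo.
  rewrite coef_comp_poly_Xn//; case: ifP => [/dvdnP[q bq]|nb].
    have bE : b = (lo + n * q)%N by rewrite mulnC -bq subnKC.
    rewrite coef_poly bq mulnK//; case: ltnP => sq; first by rewrite bE.
    rewrite nth_default// bE (leq_trans sq)// (leq_trans (leq_pmull q n0))//.
    exact: leq_addl.
  apply/eqP/negPn/negP => /pmod-/(_ _ plo)/eqP.
  by rewrite eqn_mod_dvd// nb.
have G0 : G != 0 by apply: contraNneq p0 => G0; rewrite GE G0 comp_poly0 mulr0.
have [rs rsE] := closed_field_poly_normal G.
exists (lead_coef G), lo, rs; split; rewrite ?lead_coef_eq0//.
  apply/allP => a ars /=; apply/eqP => a0.
  have : G.[0] = 0.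
    by apply/eqP; rewrite -/(root G 0) rsE rootZ ?lead_coef_eq0// root_prod_XsubC -a0.
  rewrite horner_coef0 coef_poly muln0 addn0; case: ifP => [_|]; first exact/eqP.
  by rewrite lt0n size_poly_eq0 p0.
rewrite {1}GE {1}rsE comp_polyZ -scalerAr; congr (_ *: (_ * _)).
rewrite /binomials rmorph_prod/=; apply: eq_bigr => a _.
by rewrite comp_polyB comp_polyX comp_polyC.
Qed.

Lemma mup_slice_factor n p c lo rs al : (0 < n)%N -> al != 0 ->
  slice_factor n p c lo rs -> mup al p = count_mem (al ^+ n) rs.
Proof.
move=> n0 al0 [c0 rs0 ->]; rewrite -mul_polyC mulrA mupMr ?mup_binomials//.
by rewrite /root !hornerE mulf_neq0 ?expf_neq0.
Qed.

Lemma size_binomials n rs : (0 < n)%N -> size (binomials n rs) = (n * size rs).+1.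
Proof.
move=> n0; elim: rs => [|a rs IHrs]; rewrite /binomials (big_nil, big_cons).
  by rewrite size_poly1 muln0.
rewrite -/(binomials n rs) size_mul ?binomial_neq0//; last first.
  by rewrite -size_poly_eq0 IHrs.
by rewrite IHrs size_XnsubC//=; lia.
Qed.

Lemma slice_factor_ends n p c lo rs : (0 < n)%N -> slice_factor n p c lo rs ->
  [/\ p`_lo != 0, p`_(lo + n * size rs) != 0 &
    forall b, p`_b != 0 -> (lo <= b <= lo + n * size rs)%N].
Proof.
move=> n0 [c0 rs0 ->]; have sz := size_binomials rs n0.
have B0 : (binomials n rs)`_0 != 0.
  rewrite -horner_coef0 /binomials horner_prod prodf_seq_neq0.
  apply/allP => a /(allP rs0) /= a0; by rewrite !hornerE expr0n gtn_eqF// sub0r oppr_eq0.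
split.
- by rewrite coefZ coefXnM ltnn subnn mulf_neq0.
- rewrite coefZ coefXnM ltnNge leq_addr/= addKn mulf_neq0//.
  have -> : (n * size rs)%N = (size (binomials n rs)).-1 by rewrite sz.
  by rewrite -lead_coefE lead_coef_eq0 -size_poly_eq0 sz.
move=> b; rewrite coefZ coefXnM; case: ltnP => [_|lob]; first by rewrite mulr0 eqxx.
rewrite mulf_eq0 negb_or => /andP[_ Bb]; rewrite -leq_subLR -ltnS -sz.
by rewrite ltnNge; apply: contra Bb => /leq_sizeP ->.
Qed.

(** From [n i + m b = n i' + m b'] it follows that [n] divides [m (b' - b)], and [n] is coprime to
    [m]. *)
Lemma slice_mod n m (f : cps K) k b b' : (0 < n)%N -> coprime n m ->
  (slice n m f k)`_b != 0 -> (slice n m f k)`_b' != 0 -> b = b' %[mod n].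
Proof.
move=> n0 nm /(coef_slice_neq0 n0)[i ki _] /(coef_slice_neq0 n0)[i' ki' _].
wlog bb : b b' i i' ki ki' / (b <= b')%N.
  by move=> H; case/orP: (leq_total b b') => bb; [|apply/esym]; apply: H bb; eassumption.
apply/esym/eqP; rewrite eqn_mod_dvd// -(Gauss_dvdr _ nm) mulnBr.
have -> : (m * b' - m * b = n * (i - i'))%N by nia.
exact: dvdn_mulr.
Qed.

End Roots.

Section StrictTransform.
Context {K : numClosedFieldType} (n m : nat) (n0 : (0 < n)%N) (m0 : (0 < m)%N) (al : K).
Local Notation pi_tau := (pi_tau n0 m0 al).

Lemma pi_tau_strict (f : cps K) k : is_weight n m f k ->
  exists2 g, pi_tau f = cpsX ^+ k * g & exists j, g 0%N j != 0.
Proof.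
move=> fk; have [g gE] := rows_divX (pi_tau_rows n0 m0 al fk).
exists g => //; exists (mup al (slice n m f k)).
have := (yorder_mup al (slice_weight n0 m0 fk).1).2.
by rewrite -(coef_pi_tau n0 m0 al) gE coefsXnM leqnn subnn.
Qed.

(** [g(0, Y)] can only be the lowest nonzero row of [pi_tau f], that is the lowest slice recentred
    at [al]; its order is the multiplicity of [al]. *)
Lemma pi_tau_strict_uniq (f g : cps K) k k' : is_weight n m f k ->
  pi_tau f = cpsX ^+ k' * g -> (exists j, g 0%N j != 0) ->
  k' = k /\ yorder (g 0%N) (mup al (slice n m f k)).
Proof.
move=> fk fg [j gj]; have [s0 _] := slice_weight n0 m0 fk.
have gE i : g 0%N i = pi_tau f k' i by rewrite fg coefsXnM leqnn subnn.
have kk : k' = k.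
  case: (ltngtP k' k) => // kk.
    by move: gj; rewrite gE (pi_tau_rows n0 m0 al fk)// eqxx.
  have := (yorder_mup al s0).2; rewrite -(coef_pi_tau n0 m0 al) fg coefsXnM.
  by rewrite leqNgt kk eqxx.
split=> //; subst k'; have [lo hi] := yorder_mup al s0.
by split=> [i /lo|]; rewrite gE coef_pi_tau.
Qed.

(** With [g = h_tau] this compares initial forms: a series in the kernel of the comparison map
    inherits the roots of the initial form of [h] with their multiplicities. *)
Lemma mup_of_multiple (u q g : cps K) k d : is_weight n m u k ->
  pi_tau u = q * g -> yorder (g 0%N) d -> (d <= mup al (slice n m u k))%N.
Proof.
move=> uk uE gd; apply: mup_ge => [|j jd]; first exact: (slice_weight n0 m0 uk).1.
rewrite -(coef_pi_tau n0 m0 al) uE (mult_row_low gd)//.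
by rewrite -uE; exact: pi_tau_rows.
Qed.

End StrictTransform.

(** * Newton diagrams *)

Section Plane.
Context {R : realType}.
Local Notation plane := (R^o * R^o)%type.
Local Notation msum := (@Defs.msum R).
Implicit Types (D : set plane) (E : set (nat * nat)).

Definition cvx D : Prop := forall (p q : plane) (t : R), 0 <= t -> t <= 1 ->
  D p -> D q -> D (t * p.1 + (1 - t) * q.1, t * p.2 + (1 - t) * q.2).

Definition upward D : Prop := forall (p : plane) (x y : R),
  D p -> p.1 <= x -> p.2 <= y -> D (x, y).

Lemma convex_setE D : @convex_set R plane D <-> cvx D.
Proof.
split=> [cD p q t t0 t1 Dp Dq|cD p q t pD qD].
  have := cD p q (Itv01 t0 t1); rewrite !inE => /(_ Dp Dq).
  by [].
rewrite inE in pD; rewrite inE in qD; rewrite inE.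
exact: (cD p q t%:num).
Qed.

Lemma msumE D D' (p : plane) : msum D D' p <->
  exists2 d, D d & D' (p.1 - d.1, p.2 - d.2).
Proof.
split=> [[d Dd [d' Dd' <-]]|[d Dd Dd']].
  by exists d => //=; rewrite ![_ + _ - _]addrAC !subrr !add0r -surjective_pairing.
exists d => //; exists (p.1 - d.1, p.2 - d.2) => //; case: p {Dd'} => x y /=.
by rewrite /GRing.add/= ; congr (_, _); rewrite addrC subrK.
Qed.

Lemma cvx_msum D D' : cvx D -> cvx D' -> cvx (msum D D').
Proof.
move=> cD cD' p q t t0 t1 /msumE[d Dd Dd'] /msumE[e De De']; apply/msumE.
exists (t * d.1 + (1 - t) * e.1, t * d.2 + (1 - t) * e.2); first exact: cD.
have := cD' _ _ _ t0 t1 Dd' De'; congr (D' (_, _)); rewrite /=; ring.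
Qed.

Lemma upward_msum D D' : upward D' -> upward (msum D D').
Proof.
move=> uD p x y /msumE[d Dd Dd'] px py; apply/msumE; exists d => //.
by apply: uD Dd' _ _ => /=; rewrite lerD2r.
Qed.

Lemma cvx_quadrant : cvx quadrant.
Proof.
move=> p q t t0 t1 [p1 p2] [q1 q2]; have t1' : 0 <= 1 - t by rewrite subr_ge0.
by split=> /=; rewrite addr_ge0// mulr_ge0.
Qed.

Lemma upward_quadrant : upward quadrant.
Proof. by move=> p x y [p1 p2] px py; split; [exact: le_trans px|exact: le_trans py]. Qed.

Lemma msumC D D' : msum D D' = msum D' D.
Proof.
by apply/seteqP; split=> p [d Dd [e De <-]]; exists e => //; exists d => //; rewrite addrC.
Qed.

Lemma msumA D1 D2 D3 : msum D1 (msum D2 D3) = msum (msum D1 D2) D3.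
Proof.
apply/seteqP; split=> p.
  move=> [d Dd [_ [e De [f Df <-]] <-]]; exists (d + e); first by exists d => //; exists e.
  by exists f => //; rewrite addrA.
move=> [_ [d Dd [e De <-]] [f Df <-]]; exists d => //; exists (e + f).
  by exists e => //; exists f.
by rewrite addrA.
Qed.

Lemma msum_quadrant D : upward D -> msum quadrant D = D.
Proof.
move=> uD; apply/seteqP; split=> [p /msumE[d [d1 d2] Dp]|p Dp]; last first.
  by apply/msumE; exists (0, 0); [split=> /=|rewrite !subr0 -surjective_pairing].
by case: p Dp => x y /= Dp; apply: uD Dp _ _ => /=; rewrite gerBl.
Qed.

Lemma nd_quadrant E (p : plane) a b : E (a, b) ->
  a%:R <= p.1 -> b%:R <= p.2 -> newton_diagram E p.
Proof.
move=> Eab ap bp; suff : msum (lattice @` E) quadrant p.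
  by apply: (@sub_smallest _ (@convex_set R plane) (msum (lattice @` E) quadrant)).
apply/msumE.
exists (lattice (a, b)); first by exists (a, b).
by split=> /=; rewrite subr_ge0.
Qed.

Lemma nd_mem E a b : E (a, b) -> newton_diagram E (a%:R : R^o, b%:R : R^o).
Proof. by move=> Eab; exact: nd_quadrant Eab _ _. Qed.

(** Convexity and upward closure absorb the hull and the added quadrant, so only the lattice
    generators have to be checked. Most inclusions of diagrams are proved this way. *)
Lemma nd_ind E D : cvx D -> upward D ->
  (forall a b, E (a, b) -> D (a%:R, b%:R)) -> newton_diagram E `<=` D.
Proof.
move=> /convex_setE cD uD ED; apply: smallest_sub => // p.
move=> [_ [[a b] Eab <-] [q [q1 q2] <-]].
by apply: (uD (a%:R, b%:R) (a%:R + q.1) (b%:R + q.2)); rewrite ?lerDl//; exact: ED.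
Qed.

Lemma cvx_nd E : cvx (newton_diagram E).
Proof.
apply/convex_setE => p q t; rewrite !inE => pE qE A [cA AE].
by have := cA p q t; rewrite !inE; apply; [exact: pE|exact: qE].
Qed.

Lemma cvx_translate D (v : plane) : cvx D -> cvx [set p | D (p.1 + v.1, p.2 + v.2)].
Proof.
move=> cD p q t t0 t1 Dp Dq /=; have := cD _ _ _ t0 t1 Dp Dq.
by congr (D (_, _)) => /=; ring.
Qed.

Lemma upward_nd E : upward (newton_diagram E).
Proof.
move=> p x y Dp px py.
(* [D] is the diagram pulled back along the translation from [p] to [(x, y)]. It is convex and
   contains the generators, hence the whole diagram. *)
pose D := [set q : plane | newton_diagram E (q.1 + (x - p.1), q.2 + (y - p.2))].
suff : D p by rewrite /D/= ![_ + (_ - _)]addrC !subrK.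
have cD : @convex_set R plane D.
  by apply/convex_setE; apply: (@cvx_translate _ (x - p.1, y - p.2)); exact: cvx_nd.
apply: smallest_sub Dp => // q [_ [[a b] Eab <-] [r [r1 r2] <-]].
by apply: nd_quadrant Eab _ _; rewrite /= -addrA lerDl addr_ge0// subr_ge0.
Qed.

Lemma msum_nd_sub E E' D : cvx D -> upward D ->
  (forall a b a' b', E (a, b) -> E' (a', b') -> D (a%:R + a'%:R, b%:R + b'%:R)) ->
  msum (newton_diagram E) (newton_diagram E') `<=` D.
Proof.
move=> cD uD H; suff K (d e : plane) : newton_diagram E d -> newton_diagram E' e ->
    D (e.1 + d.1, e.2 + d.2).
  move=> p /msumE[d Ed Ed']; have := K _ _ Ed Ed'.
  by rewrite /= !subrK -surjective_pairing.
have uT (D1 : set plane) (v : plane) : upward D1 -> upward [set p | D1 (p.1 + v.1, p.2 + v.2)].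
  by move=> uD1 p x y Dp px py; apply: uD1 Dp _ _ => /=; rewrite lerD2r.
move=> Ed Ee; move: e Ee; apply: nd_ind => [||a' b' E'ab].
- exact: cvx_translate.
- exact: uT.
have {}H : forall d, newton_diagram E d -> [set p : plane | D (p.1 + a'%:R, p.2 + b'%:R)] d.
  apply: nd_ind => [||a b Eab].
  - by apply: (@cvx_translate _ (a'%:R, b'%:R)).
  - by apply: (@uT _ (a'%:R, b'%:R)).
  - exact: H.
by have := H d Ed; rewrite /= [_ + d.1]addrC [_ + d.2]addrC.
Qed.

Lemma msum_nd E E' : msum (newton_diagram E) (newton_diagram E') =
  newton_diagram [set (e.1 + e'.1, e.2 + e'.2)%N | e in E & e' in E'].
Proof.
apply/seteqP; split.
  apply: msum_nd_sub => [||a b a' b' Eab E'ab]; [exact: cvx_nd|exact: upward_nd|].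
  by rewrite -!natrD; apply: nd_mem; exists (a, b) => //; exists (a', b').
apply: nd_ind; [by apply: cvx_msum; exact: cvx_nd|by apply: upward_msum; exact: upward_nd|].
move=> _ _ [[a b] Eab [[a' b'] E'ab [<- <-]]]; apply/msumE.
exists (a%:R, b%:R); first exact: nd_mem.
by rewrite /= !natrD ![_%:R + _ - _]addrAC !subrr !add0r; exact: nd_mem.
Qed.

Lemma is_newton_diagram_msum D D' : is_newton_diagram D -> is_newton_diagram D' ->
  is_newton_diagram (msum D D').
Proof.
move=> [E [e Ee] ->] [E' [e' Ee'] ->]; rewrite msum_nd; eexists; last reflexivity.
by exists (e.1 + e'.1, e.2 + e'.2)%N; exists e => //; exists e'.
Qed.

Lemma quadrantE : quadrant = newton_diagram [set (0%N, 0%N)] :> set plane.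
Proof.
apply/seteqP; split=> [p [p1 p2]|]; first exact: (@nd_quadrant _ _ 0 0).
by apply: nd_ind cvx_quadrant upward_quadrant _ => a b [-> ->]; split=> /=.
Qed.

End Plane.

(** * Decomposition of a Newton diagram into edges, and support functions *)

Section Decomposition.
Context {R : realType}.
Local Notation plane := (R^o * R^o)%type.
Local Notation msum := (@Defs.msum R).
Implicit Types (e : nat * nat) (D : set plane) (E : set (nat * nat)) (L : seq (nat * nat)).

Definition edge_diagram (e : nat * nat) : set plane :=
  elementary (Some e.1) (Some e.2).

Definition edge_sum L : set plane :=
  foldr (fun e D => msum (edge_diagram e) D) quadrant L.

Lemma cvx_edge e : cvx (edge_diagram e). Proof. exact: cvx_nd. Qed.

Lemma edge_diagram_fst a b : edge_diagram (a, b) (a%:R, 0).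
Proof. by apply: (@nd_mem _ _ a 0); left. Qed.

Lemma edge_diagram_snd a b : edge_diagram (a, b) (0, b%:R).
Proof. by apply: (@nd_mem _ _ 0 b); right. Qed.

Lemma lexmin_exists E : E !=set0 -> exists2 P, E P & forall e, E e ->
  (P.1 < e.1)%N \/ P.1 = e.1 /\ (P.2 <= e.2)%N.
Proof.
move=> [[a b] Eab].
have ex1 : exists a, `[< exists b, E (a, b) >] by exists a; apply/asboolP; exists b.
case: (ex_minnP ex1) => a0 /asboolP[b1 Eb1] amin.
have ex2 : exists b, `[< E (a0, b) >] by exists b1; apply/asboolP.
case: (ex_minnP ex2) => b0 /asboolP Eb0 bmin.
exists (a0, b0) => // -[a' b'] Eab' /=.
have : (a0 <= a')%N by apply: amin; apply/asboolP; exists b'.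
rewrite leq_eqVlt => /orP[/eqP aa|]; [right|by left].
by split=> //; apply: bmin; apply/asboolP; rewrite aa.
Qed.

(* [P] is the other end of the first edge: among the points of [E] below the   *)
(* vertex [(a0, b0)] it minimises the slope, and lies lowest on its line.      *)
Lemma first_edge E a0 b0 : (forall e, E e -> (a0 <= e.1)%N) ->
  (exists2 e, E e & (e.2 < b0)%N) ->
  exists2 P, E P & (P.2 < b0)%N /\ forall e, E e -> (e.2 < b0)%N ->
    ((P.1 - a0) * (b0 - e.2) < (e.1 - a0) * (b0 - P.2) \/
    (P.1 - a0) * (b0 - e.2) = (e.1 - a0) * (b0 - P.2) /\ P.2 <= e.2)%N.
Proof.
move=> a0min [e0 Ee0 e0b].
(* The factorial clears denominators: [(e.1 - a0) * cof e] is the ratio of horizontal to vertical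
   distance scaled to a natural number. The factor [b0.+1] makes [key] lexicographic, as
   [e.2 < b0]. *)
pose cof (e : nat * nat) := (b0`! %/ (b0 - e.2))%N.
have cofE e : (e.2 < b0)%N -> ((b0 - e.2) * cof e = b0`!)%N.
  by move=> eb; rewrite mulnC divnK// dvdn_fact// subn_gt0 eb leq_subr.
pose key (e : nat * nat) := ((e.1 - a0) * cof e * b0.+1 + e.2)%N.
have ex : exists k, `[< exists e, [/\ E e, (e.2 < b0)%N & k = key e] >].
  by exists (key e0); apply/asboolP; exists e0.
case: (ex_minnP ex) => k /asboolP[P [EP Pb ->]] kmin; exists P => //; split=> // e Ee eb.
have : (key P <= key e)%N by apply: kmin; apply/asboolP; exists e.
have := cofE _ eb; have := cofE _ Pb; rewrite /key.
have := fact_gt0 b0; set F := b0`!.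
move: (cof e) (cof P) => ce cP F0 HP He.
set x1 := (P.1 - a0)%N; set x := (e.1 - a0)%N.
have xx : ((x1 * (b0 - e.2)) * F = (x1 * cP) * ((b0 - P.2) * (b0 - e.2)))%N.
  by rewrite -HP; ring.
have xx' : ((x * (b0 - P.2)) * F = (x * ce) * ((b0 - P.2) * (b0 - e.2)))%N.
  by rewrite -He; ring.
have pos : (0 < (b0 - P.2) * (b0 - e.2))%N by rewrite muln_gt0 !subn_gt0 Pb.
move: (x1 * cP)%N (x * ce)%N xx xx' => u v xx xx' uv.
have uv' : (u <= v)%N by nia.
move: uv'; rewrite leq_eqVlt => /orP[/eqP uv'|uv'].
  right; split; last by move: uv; rewrite uv' leq_add2l.
  by apply/eqP; rewrite -(eqn_pmul2r F0) xx xx' uv'.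
by left; rewrite -(ltn_pmul2r F0) xx xx' ltn_pmul2r.
Qed.

(** Splits off the steepest edge, from [(a0, b0)] to [(a0 + da, b1)]. Points of height at most [b1]
    move left by [da]; the slope condition keeps the points of the strip above them to the right of
    the edge. *)
Lemma nd_peel E a0 b0 da b1 : E (a0, b0) -> E (a0 + da, b1)%N ->
  (b1 < b0)%N ->
  (forall e, E e -> (a0 < e.1)%N \/ a0 = e.1 /\ (b0 <= e.2)%N) ->
  (forall e, E e -> (e.2 < b0)%N ->
    (da * (b0 - e.2) < (e.1 - a0) * (b0 - b1) \/
    da * (b0 - e.2) = (e.1 - a0) * (b0 - b1) /\ b1 <= e.2)%N) ->
  newton_diagram E = msum (edge_diagram (da, b0 - b1)%N)
    (newton_diagram [set e | (e.2 <= b1)%N /\ E (e.1 + da, e.2)%N]).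
Proof.
move=> E0 E1 bb lexmin slope; set E' := [set e | _].
have bb0 : 0 < b0%:R - b1%:R :> R by rewrite subr_gt0 ltr_nat.
have slopeR a b : E (a, b) -> (b < b0)%N ->
    da%:R * (b0%:R - b%:R) <= (a%:R - a0%:R) * (b0%:R - b1%:R) :> R.
  move=> Eab bb0'; have := slope _ Eab bb0' => /= s.
  have aa0 : (a0 <= a)%N by case: (lexmin _ Eab) => /=; lia.
  by rewrite -!natrB ?(ltnW bb) ?(ltnW bb0')// -!natrM ler_nat; lia.
have daa a b : E (a, b) -> (b <= b1)%N -> (a0 + da <= a)%N.
  move=> Eab ab; have := slope _ Eab (leq_ltn_trans ab bb) => /= s.
  have aa0 : (a0 <= a)%N by case: (lexmin _ Eab) => /=; lia.
  nia.
apply/seteqP; split; last first.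
  apply: msum_nd_sub; [exact: cvx_nd|exact: upward_nd|].
  move=> a b a' b' [[[<-] /= ->]|[[<-] /= ->]] [/= b'b1 Eab'].
    by rewrite add0r -natrD addnC; exact: nd_mem.
  rewrite add0r.
  have s := slopeR _ _ Eab' (leq_ltn_trans b'b1 bb).
  pose y : R := b1%:R - b'%:R; pose db : R := b0%:R - b1%:R.
  have y0 : 0 <= y by rewrite subr_ge0 ler_nat.
  have db0 : 0 < db by [].
  (* On the segment from [(a' + da, b')] to [(a0, b0)] this selects the point of height
     [b' + (b0 - b1)]; the slope condition bounds its abscissa by [a']. *)
  pose t := y / (db + y).
  have dby : 0 < db + y by rewrite ltr_pwDl.
  have t0 : 0 <= t by rewrite divr_ge0// ltW.
  have t1 : t <= 1 by rewrite ler_pdivrMr// mul1r lerDr ltW.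
  have tE : t * (db + y) = y by rewrite mulfVK// gt_eqF.
  have := @cvx_nd _ E _ _ t t0 t1 (nd_mem Eab') (nd_mem E0).
  move=> /upward_nd; apply => /=.
    suff : t * (a'%:R + da%:R - a0%:R) <= a'%:R - a0%:R by rewrite natrD; lra.
    rewrite -(ler_pM2r dby) mulrAC tE; rewrite natrD in s; rewrite /y /db; nra.
  rewrite natrB ?(ltnW bb)//; have : db + y = b0%:R - b'%:R by rewrite /db /y; lra.
  move: tE => /[swap] ->; rewrite /y; lra.
have E'1 : E' (a0, b1) by split.
apply: nd_ind; [by apply: cvx_msum; exact: cvx_nd|by apply: upward_msum; exact: upward_nd|].
move=> a b Eab.
have [ab|ab] := leqP b b1.
  apply/msumE; exists (da%:R, 0); first exact: edge_diagram_fst.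
  rewrite /= subr0 -natrB; last by have := daa _ _ Eab ab; lia.
  by apply: nd_mem; split=> //=; rewrite subnK//; have := daa _ _ Eab ab; lia.
have aa0 : (a0 <= a)%N by case: (lexmin _ Eab) => /=; lia.
have [ab0|ab0] := leqP b0 b.
  apply/msumE; exists (0, (b0 - b1)%:R); first exact: edge_diagram_snd.
  apply: upward_nd (nd_mem E'1) _ _ => /=; first by rewrite subr0 ler_nat.
  by rewrite natrB ?(ltnW bb)// lerBrDr addrC subrK ler_nat.
have s := slopeR _ _ Eab ab0.
(* For [b1 < b < b0] the edge contributes its point of height [b - b1], and the remainder dominates
   [(a0, b1)]. *)
pose t : R := (b0%:R - b%:R) / (b0%:R - b1%:R).
have t0 : 0 <= t by rewrite divr_ge0 ?subr_ge0 ?ler_nat// ltnW.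
have t1 : t <= 1 by rewrite ler_pdivrMr// mul1r lerD2l lerN2 ler_nat ltnW.
have tE : t * (b0%:R - b1%:R) = b0%:R - b%:R by rewrite mulfVK// gt_eqF.
apply/msumE; exists (t * da%:R + (1 - t) * 0, t * 0 + (1 - t) * (b0 - b1)%:R).

  exact: (@cvx_edge (da, b0 - b1)%N _ _ t t0 t1
    (@edge_diagram_fst da (b0 - b1)) (@edge_diagram_snd da (b0 - b1))).
apply: upward_nd (nd_mem E'1) _ _ => /=.
  rewrite mulr0 addr0 lerBrDl -lerBrDr -(ler_pM2r bb0) mulrAC tE mulrC.
  exact: s.
by rewrite mulr0 add0r natrB ?(ltnW bb)// mulrBl mul1r tE; lra.
Qed.

(** The first edge is peeled off by strong induction on the height of the leftmost vertex [P], until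
    no point is lower; a translated quadrant remains. *)
Lemma nd_decomposition E : E !=set0 -> exists P b0 L,
  [/\ E P, forall e, E e -> (P.1 < e.1)%N \/ P.1 = e.1 /\ (P.2 <= e.2)%N,
      exists2 e, E e & e.2 = b0,
      all (fun e => (0 < e.1) && (0 < e.2))%N L &
      P.2 = (b0 + \sum_(e <- L) e.2)%N /\
      newton_diagram E = msum (newton_diagram [set (P.1, b0)]) (edge_sum L)].
Proof.
move=> E0; have [P EP Pmin] := lexmin_exists E0.
suff [b0 [L HL]] : exists b0 L, [/\ exists2 e, E e & e.2 = b0,
    all (fun e => (0 < e.1) && (0 < e.2))%N L,
    P.2 = (b0 + \sum_(e <- L) e.2)%N &
    newton_diagram E = msum (newton_diagram [set (P.1, b0)]) (edge_sum L)].
  by exists P, b0, L; case: HL => ? ? ? ?; split.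
move: {E0} P EP Pmin => [a0 b]; elim/ltn_ind: b E => b IH E /= Eab lexmin.
have a0min e : E e -> (a0 <= e.1)%N by move=> /lexmin; lia.
have [low|/forall2NP nolow] := pselect (exists2 e, E e & (e.2 < b)%N); last first.
  exists b, [::]; split=> //; first by exists (a0, b).
    by rewrite big_nil addn0.
  rewrite /= msumC msum_quadrant; last exact: upward_nd.
  apply/seteqP; split; apply: nd_ind; try exact: cvx_nd; try exact: upward_nd.
    move=> a' b' Eab'; apply: (@nd_quadrant _ _ _ a0 b) => //=; rewrite ler_nat.
      exact: a0min Eab'.
    by case: (nolow (a', b')) => //= /negP; rewrite -leqNgt.
  by move=> _ _ [-> ->]; exact: nd_mem.
have [[a1 b1] E1 [/= b1b slope]] := first_edge a0min low.
have a01 : (a0 < a1)%N by have := lexmin _ E1 => /=; lia.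
have a1E : a1 = (a0 + (a1 - a0))%N by lia.
have E1' : E (a0 + (a1 - a0), b1)%N by rewrite -a1E.
have peel := nd_peel Eab E1' b1b lexmin slope.
have [||b0 [L [[e [/= eb1 Ee] eb0] Lpos b1E dE]]] := IH b1 b1b
    [set e | (e.2 <= b1)%N /\ E (e.1 + (a1 - a0), e.2)%N].
- by split.
- move=> [a' b'] [/= b'b1 Eab'].
  have := lexmin _ Eab'; have := slope _ Eab' (leq_ltn_trans b'b1 b1b) => /=.
  nia.
exists b0, ((a1 - a0, b - b1)%N :: L); split.
- by exists (e.1 + (a1 - a0), e.2)%N.
- by rewrite /= Lpos !subn_gt0 a01 b1b.
- by rewrite big_cons/= addnCA -b1E subnK// ltnW.
by rewrite peel dE /= msumA msumA [msum _ (newton_diagram _)]msumC.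
Qed.

(** The support function of [D] at [(n, m)]. It depends on [D] only and is additive under Minkowski
    sums, so it extracts numbers from any decomposition. *)
Definition min_weight (n m : nat) D (k : nat) : Prop :=
  (forall p : plane, D p -> k%:R <= n%:R * p.1 + m%:R * p.2) /\
  exists2 p : plane, D p & k%:R = n%:R * p.1 + m%:R * p.2.

Lemma min_weight_uniq n m D k k' : min_weight n m D k -> min_weight n m D k' ->
  k = k'.
Proof.
move=> [kD [p Dp kp]] [k'D [q Dq k'q]]; apply/eqP.
rewrite -(eqr_nat R) eq_le {1}k'q {2}kp.
by rewrite kD// k'D.
Qed.

Lemma min_weight_nd n m E k : (forall e, E e -> (k <= n * e.1 + m * e.2)%N) ->
  (exists2 e, E e & k = n * e.1 + m * e.2)%N -> min_weight n m (newton_diagram E) k.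
Proof.
move=> kE [[a b] Eab kab]; split; last first.
  by exists (a%:R, b%:R); [exact: nd_mem|rewrite kab natrD !natrM].
have n0 : 0 <= n%:R :> R by []; have m0 : 0 <= m%:R :> R by [].
apply: nd_ind => [p q t t0 t1 /= kp kq|p x y /= kp px py|a' b' Eab' /=].
- have t1' : 0 <= 1 - t by rewrite subr_ge0.
  have H1 := ler_wpM2l t0 kp; have H2 := ler_wpM2l t1' kq.
  have -> : k%:R = t * k%:R + (1 - t) * k%:R :> R by ring.
  by apply: le_trans (lerD H1 H2) _; rewrite le_eqVlt; apply/orP; left; apply/eqP; ring.
- by apply: le_trans kp _; rewrite lerD// ler_wpM2l.
- by rewrite -!natrM -natrD ler_nat; exact: kE Eab'.
Qed.

Lemma min_weight_msum n m D D' k k' : min_weight n m D k -> min_weight n m D' k' ->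
  min_weight n m (msum D D') (k + k').
Proof.
move=> [kD [p Dp kp]] [k'D [q Dq k'q]]; split.
  move=> _ [d Dd [d' Dd' <-]]; rewrite natrD.
  apply: le_trans (lerD (kD _ Dd) (k'D _ Dd')) _.
  by rewrite le_eqVlt; apply/orP; left; apply/eqP => /=; ring.
exists (p + q); first by exists p => //; exists q.
by rewrite natrD kp k'q /=; ring.
Qed.

Lemma min_weight_quadrant n m : min_weight n m quadrant 0.
Proof.
rewrite quadrantE; apply: min_weight_nd => // .
by exists (0%N, 0%N) => //=; rewrite !muln0.
Qed.

Lemma min_weight_edge n m e : min_weight n m (edge_diagram e) (minn (n * e.1) (m * e.2)).
Proof.
case: e => a b; apply: min_weight_nd => [[a' b'] [[[<-] /= ->]|[[<-] /= ->]]|].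
- by rewrite muln0 addn0 geq_minl.
- by rewrite muln0 add0n geq_minr.
rewrite /=; case: (leqP (n * a) (m * b)) => _.
  by exists (a, 0%N); [left|rewrite /= muln0 addn0].
by exists (0%N, b); [right|rewrite /= muln0 add0n].
Qed.

Lemma min_weight_edge_sum n m L :
  min_weight n m (edge_sum L) (\sum_(e <- L) minn (n * e.1) (m * e.2)).
Proof.
elim: L => [|e L IHL]; rewrite ?big_nil ?big_cons; first exact: min_weight_quadrant.
by apply: min_weight_msum => //; exact: min_weight_edge.
Qed.

Lemma min_weight_point n m a b :
  min_weight n m (newton_diagram [set (a, b)]) (n * a + m * b).
Proof. by apply: min_weight_nd => [_ ->//|]; exists (a, b). Qed.

End Decomposition.

(** * The double area *)

Section DoubleArea.
Context {R : realType}.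
Local Notation plane := (R^o * R^o)%type.
Local Notation msum := (@Defs.msum R).
Local Notation entries := (option nat * option nat)%type.
Implicit Types (D : set plane) (e : entries) (L : seq entries).

Definition entries_sum L : set plane :=
  foldr (fun e D => msum (elementary e.1 e.2) D) quadrant L.

Definition valid e : Prop := elementary_entries e.1 e.2.

Definition is_decomposition D L : Prop :=
  (forall e, e \in L -> valid e) /\ D = entries_sum L.

Lemma upward_entries_sum L : upward (entries_sum L).
Proof. by elim: L => [|e L IHL]; [exact: upward_quadrant|exact: upward_msum]. Qed.

Lemma entries_sum_cat L L' :
  entries_sum (L ++ L') = msum (entries_sum L) (entries_sum L').
Proof.
elim: L => [|e L IHL] /=; last by rewrite IHL msumA.
by rewrite msum_quadrant//; exact: upward_entries_sum.
Qed.

Lemma entries_sum_edges (L : seq (nat * nat)) :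
  entries_sum [seq (Some p.1, Some p.2) | p <- L] = edge_sum L.
Proof. by elim: L => //= e L ->. Qed.

Lemma elementary_none_r a : elementary (Some a) None = newton_diagram [set (a, 0%N)] :> set plane.
Proof.
rewrite /elementary; congr newton_diagram; apply/seteqP; split=> [[x y] [[[->] /= ->]|[]]//|].
by move=> _ ->; left.
Qed.

Lemma elementary_none_l b : elementary None (Some b) = newton_diagram [set (0%N, b)] :> set plane.
Proof.
rewrite /elementary; congr newton_diagram; apply/seteqP; split=> [[x y] [[]//|[[->] /= ->]]|].
  by [].
by move=> _ ->; right.
Qed.

Lemma decomposition_exists D : is_newton_diagram D -> exists L, is_decomposition D L.
Proof.
move=> [E E0 ->]; have [P [b0 [L [_ _ _ Lpos [_ ->]]]]] := @nd_decomposition R E E0.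
pose axis1 (a : nat) : seq entries := if a == 0%N then [::] else [:: (Some a, None)].
pose axis2 (b : nat) : seq entries := if b == 0%N then [::] else [:: (None, Some b)].
exists (axis1 P.1 ++ axis2 b0 ++ [seq (Some p.1, Some p.2) | p <- L]); split.
  move=> e; rewrite !mem_cat => /or3P[||/mapP[[a b] /(allP Lpos) /andP[/= a0 b0'] ->]].
  - rewrite /axis1; case: eqP => // a0; rewrite inE => /eqP ->.
    by split=> //=; [case=> /a0|left].
  - rewrite /axis2; case: eqP => // a0; rewrite inE => /eqP ->.
    by split=> //=; [case=> /a0|right].
  - by split=> /=; [case=> a0'; rewrite a0' in a0|case=> b0''; rewrite b0'' in b0'|left].
rewrite !entries_sum_cat entries_sum_edges msumA; congr msum.
have qmsum D' : upward D' -> msum D' quadrant = D'.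
  by move=> uD; rewrite msumC msum_quadrant.
have -> : entries_sum (axis1 P.1) = newton_diagram [set (P.1, 0%N)].
  rewrite /axis1; case: eqP => [->|_] /=; first exact: quadrantE.
  by rewrite elementary_none_r qmsum//; exact: upward_nd.
have -> : entries_sum (axis2 b0) = newton_diagram [set (0%N, b0)].
  rewrite /axis2; case: eqP => [->|_] /=; first exact: quadrantE.
  by rewrite elementary_none_l qmsum//; exact: upward_nd.
rewrite msum_nd; congr newton_diagram; apply/seteqP; split.
  by move=> _ ->; exists (P.1, 0%N) => //; exists (0%N, b0) => //=; rewrite addn0.
by move=> _ [_ -> [_ -> <-]] /=; rewrite addn0.
Qed.

Definition area2 e e' : \bar R :=
  Order.min (entry e.1 * entry e'.2)%E (entry e'.1 * entry e.2)%E.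

Lemma area2C e e' : area2 e e' = area2 e' e. Proof. exact: minC. Qed.

Lemma area2_swap a b a' b' : area2 (a, b) (a', b') = area2 (b, a) (b', a').
Proof. by rewrite /area2 /= minC muleC (muleC (entry a)). Qed.

Lemma entry_ge0 a : (0 <= @entry R a)%E.
Proof. by case: a => [a|] /=; rewrite ?lee_fin ?leey. Qed.

Lemma area2_ge0 e e' : (0 <= area2 e e')%E.
Proof. by rewrite /area2 le_min !mule_ge0 ?entry_ge0. Qed.

(* The least weight on an elementary diagram, for the normal of {a' // b'}.    *)
Definition weight_entries (a' b' : nat) e : nat :=
  match e with
  | (Some a, Some b) => minn (b' * a) (a' * b)
  | (Some a, None) => b' * a
  | (None, Some b) => a' * b
  | (None, None) => 0
  end.

Lemma valid_cases e : valid e ->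
  [\/ exists a b, [/\ e = (Some a, Some b), (0 < a)%N & (0 < b)%N],
      exists2 a, e = (Some a, None) & (0 < a)%N |
      exists2 b, e = (None, Some b) & (0 < b)%N].
Proof.
case: e => [[[|a]|] [[|b]|]] [] //= _ _ [] // _.
- by constructor 1; exists a.+1, b.+1.
- by constructor 1; exists a.+1, b.+1.
- by constructor 2; exists a.+1.
- by constructor 3; exists b.+1.
Qed.

Lemma area2_fin e a' b' : valid e -> (0 < a')%N -> (0 < b')%N ->
  area2 e (Some a', Some b') = (weight_entries a' b' e)%:R%:E.
Proof.
move=> /valid_cases[[a [b [-> a0 b0]]]|[a -> a0]|[b -> b0]] a'0 b'0; rewrite /area2 /=.
- rewrite -!EFinM -!natrM (mulnC a) -EFin_min; congr EFin.
  case: (leqP (b' * a) (a' * b)) => h; first by apply/min_idPl; rewrite ler_nat.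
  by apply/min_idPr; rewrite ler_nat ltnW.
- by rewrite mulry gtr0_sg ?ltr0n// mul1e miney -EFinM -natrM mulnC.
- by rewrite mulyr gtr0_sg ?ltr0n// mul1e minye -EFinM -natrM.
Qed.

Lemma min_weight_entries_sum L a' b' : (forall e, e \in L -> valid e) ->
  min_weight b' a' (entries_sum L) (\sum_(e <- L) weight_entries a' b' e).
Proof.
elim: L => [|e L IHL] Lv; rewrite ?big_nil ?big_cons; first exact: min_weight_quadrant.
apply: min_weight_msum; last by apply: IHL => x xL; apply: Lv; rewrite inE xL orbT.
have /valid_cases[[a [b [-> a0 b0]]]|[a -> a0]|[b -> b0]] := Lv e (mem_head _ _).
- exact: (min_weight_edge _ _ (a, b)).
- have := @min_weight_point R b' a' a 0; rewrite muln0 addn0 /=.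
  by rewrite elementary_none_r.
- have := @min_weight_point R b' a' 0 b; rewrite muln0 add0n /=.
  by rewrite elementary_none_l.
Qed.

Lemma sum_area2_fin L a' b' : (forall e, e \in L -> valid e) ->
  (0 < a')%N -> (0 < b')%N ->
  (\sum_(e <- L) area2 e (Some a', Some b') =
   (\sum_(e <- L) weight_entries a' b' e)%N%:R%:E)%E.
Proof.
move=> Lv a0 b0; rewrite natr_sum -sumEFin !big_seq.
by apply: eq_bigr => e /Lv ev; rewrite area2_fin.
Qed.

(* An infinite entry is the limit of large finite ones; [F N] is the double    *)
(* area with the entry oo replaced by [N].                                    *)
Lemma sum_limit_le (F : nat -> entries -> \bar R) (Foo : entries -> \bar R) L L' :
  (forall N e, e \in L -> (0 <= F N e)%E) ->
  (forall N e, e \in L' -> (F N e <= Foo e)%E) ->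
  (forall e, e \in L -> (exists M, forall N, (M <= N)%N -> F N e = Foo e) \/
     forall N, (N%:R%:E <= F N e)%E) ->
  (forall N, (0 < N)%N -> \sum_(e <- L) F N e = \sum_(e <- L') F N e)%E ->
  (\sum_(e <- L) Foo e <= \sum_(e <- L') Foo e)%E.
Proof.
move=> F0 Fle Fcase Feq.
have FL' N : (\sum_(e <- L') F N e <= \sum_(e <- L') Foo e)%E.
  by rewrite !big_seq; apply: lee_sum => e; exact: Fle.
have [H|] := pselect (forall e, e \in L -> exists M, forall N, (M <= N)%N -> F N e = Foo e).
  have [M HM] : exists M, forall e N, e \in L -> (M <= N)%N -> F N e = Foo e.
    clear -H; elim: L H => [_|e L IHL H]; first by exists 0%N.
    have [M1 H1] := H e (mem_head _ _).
    have [|M2 H2] := IHL; first by move=> x xL; apply: H; rewrite inE xL orbT.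
    exists (maxn M1 M2) => x N; rewrite inE geq_max => /orP[/eqP ->|xL] /andP[N1 N2].
      exact: H1.
    exact: H2.
  apply: le_trans (FL' M.+1); rewrite -Feq// big_seq [leRHS]big_seq.
  by rewrite le_eqVlt; apply/orP; left; apply/eqP/eq_bigr => e eL; rewrite (HM _ M.+1).
move=> /existsNP[e /not_implyP[eL eno]].
have {}eno N : (N%:R%:E <= F N e)%E.
  by case: (Fcase e eL) => // H; case: (eno H).
have big N : (N.+1%:R%:E <= \sum_(e <- L') Foo e)%E.
  apply: le_trans (FL' N.+1); rewrite -Feq// (big_rem e eL)/=.
  apply: le_trans (eno N.+1) _; rewrite leeDl// big_seq sume_ge0// => x /mem_rem.
  exact: F0.
(* This sum dominates every natural number, so it is infinite. *)
case: (\sum_(e <- L') _)%E big => [r big|_|/(_ 0%N)//]; last by rewrite leey.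
have := big (Num.truncn r); rewrite lee_fin leNgt.
by have := truncnS_gt r => ->.
Qed.

(** As [N] grows, the minimum becomes constant when [y] is finite and stays above [N] when [y] is
    infinite; [sum_limit_le] asks for this alternative. *)
Lemma entry_cvg_cases (x : nat) (y : option nat) a' : (0 < x)%N -> (0 < a')%N ->
  y <> Some 0%N ->
  (exists M, forall N, (M <= N)%N ->
    Order.min (x%:R%:E * N%:R%:E) (a'%:R%:E * @entry R y) =
    Order.min (x%:R%:E * +oo) (a'%:R%:E * entry y))%E \/
  forall N, (N%:R%:E <= Order.min (x%:R%:E * N%:R%:E) (a'%:R%:E * @entry R y))%E.
Proof.
move=> x0 a0; case: y => [y|] _; [left|right] => /=.
  exists (a' * y)%N => N N1; rewrite mulry gtr0_sg ?ltr0n// mul1e minye.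
  apply/min_idPr; rewrite -!EFinM -!natrM lee_fin ler_nat.
  by apply: leq_trans N1 _; rewrite leq_pmull.
move=> N; rewrite mulry gtr0_sg ?ltr0n// mul1e miney -EFinM -natrM lee_fin ler_nat.
by rewrite leq_pmull.
Qed.

(** For finite entries both sums are the support function of the same diagram at [(b', a')]; an
    infinite entry is approached by [sum_limit_le]. An inequality is enough, as the hypotheses are
    symmetric in [L] and [L']. *)
Lemma sum_area2_le L L' e' : valid e' -> (forall e, e \in L -> valid e) ->
  (forall e, e \in L' -> valid e) -> entries_sum L = entries_sum L' ->
  (\sum_(e <- L) area2 e e' <= \sum_(e <- L') area2 e e')%E.
Proof.
move=> ve' Lv L'v LL'.
have eq_fin a' b' : (0 < a')%N -> (0 < b')%N ->
    (\sum_(e <- L) area2 e (Some a', Some b') =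
     \sum_(e <- L') area2 e (Some a', Some b'))%E.
  move=> a0 b0; rewrite !sum_area2_fin//.
  have := min_weight_entries_sum a' b' Lv; rewrite LL'.
  by move=> /min_weight_uniq -/(_ _ (min_weight_entries_sum a' b' L'v)) ->.
have mulle (x : option nat) N : (@entry R x * N%:R%:E <= entry x * +oo)%E.
  by rewrite lee_wpmul2l ?entry_ge0 ?leey.
have le_minl (x y z : \bar R) : (x <= y)%E -> (Order.min x z <= Order.min y z)%E.
  by move=> xy; rewrite le_min !ge_min xy lexx orbT.
case/valid_cases: (ve') => [[a' [b' [-> a0 b0]]]|[a' -> a0]|[b' -> b0]].
- by rewrite eq_fin.
- apply: (@sum_limit_le (fun N e => area2 e (Some a', Some N))) => [N e _|N e _|e eL|N N0].
  + exact: area2_ge0.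
  + by rewrite /area2; apply: le_minl; exact: mulle.
  + have /valid_cases[[a [b [-> x0 y0]]]|[a -> x0]|[b -> y0]] := Lv e eL.
    * by apply: entry_cvg_cases => //; case=> y0'; rewrite y0' in y0.
    * exact: entry_cvg_cases.
    (* The threshold is 1 because [oo * 0 = 0]. *)
    * left; exists 1%N => N N0; rewrite /area2 /= mulyr gtr0_sg ?ltr0n//.
      by rewrite mul1e mulyy.
  + exact: eq_fin.
- apply: (@sum_limit_le (fun N e => area2 e (Some N, Some b'))) => [N e _|N e _|e eL|N N0].
  + exact: area2_ge0.
  + by case: e => a b; rewrite !(area2_swap a) /area2; apply: le_minl; exact: mulle.
  + have /valid_cases[[a [b [-> x0 y0]]]|[a -> x0]|[b -> y0]] := Lv e eL.
    * case: (@entry_cvg_cases b (Some a) b') => // [[]x0'|[M HM]|H]; first by rewrite x0' in x0.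
        by left; exists M => N /HM; rewrite !(area2_swap (Some a)).
      by right=> N; rewrite area2_swap; exact: H.
    * left; exists 1%N => N N0; rewrite !(area2_swap (Some a)) /area2 /=.
      by rewrite mulyr gtr0_sg ?ltr0n// mul1e mulyy.
    * case: (@entry_cvg_cases b None b') => // [[M HM]|H].
        by left; exists M => N /HM; rewrite !(area2_swap None).
      by right=> N; rewrite area2_swap; exact: H.
  + exact: eq_fin.
Qed.

Definition area2_sum L L' : \bar R := (\sum_(e <- L) \sum_(e' <- L') area2 e e')%E.

Lemma area2_sumC L L' : area2_sum L L' = area2_sum L' L.
Proof.
rewrite /area2_sum exchange_big; apply: eq_bigr => e _; apply: eq_bigr => e' _.
exact: area2C.
Qed.

Lemma area2_sum_wd D L1 L2 L : is_decomposition D L1 -> is_decomposition D L2 ->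
  (forall e, e \in L -> valid e) -> area2_sum L1 L = area2_sum L2 L.
Proof.
move=> [L1v D1] [L2v D2] Lv; have L12 := etrans (esym D1) D2.
rewrite /area2_sum exchange_big [RHS]exchange_big !big_seq; apply: eq_bigr => e' /Lv ve'.
by apply/eqP; rewrite eq_le !sum_area2_le.
Qed.

Definition decomposition D : seq entries := xget [::] (is_decomposition D).

Lemma decompositionP D : is_newton_diagram D -> is_decomposition D (decomposition D).
Proof. by move=> /decomposition_exists; exact: xgetPex. Qed.

Lemma is_decomposition_msum D D' L L' : is_decomposition D L ->
  is_decomposition D' L' -> is_decomposition (msum D D') (L ++ L').
Proof.
move=> [Lv ->] [L'v ->]; split; last by rewrite entries_sum_cat.
by move=> e; rewrite mem_cat => /orP[/Lv|/L'v].
Qed.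

Lemma is_decomposition_elementary e : valid e ->
  is_decomposition (elementary e.1 e.2) [:: e].
Proof.
move=> ve; split; first by move=> x; rewrite inE => /eqP ->.
by rewrite /= msumC msum_quadrant//; exact: upward_nd.
Qed.

Lemma is_newton_elementary e : valid e -> is_newton_diagram (@elementary R e.1 e.2).
Proof.
move=> ve; eexists; last reflexivity.
case/valid_cases: ve => [[a [b [-> _ _]]]|[a -> _]|[b -> _]].
- by exists (a, 0%N); left.
- by exists (a, 0%N); left.
- by exists (0%N, b); right.
Qed.

Lemma is_newton_quadrant : is_newton_diagram (@quadrant R).
Proof. by rewrite quadrantE; eexists; last reflexivity; exists (0%N, 0%N). Qed.

(** [double_area] is picked by [xget], so a witness is required: elementary areas summed over chosen
    decompositions. By [area2_sum_wd] the choice is immaterial, and concatenating decompositions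
    gives additivity. *)
Theorem double_areaP : is_double_area (@double_area R).
Proof.
apply: xgetPex; exists (fun D D' => area2_sum (decomposition D) (decomposition D')).
have add D1 D2 D : is_newton_diagram D1 -> is_newton_diagram D2 ->
    is_newton_diagram D -> area2_sum (decomposition (msum D1 D2)) (decomposition D) =
    (area2_sum (decomposition D1) (decomposition D) +
     area2_sum (decomposition D2) (decomposition D))%E.
  move=> N1 N2 ND.
  have := is_decomposition_msum (decompositionP N1) (decompositionP N2).
  move=> /(area2_sum_wd (decompositionP (is_newton_diagram_msum N1 N2))) ->.
    by rewrite /area2_sum big_cat.
  exact: (decompositionP ND).1.
split=> [D D' _ _|//|D D1 D2 ND N1 N2|D ND|a b a' b' ab ab'].
- exact: area2_sumC.
- by rewrite !(area2_sumC (decomposition D)) add.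
- have q : is_decomposition (@quadrant R) [::] by [].
  rewrite (area2_sum_wd (decompositionP is_newton_quadrant) q).
    by rewrite /area2_sum big_nil.
  exact: (decompositionP ND).1.
have N1 := @is_newton_elementary (a, b) ab.
have N2 := @is_newton_elementary (a', b') ab'.
have d1 := is_decomposition_elementary (e := (a, b)) ab.
have d2 := is_decomposition_elementary (e := (a', b')) ab'.
rewrite (area2_sum_wd (decompositionP N1) d1); last exact: (decompositionP N2).1.
rewrite area2_sumC (area2_sum_wd (decompositionP N2) d2); last exact: d1.1.
by rewrite /area2_sum !big_seq1 area2C.
Qed.

(** The double area of [D] with {a//b} is the support function of [D] at [(b, a)], since this holds
    for each elementary summand of [D] and both sides are additive. *)
Lemma double_area_edge_sum D (L : seq (nat * nat)) (k : nat * nat -> nat) :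
  is_newton_diagram D -> all (fun p => (0 < p.1) && (0 < p.2))%N L ->
  (forall p, p \in L -> min_weight p.2 p.1 D (k p)) ->
  double_area D (edge_sum L) = (\sum_(p <- L) k p)%N%:R%:E.
Proof.
move=> ND; have [sym addl addr q0 elem] := double_areaP.
have [LL [LLv DE]] := decomposition_exists ND.
have nL (L' : seq (nat * nat)) : is_newton_diagram (@edge_sum R L').
  elim: L' => [|p L' IHL]; first exact: is_newton_quadrant.
  apply: is_newton_diagram_msum => //; eexists; last reflexivity.
  by exists (p.1, 0%N); left.
elim: L => [|p L IHL] /= Lpos kP.
  by rewrite big_nil sym// ?q0//; exact: is_newton_quadrant.
case/andP: Lpos => /andP[p1 p2] Lpos.
have vp : elementary_entries (Some p.1) (Some p.2).
  by split; [case=> e0; rewrite e0 in p1|case=> e0; rewrite e0 in p2|left].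
have Np := @is_newton_elementary (Some p.1, Some p.2) vp.
rewrite big_cons natrD EFinD addr//; congr (_ + _)%E; last first.
  by apply: IHL => // x xL; apply: kP; rewrite inE xL orbT.
have := kP p (mem_head _ _); rewrite {}DE in kP ND *.
have := min_weight_entries_sum p.1 p.2 LLv; move=> /min_weight_uniq H /H <-.
rewrite -sum_area2_fin//.
clear -sym addl q0 elem LLv vp Np; elim: LL LLv => [|e LL IHLL] LLv.
  by rewrite big_nil q0.
have ve := LLv e (mem_head _ _).
have LLv' x : x \in LL -> valid x by move=> xL; apply: LLv; rewrite inE xL orbT.
rewrite big_cons -IHLL//= addl//; last 2 first.
- exact: is_newton_elementary.
- clear -LLv'; elim: LL LLv' => [|x LL IH] LLv'; first exact: is_newton_quadrant.
  apply: is_newton_diagram_msum.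
    by apply: is_newton_elementary; apply: LLv'; exact: mem_head.
  by apply: IH => y yL; apply: LLv'; rewrite inE yL orbT.
by congr (_ + _)%E; rewrite elem.
Qed.



End DoubleArea.

(** * Codimension of ideals *)

Section Ideals.
Context {K : numFieldType}.
Implicit Types (f g h u v : cps K) (k d n : nat).
Local Notation edim := (@edim _ K _).

Definition cps_mul f : cps K -> cps K := fun u => f * u.
Lemma cps_mul_linear f : linear (cps_mul f).
Proof. by move=> a u v; rewrite /cps_mul mulrDr scalerAr. Qed.
HB.instance Definition _ f := GRing.isLinear.Build K (cps K) (cps K) _ (cps_mul f)
  (cps_mul_linear f).

Lemma ideal2P f g u : ideal2 f g u <-> exists p q, u = p * f + q * g.
Proof.
by split=> [[p _ [q _ <-]]|[p [q ->]]]; [exists p, q|exists p => //; exists q].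
Qed.

Lemma ideal2C f g : ideal2 f g = ideal2 g f.
Proof.
by apply/seteqP; split=> u /ideal2P[p [q ->]]; apply/ideal2P; exists q, p; rewrite addrC.
Qed.

Lemma submod_ideal2 f g : is_submod (ideal2 f g).
Proof.
split=> [|a u v]; first by exists 0 => //; exists 0 => //; rewrite !mul0r addr0.
move=> /ideal2P[p [q ->]] /ideal2P[p' [q' ->]]; apply/ideal2P.
exists (a *: p + p'), (a *: q + q').
by rewrite scalerDr !mulrDl !scalerAl addrACA.
Qed.

Lemma ideal2Ml f g u v : ideal2 f g u -> ideal2 f g (v * u).
Proof.
move=> /ideal2P[p [q ->]]; apply/ideal2P; exists (v * p), (v * q).
by rewrite mulrDr !mulrA.
Qed.

Lemma torsion_dvd k p q g d : yorder (g 0%N) d -> cpsX ^+ k * p = q * g ->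
  exists q', p = q' * g.
Proof.
move=> gd pq; have [q' qE] := rows_divX (rows_torsion gd pq); exists q'.
have X0 : cpsX ^+ k != 0 :> cps K.
  apply/eqP => /(congr1 (fun u : cps K => u k 0%N)); rewrite cpsXn/= /monoc !eqxx.
  by move/eqP; rewrite oner_eq0.
by apply: (mulfI X0); rewrite pq qE mulrA.
Qed.

Lemma mono_lc n (c : 'I_n -> K) i j : (\sum_(k < n) c k *: cpsY ^+ k) i j =
  if i == 0%N then oapp c 0 (insub j) else 0.
Proof.
rewrite coefs_sum; under eq_bigr do rewrite coefsZ cpsYn /= /monoc.
case: eqP => _ /=; last by rewrite big1// => k _; rewrite mulr0.
case: insubP => [k _ <-|jn] /=.
  rewrite (bigD1 k)//= eqxx mulr1 big1 ?addr0// => l lk.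
  by rewrite (inj_eq val_inj) eq_sym (negbTE lk) mulr0.
rewrite big1// => k _; rewrite (_ : (j == k :> nat) = false) ?mulr0//.
by apply/negbTE; apply: contra jn => /eqP ->.
Qed.

(** Weierstrass division by [g] followed by reduction modulo [X] leaves the basis
    [1, Y, ..., Y^(d-1)]. *)
Lemma fdim_idealX1 g d : yorder (g 0%N) d -> fdim setT (ideal2 g cpsX) d.
Proof.
move=> gd; exists (fun k : 'I_d => cpsY ^+ k); split=> // [c|u _].
  move=> /ideal2P[p [q E]] k.
  have := congr1 (fun u => coefs u 0%N k) E.
  rewrite mono_lc eqxx valK coefsD -[cpsX]expr1 (mulrC q) coefsXnM ltnn addr0 /oapp => ->.
  rewrite coefsM_row0// big1// => l _; rewrite gd.1 ?mulr0//.
  exact: leq_ltn_trans (leq_subr _ _) (ltn_ord k).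
have [q [r [uE r0]]] := weierstrass_division u gd.
exists (fun k => r 0%N k); apply/ideal2P.
have /rows_divX[p pE] : rows_from 1 (r - \sum_(k < d) r 0%N k *: cpsY ^+ k).
  move=> [|//] _ j; rewrite coefsB mono_lc/=; case: insubP => [k _ <-|] /=.
    by rewrite subrr.
  by rewrite -leqNgt => /r0 ->; rewrite subrr.
by exists q, p; rewrite uE -addrA pE expr1 (mulrC p).
Qed.

(** In a finite dimensional quotient the powers of [X] are dependent, so [(g, f)] contains a nonzero
    polynomial in [X], and hence some [X^i]. If [g] divides [f * v], it then divides [X^i * v], and
    [torsion_dvd] removes [X^i]. *)
Lemma regular_mod g f d n : yorder (g 0%N) d -> fdim setT (ideal2 g f) n ->
  forall p v, f * v = p * g -> exists q, v = q * g.
Proof.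
move=> gd [e [_ _ eI]] p v fv.
have : ~ indep_mod (ideal2 g f) (fun k : 'I_n.+1 => cpsX ^+ k).
  move=> /(span_indep_le (submod_ideal2 g f) eI); rewrite ltnn.
  by move=> H; have := H (fun=> I).
move=> /existsNP[c /not_implyP[Ic /existsNP[k0 ck0]]].
pose u := \sum_i c i *: cpsX ^+ i : cps K.
have uE i j : u i j = if j == 0%N then oapp c 0 (insub i) else 0.
  rewrite coefs_sum; under eq_bigr do rewrite coefsZ cpsXn /= /monoc andbC.
  case: eqP => _ /=; last by rewrite big1// => k _; rewrite mulr0.
  case: insubP => [k _ <-|jn] /=.
    rewrite (bigD1 k)//= eqxx mulr1 big1 ?addr0// => l lk.
    by rewrite (inj_eq val_inj) eq_sym (negbTE lk) mulr0.
  rewrite big1// => k _; rewrite (_ : (i == k :> nat) = false) ?mulr0//.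
  by apply/negbTE; apply: contra jn => /eqP ->.
have u0 : u != 0.
  apply/eqP => /(congr1 (fun w => coefs w k0 0%N)); rewrite uE eqxx valK.
  exact: ck0.
have [i [[j uij] ulow]] := low_row u0.
have [w wE] := rows_divX ulow.
have wU : w \is a GRing.unit.
  have j0 : j = 0%N.
    by apply/eqP; apply: contraNT uij => /negbTE jn; rewrite uE jn.
  by rewrite cps_unitE; move: uij; rewrite j0 wE coefsXnM leqnn subnn.
have /ideal2P[a [b XE]] : ideal2 g f (cpsX ^+ i).
  rewrite (_ : cpsX ^+ i = w^-1 * u); first exact: ideal2Ml.
  by rewrite wE mulrC mulrK.
apply: (torsion_dvd (k := i) (q := a * v + b * p) gd).
by rewrite XE !mulrDl -[b * f * v]mulrA fv; ring.
Qed.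

End Ideals.

Section IdealDimension.
Context {R : realType} {K : numFieldType}.
Implicit Types (f g : cps K) (k d : nat).
Local Notation edim := (@edim R K _).

(** In the chain from [(g, X^k f)] through [(g, X^k)] to the whole ring, multiplication by [X^k]
    identifies the quotient by [(g, f)] with the lower step. *)
Lemma edim_idealXM k f g d : yorder (g 0%N) d ->
  edim setT (ideal2 g (cpsX ^+ k * f)) =
  (edim setT (ideal2 g (cpsX ^+ k)) + edim setT (ideal2 g f))%E.
Proof.
move=> gd; rewrite (@edim_chain _ _ _ setT (ideal2 g (cpsX ^+ k))); last 5 first.
- exact: submodT.
- exact: submod_ideal2.
- exact: submod_ideal2.
- move=> u /ideal2P[p [q ->]]; apply/ideal2P; exists p, (q * f).
  by rewrite -mulrA (mulrC f).
- by [].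
congr (_ + _)%E; apply/esym.
apply: (@edim_transport _ _ _ _ (cps_mul (cpsX ^+ k))).
- exact: submod_ideal2.
- by move=> w _; apply/ideal2P; exists 0, w; rewrite mul0r add0r mulrC.
- move=> w /ideal2P[p [q ->]]; exists q => //; apply/ideal2P; exists p, 0.
  by rewrite /= /cps_mul (mulrC q) addrK mul0r addr0.
- exact: submodT.
- exact: submod_ideal2.
- exact: submod_ideal2.
move=> w _; split=> /ideal2P[p [q E]]; apply/ideal2P.
  by exists (cpsX ^+ k * p), q; rewrite /= /cps_mul E mulrDr mulrA (mulrCA q).
have [|p' pE] := @torsion_dvd _ k (w - q * f) p g d gd.
  by rewrite mulrBr [cpsX ^+ k * w](E : _ = _) (mulrCA q) addrK.
by exists p', q; rewrite -pE subrK.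
Qed.

Lemma edim_idealX k g d : yorder (g 0%N) d ->
  edim setT (ideal2 g (cpsX ^+ k)) = (k * d)%:R%:E.
Proof.
move=> gd; elim: k => [|k IHk].
  rewrite (@edim_fin _ _ _ _ _ 0)//; first exact: submod_ideal2.
  exists (fun=> 0); split=> // [c _ []//|v _]; exists (fun=> 0).
  by apply/ideal2P; exists 0, v; rewrite big_ord0 expr0; ring.
rewrite exprSr (edim_idealXM _ _ gd) IHk.
rewrite (edim_fin (submod_ideal2 _ _) (fdim_idealX1 gd)).
by rewrite -EFinD -natrD mulSn addnC.
Qed.

End IdealDimension.

(** * Series in [X] alone, and generators over them *)

Section XOnly.
Context {K : numClosedFieldType}.
Implicit Types (f g r : cps K).

Definition xonly f : Prop := forall i j, (0 < j)%N -> f i j = 0.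

Lemma xonly0 : xonly 0. Proof. by []. Qed.

Lemma xonly1 : xonly 1. Proof. by move=> i [|j] // _; rewrite coefs1 andbF. Qed.

Lemma xonlyD f g : xonly f -> xonly g -> xonly (f + g).
Proof. by move=> fx gx i j j0; rewrite coefsD fx ?gx ?addr0. Qed.

Lemma xonlyN f : xonly f -> xonly (- f).
Proof. by move=> fx i j j0; rewrite coefsN fx ?oppr0. Qed.

Lemma coefsM_xonly f g i j : xonly g ->
  (f * g) i j = \sum_(k < i.+1) f k j * g (i - k)%N 0%N.
Proof.
move=> gx; rewrite coefsM; apply: eq_bigr => k _.
rewrite big_ord_recr/= subnn big1 ?add0r// => l _.
by rewrite gx ?mulr0// subn_gt0.
Qed.

Lemma xonlyM f g : xonly f -> xonly g -> xonly (f * g).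
Proof.
by move=> fx gx i j j0; rewrite coefsM_xonly// big1// => k _; rewrite fx ?mul0r.
Qed.

Lemma xonly_det n (M : 'M[cps K]_n) : (forall i j, xonly (M i j)) -> xonly (\det M).
Proof.
move=> Mx; rewrite /determinant; elim/big_ind: _ => [||s _].
- exact: xonly0.
- exact: xonlyD.
apply: xonlyM; last by elim/big_ind: _ => [||i _]; [exact: xonly1|exact: xonlyM|exact: Mx].
by case: (perm.odd_perm s); rewrite ?expr0 ?expr1; [apply: xonlyN|]; exact: xonly1.
Qed.

Lemma xonly_unit_factor f : xonly f -> f != 0 ->
  exists e g, f = cpsX ^+ e * g /\ g \is a GRing.unit.
Proof.
move=> fx f0; have [e [[j fej] fe]] := low_row f0; have [g fE] := rows_divX fe.
exists e, g; split=> //; rewrite cps_unitE.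
have j0 : j = 0%N.
  by apply/eqP; apply: contraNT fej => j0; rewrite fx// lt0n.
by move: fej; rewrite j0 fE coefsXnM leqnn subnn.
Qed.

(** Collects the coefficients of the [X^(n a + p) Y^j] into a series in [X], so that powers of [X]
    can be sorted by their residue modulo [n]. *)
Definition row_extract n p j (c : nat -> nat -> K) : nat -> nat -> K :=
  fun a j' => if j' == 0%N then c (n * a + p)%N j else 0.

Lemma convergent_row_extract n p j f : (0 < n)%N ->
  row_extract n p j f \in convergent.
Proof.
move=> n0; have [s [C [s0 fC]]] := cps_radius f.
have fbound i : `|f i j| * s ^+ (i + j) <= C.
  have iN : (i < (maxn i j).+1)%N by rewrite ltnS leq_maxl.
  have jN : (j < (maxn i j).+1)%N by rewrite ltnS leq_maxr.
  apply: le_trans (fC (maxn i j).+1); rewrite /abs_psum (bigD1 (Ordinal iN))//=.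
  rewrite (bigD1 (Ordinal jN))//= -addrA lerDl addr_ge0//; apply: sumr_ge0 => k _.
    by rewrite mulr_ge0 ?exprn_ge0 ?(ltW s0).
  by apply: sumr_ge0 => l _; rewrite mulr_ge0 ?exprn_ge0 ?(ltW s0).
have C0 : 0 <= C by have := fC 0%N; rewrite /abs_psum big_ord0.
pose D := C / s ^+ (p + j).
have D0 : 0 <= D by rewrite divr_ge0 ?exprn_ge0 ?(ltW s0).
(* The bound on single coefficients makes the terms at radius [s ^+ n] bounded; halving that radius
   gives a geometric series. *)
apply/convergentP; exists (s ^+ n / 2), (2 * D); split=> [|N].
  by rewrite divr_gt0 ?exprn_gt0.
apply: le_trans (sum_half N D0); apply: ler_sum => a _.
rewrite (_ : \sum_(j' < N) _ =
    \sum_(j' < N) if j' == 0%N :> nat then `|f (n * a + p)%N j| * (s ^+ n / 2) ^+ a else 0).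
  rewrite -big_mkcond/=; case: N a => [[//]|N] a; rewrite (big_pred1 ord0) => [|k]; last first.
    by rewrite /= -(inj_eq val_inj).
  rewrite ler_pdivlMr ?exprn_gt0// expr_div_n -exprM mulrA mulfVK ?expf_neq0 ?pnatr_eq0//.
  rewrite ler_pdivlMr ?exprn_gt0// -mulrA -exprD addnA; exact: fbound.
apply: eq_bigr => j' _; rewrite /row_extract; case: eqP => [->|_]; first by rewrite addn0.
by rewrite normr0 mul0r.
Qed.

Lemma row_extract_exists n p j f : (0 < n)%N ->
  exists2 g, xonly g & forall a, g a 0%N = f (n * a + p)%N j.
Proof.
move=> n0; exists (CPS (convergent_row_extract p j f n0)) => //.
by move=> a [|j'].
Qed.

Context (n m : nat) (n0 : (0 < n)%N) (m0 : (0 < m)%N) (al : K).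
Local Notation pi_tau := (pi_tau n0 m0 al).

Lemma coef_pi_tau_xonly r i j : xonly r ->
  pi_tau r i j = if (j == 0%N) && (n %| i)%N then r (i %/ n)%N 0%N else 0.
Proof.
move=> rx; rewrite coef_pi_tau.
have -> : slice n m r i = (if (n %| i)%N then r (i %/ n)%N 0%N else 0)%:P.
  apply/polyP => b; rewrite coefC coef_poly; case: b => [|b] /=.
    by rewrite muln0 subn0.
  by rewrite rx// !if_same.
by rewrite comp_polyC coefC; case: (j == 0%N).
Qed.

Lemma pi_tauX : pi_tau cpsX = cpsX ^+ n.
Proof.
apply: cpsP => i j; rewrite cpsXn coef_pi_tau_xonly; last first.
  by move=> a [|j'] // _; rewrite /= /monoc andbF.
rewrite /= /monoc; case: (eqVneq j 0%N) => _ /=; last by rewrite andbF.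
rewrite !andbT; case: ifP => [/dvdnP[q ->]|nd].
  by rewrite mulnK// -{2}[n]mul1n eqn_pmul2r.
by rewrite (_ : (i == n) = false)//; apply: contraFF nd => /eqP ->.
Qed.

(** After Weierstrass division the remainder has degree less than [d] in [Y]. Sorting its exponents
    of [X] modulo [n] leaves coefficients in [X^n], which are the images under [pi_tau] of series in
    [X]. *)
Lemma generate_rows g d v : yorder (g 0%N) d ->
  exists r : 'I_n * 'I_d -> cps K, (forall x, xonly (r x)) /\
  exists q, v = q * g + \sum_x pi_tau (r x) * (cpsX ^+ x.1 * cpsY ^+ x.2).
Proof.
move=> gd; have [q [w [vE w0]]] := weierstrass_division v gd.
pose P (x : 'I_n * 'I_d) g := xonly g /\ forall a, g a 0%N = w (n * a + x.1)%N x.2.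
have [x|r rP] := choice (fun x => _ : exists g, P x g).
  by have [r rx rE] := row_extract_exists x.1 x.2 w n0; exists r.
exists r; split=> [x|]; first exact: (rP x).1.
exists q; rewrite vE; congr (_ + _); apply: cpsP => i j; rewrite coefs_sum.
have E (x : 'I_n * 'I_d) : (pi_tau (r x) * (cpsX ^+ x.1 * cpsY ^+ x.2)) i j =
    if (x.1 == i %% n :> nat)%N && (x.2 == j :> nat) then w i j else 0.
  rewrite mulrC -mulrA coefsXnM; case: ltnP => [ix|xi].
    rewrite ifN// negb_and; apply/orP; left; apply/eqP => xE.
    by move: ix; rewrite xE ltnNge leq_mod.
  rewrite coefsYnM coef_pi_tau_xonly; last exact: (rP x).1.
  have -> : (x.1 == i %% n :> nat)%N = (n %| i - x.1)%N.
    rewrite -eqn_mod_dvd// (modn_small (ltn_ord x.1)) eq_sym.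
    by [].
  case: (ltngtP x.2 j) => xj /=; rewrite ?andbF//.
    by rewrite subn_eq0 leqNgt xj.
  rewrite andbT xj subnn eqxx/=; case: ifP => // nd.
  by rewrite (rP x).2 mulnC divnK// subnK// xj.
pose c (x : 'I_n * 'I_d) := (x.1 == i %% n :> nat)%N && (x.2 == j :> nat).
transitivity (\sum_(x | c x) w i j); last first.
  by rewrite big_mkcond; apply: eq_bigr => x _; rewrite E.
have [dj|jd] := leqP d j; first by rewrite w0// big1_eq.
have im : (i %% n < n)%N by rewrite ltn_mod.
by rewrite (big_pred1 (Ordinal im, Ordinal jd)).
Qed.

End XOnly.

(** * The comparison map to the strict transforms and its cokernel *)

Section Core.
Context {R : realType} {K : numClosedFieldType}.
Context (t : nat) (n_ m_ : 'I_t -> nat) (n0 : forall i, (0 < n_ i)%N)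
  (m0 : forall i, (0 < m_ i)%N) (al_ : 'I_t -> K).
Context (h : cps K) (hs : 'I_t -> cps K) (ds kh : 'I_t -> nat).
Local Notation edim := (@edim R K _).
Local Notation pi_ i := (pi_tau (n0 i) (m0 i) (al_ i)).
Local Notation V := ('I_t -> cps K).

Hypothesis hsE : forall i, pi_ i h = cpsX ^+ kh i * hs i.
Hypothesis hs_order : forall i, yorder (hs i 0%N) (ds i).
Let index := {i : 'I_t & ('I_(n_ i) * 'I_(ds i))%type}.
Let b := #|{: index}|.
Hypothesis h_order : yorder (h 0%N) b.
Hypothesis low_degree_inj : forall u : cps K,
  (forall i j, (b <= j)%N -> u i j = 0) ->
  (forall i, exists q, pi_ i u = q * hs i) -> u = 0.

Definition all_multiples : set V := [set v | forall i, exists q, v i = q * hs i].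
Local Notation H := all_multiples.

Lemma submod_multiples : is_submod H.
Proof.
split=> [i|a u v Hu Hv i]; first by exists 0; rewrite mul0r.
have [p pE] := Hu i; have [q qE] := Hv i; exists (a *: p + q).
by rewrite mulrDl -scalerAl -pE -qE.
Qed.
Local Notation sH := submod_multiples.

Definition pullback (u : cps K) : V := fun i => pi_ i u.
Lemma pullback_linear : linear pullback.
Proof. by move=> a u v; apply/funext => i; rewrite /pullback linearP. Qed.
HB.instance Definition _ := GRing.isLinear.Build K (cps K) V _ pullback pullback_linear.

(** Makes [V] a module over the source ring; in particular [X] acts on component [i] as
    [X^(n_ i)]. *)
Definition act (u : cps K) (v : V) : V := fun i => pi_ i u * v i.
Lemma act_linear u : linear (act u).
Proof. by move=> a v w; apply/funext => i; rewrite /act mulrDr -scalerAr. Qed.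
HB.instance Definition _ u := GRing.isLinear.Build K V V _ (act u) (act_linear u).

Lemma actA u w v : act (u * w) v = act u (act w v).
Proof. by apply/funext => i; rewrite /act rmorphM mulrA. Qed.
Lemma actDl u w v : act (u + w) v = act u v + act w v.
Proof. by apply/funext => i; rewrite /act rmorphD mulrDl. Qed.
Lemma act0 v : act 0 v = 0.
Proof. by apply/funext => i; rewrite /act rmorph0 mul0r. Qed.
Lemma act_suml (I : Type) (r : seq I) (F : I -> cps K) v :
  act (\sum_(i <- r) F i) v = \sum_(i <- r) act (F i) v.
Proof. exact: (big_morph (fun u => act u v) (fun u w => actDl u w v) (act0 v)). Qed.
Lemma pullbackM u w : pullback (u * w) = act u (pullback w).
Proof. by apply/funext => i; rewrite /pullback /act rmorphM. Qed.
Lemma H_act u v : H v -> H (act u v).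
Proof. by move=> Hv i; have [q qE] := Hv i; exists (pi_ i u * q); rewrite /act qE mulrA. Qed.

Definition generator (k : 'I_b) : V := fun i =>
  let x : index := enum_val k in
  if tag x == i then cpsX ^+ (tagged x).1 * cpsY ^+ (tagged x).2 else 0.

Lemma generate v : exists r : 'I_b -> cps K, (forall k, xonly (r k)) /\
  H (v - \sum_k act (r k) (generator k)).
Proof.
pose G i := cid (generate_rows (n0 i) (m0 i) (al_ i) (v i) (hs_order i)).
pose r i := sval (G i); have rP i := svalP (G i).
exists (fun k => let x : index := enum_val k in r (tag x) (tagged x)); split=> [k|i].
  exact: (rP _).1.
have [q vE] := (rP i).2; exists q; rewrite -[LHS]/(v i - (\sum_k _) i) fct_sumE {1}vE.
rewrite -addrA -[RHS]addr0; congr (_ + _); apply/eqP; rewrite subr_eq0; apply/eqP.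
transitivity (\sum_(x : index) pi_ i (r (tag x) (tagged x)) *
    (if tag x == i then cpsX ^+ (tagged x).1 * cpsY ^+ (tagged x).2 else 0)); last first.
  by rewrite big_enum_val.
pose F i' (x : 'I_(n_ i') * 'I_(ds i')) := pi_ i (r i' x) *
    (if i' == i then cpsX ^+ x.1 * cpsY ^+ x.2 else 0).
transitivity (\sum_(x : index) F (tag x) (tagged x)) => //.
have := @sig_big_dep _ _ (@GRing.add (cps K)) _ _ predT (fun i' => predT) F.
move=> /= <-; rewrite (bigD1 i)//= [X in _ + X]big1 ?addr0.
  by apply: eq_bigr => x _; rewrite /F eqxx.
by move=> i' ii'; rewrite big1// => x _; rewrite /F (negbTE ii') mulr0.
Qed.

Lemma pullback_generators : exists M : 'M[cps K]_b, (forall a k, xonly (M a k)) /\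
  forall a : 'I_b, H (pullback (cpsY ^+ a) - \sum_k act (M a k) (generator k)).
Proof.
have [r rP] := choice (fun a : 'I_b => generate (pullback (cpsY ^+ a))).
exists (\matrix_(a, k) r a k); split=> [a k|a]; first by rewrite mxE; exact: (rP a).1.
by under eq_bigr do rewrite mxE; exact: (rP a).2.
Qed.

Lemma combination_generators (M : 'M[cps K]_b) (c : 'I_b -> cps K) :
  (forall a : 'I_b, H (pullback (cpsY ^+ a) - \sum_k act (M a k) (generator k))) ->
  H (pullback (\sum_a c a * cpsY ^+ a) -
     \sum_k act (\sum_a c a * M a k) (generator k)).
Proof.
move=> HM; rewrite linear_sum/=.
under [X in _ - X]eq_bigr do rewrite act_suml.
rewrite exchange_big -sumrB; apply: (submod_sum sH) => a _.
rewrite pullbackM; under eq_bigr do rewrite actA.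
by rewrite -linear_sum -linearB; apply: H_act; exact: HM.
Qed.

(** A row vector killed by [M] may be replaced by its coefficients at one power [Y^j0], as the
    entries of [M] involve [X] only. These coefficients define a nonzero polynomial of degree less
    than [b] in [Y] that is sent into [H], against [low_degree_inj]. *)
Lemma det_neq0 (M : 'M[cps K]_b) : (forall a k, xonly (M a k)) ->
  (forall a : 'I_b, H (pullback (cpsY ^+ a) - \sum_k act (M a k) (generator k))) ->
  \det M != 0.
Proof.
move=> Mx HM; apply/negP => /det0P[v v0 vM].
have [a0 va0] : exists a, v 0 a != 0.
  apply/not_existsP => va; move/eqP: v0; apply; apply/rowP => a; rewrite mxE.
  by apply/eqP/negPn/negP; exact: va.
have [i0 [[j0 vij] _]] := low_row va0.
pose c a := CPS (convergent_row_extract 0 j0 (v 0 a) (ltnSn 0)).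
have cE a i : c a i 0%N = v 0 a i j0 by rewrite /= /row_extract eqxx mul1n addn0.
have cx a : xonly (c a) by move=> i [|j].
have cM k : \sum_a c a * M a k = 0.
  apply: cpsP => i [|j]; last first.
    rewrite coefs_sum big1// => a _; rewrite [LHS](xonlyM (cx a) (Mx a k))//.
  have := congr1 (fun A : 'rV_b => A 0 k) vM; rewrite !mxE => vMk.
  rewrite coefs_sum; transitivity (\sum_a (v 0 a * M a k) i j0); last first.
    by rewrite -coefs_sum vMk.
  apply: eq_bigr => a _; rewrite !(coefsM_xonly _ _ _ (Mx a k)).
  by apply: eq_bigr => l _; rewrite cE.
have := combination_generators c HM.
under [X in _ - X]eq_bigr do rewrite cM act0.
rewrite big1_eq subr0 => /low_degree_inj u0.
move/eqP: vij; apply; rewrite -cE.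
have uE i j : (\sum_a c a * cpsY ^+ a) i j = oapp (fun a => c a i 0%N) 0 (insub j).
  rewrite coefs_sum.
  have E (a : 'I_b) : (c a * cpsY ^+ a) i j = if a == j :> nat then c a i 0%N else 0.
    rewrite mulrC coefsYnM; case: (ltngtP a j) => aj //.
      by rewrite cx// subn_gt0.
    by rewrite aj subnn.
  transitivity (\sum_(a < b) if a == j :> nat then c a i 0%N else 0).
    by apply: eq_bigr => a _; exact: E.
  rewrite -big_mkcond; case: insubP => [a _ <-|jb] /=.
    by rewrite (big_pred1 a).
  rewrite big_pred0// => a; apply: contraNF jb => /eqP <-; exact: ltn_ord.
have : (\sum_a c a * cpsY ^+ a) i0 a0 = 0.
  rewrite u0// => i j bj; rewrite uE; case: insubP => [a jb _|//].
  by move: jb; rewrite ltnNge bj.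
by rewrite uE valK.
Qed.

Definition image_mod (f : cps K) : set V := [set v | exists u, H (v - pullback (u * f))].

Lemma submod_image f : is_submod (image_mod f).
Proof.
split=> [|a v w [u Hu] [u' Hu']].
  by exists 0; rewrite mul0r linear0 subr0; exact: sH.1.
exists (a *: u + u'); rewrite mulrDl -scalerAl linearP opprD addrACA -scalerBr.
exact: sH.2.
Qed.

(** By the adjugate matrix, [\det M] sends every generator into the image; and [\det M] is a power
    of [X] times a unit. *)
Lemma coker_exponent : exists e, forall v, image_mod 1 (act (cpsX ^+ e) v).
Proof.
have [M [Mx HM]] := pullback_generators.
have [e [g [dE gU]]] := xonly_unit_factor (xonly_det Mx) (det_neq0 Mx HM).
have gen k : image_mod 1 (act (\det M) (generator k)).
  exists (\sum_a (\adj M) k a * cpsY ^+ a); rewrite mulr1.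
  have := combination_generators (fun a => (\adj M) k a) HM.
  set P := pullback _; set S := (X in P - X) => HS.
  have -> : act (\det M) (generator k) = S.
    rewrite /S (bigD1 k)//= [X in _ + X]big1 ?addr0 => [|l lk].
      have := congr1 (fun A : 'M[cps K]_b => A k k) (mul_adj_mx M).
      by rewrite !mxE eqxx mulr1n => ->.
    have := congr1 (fun A : 'M[cps K]_b => A k l) (mul_adj_mx M).
    by rewrite !mxE eq_sym (negbTE lk) mulr0n => ->; rewrite act0.
  by rewrite -opprB -scaleN1r; apply: submodZ sH _ _ HS.
exists e => v; have [r [_ Hr]] := @generate (act (g^-1) v).
have [u uP] := choice gen.
exists (\sum_k r k * u k); rewrite mulr1.
have -> : act (cpsX ^+ e) v = act (\det M) (act (g^-1) v).
  by rewrite -actA dE mulrK.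
apply: (submodBr sH (v := act (\det M) (\sum_k act (r k) (generator k)) -
   pullback (\sum_k r k * u k))).
  rewrite opprB addrA subrK -linearB; exact: H_act.
rewrite !linear_sum/= -big_split/=; apply: (submod_sum sH) => k _.
rewrite -actA (mulrC (\det M)) actA pullbackM -linearB; apply: H_act.
by have := uP k; rewrite mulr1.
Qed.

(** Since [X^e] kills the cokernel, the latter is a quotient of the product of the rings modulo
    [(h_tau, X^(n e))], each of finite dimension. *)
Lemma coker_finite : exists c, fdim setT (image_mod 1) c.
Proof.
have [e eP] := coker_exponent.
pose Z := [set v : V | forall i, ideal2 (hs i) (cpsX ^+ (n_ i * e)) (v i)].
have sZ : is_submod Z.
  exact: (@submod_prod _ _ _ (fun i => ideal2 (hs i) (cpsX ^+ (n_ i * e)))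
    (fun i => submod_ideal2 _ _)).
have ZI : Z `<=` image_mod 1.
  move=> v Zv; have [q qP] := choice (fun i => (ideal2P _ _ _).1 (Zv i)).
  have [r rP] := choice qP; have [u Hu] := eP r; exists u.
  have {}Hu i := Hu i.
  suff : H (v - act (cpsX ^+ e) r) by move=> H1; have := submodD sH H1 Hu; rewrite addrA subrK.
  move=> i; exists (q i); rewrite -[LHS]/(v i - pi_ i (cpsX ^+ e) * r i) rP.
  by rewrite rmorphXn/= pi_tauX -exprM (mulrC (r i)) addrK.
have [|c Zc] := @edim_fdim R _ _ setT Z (\sum_(i < t) (n_ i * e * ds i)%:R).
  rewrite (@edim_prod _ _ _ _ (fun i => ideal2 (hs i) (cpsX ^+ (n_ i * e)))) => [|i]; last first.
    exact: submod_ideal2.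
  by rewrite -sumEFin; apply: eq_bigr => i _; rewrite (edim_idealX _ (hs_order i)).
exact: fdim_quo (@submodT _ _) (submod_image 1) sZ ZI Zc.
Qed.

(** The remainder of [u] under division by [h] is again sent into [H] and has degree less than [b]
    in [Y], so it vanishes. *)
Lemma in_idealP (u : cps K) : H (pullback u) -> exists q, u = q * h.
Proof.
move=> Hu; have [q [r [uE r0]]] := weierstrass_division u h_order.
exists q; rewrite uE [r]low_degree_inj ?addr0// => i.
have [p pE] := Hu i; exists (p - pi_ i q * cpsX ^+ kh i).
have -> : r = u - q * h by rewrite uE addrAC subrr add0r.
by rewrite rmorphB rmorphM/= hsE -[pi_ i u]/(pullback u i) pE; ring.
Qed.

Context (f : cps K) (fs : 'I_t -> cps K) (kf : 'I_t -> nat).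
Hypothesis fsE : forall i, pi_ i f = cpsX ^+ kf i * fs i.

Let G := [set v : V | forall i, ideal2 (hs i) (cpsX ^+ kf i * fs i) (v i)].

Let sG : is_submod G.
Proof.
exact: (@submod_prod _ _ _ (fun i => ideal2 (hs i) (cpsX ^+ kf i * fs i))
  (fun i => submod_ideal2 _ _)).
Qed.

Lemma H_sub_image g : H `<=` image_mod g.
Proof. by move=> v Hv; exists 0; rewrite mul0r linear0 subr0. Qed.

Lemma image_sub_G : image_mod f `<=` G.
Proof.
move=> v [u Hu] i; have [q qE] := Hu i; apply/ideal2P; exists q, (pi_ i u).
by rewrite -qE -fsE -rmorphM -[RHS]/(v i - pi_ i (u * f) + pi_ i (u * f)) subrK.
Qed.

Lemma image_sub_image1 : image_mod f `<=` image_mod 1.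
Proof. by move=> v [u Hu]; exists (u * f); rewrite mulr1. Qed.

Lemma edim_ideal_image : edim setT (ideal2 f h) = edim (image_mod 1) (image_mod f).
Proof.
apply: (@edim_transport _ _ _ _ pullback).
- exact: submod_image.
- by move=> w _; exists w; rewrite mulr1 subrr; exact: sH.1.
- by move=> w [u Hu]; exists u => //; apply: H_sub_image; move: Hu; rewrite mulr1.
- exact: submodT.
- exact: submod_ideal2.
- exact: submod_image.
move=> u _; split=> [/ideal2P[p [q ->]]|[p Hp]]; last first.
  have /in_idealP[q qE] : H (pullback (u - p * f)) by rewrite linearB.
  by apply/ideal2P; exists p, q; rewrite -qE addrC subrK.
exists p; rewrite -linearB/= addrAC subrr add0r => i; exists (pi_ i q * cpsX ^+ kh i).
by rewrite /pullback rmorphM/= hsE mulrA.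
Qed.

(** Finiteness makes the image of [f] regular modulo each [h_tau], so multiplication by [f]
    identifies the cokernel of the comparison map with [G] modulo [image_mod f]. *)
Lemma edim_coker_mul n : edim setT G = n%:R%:E ->
  edim G (image_mod f) = edim setT (image_mod 1).
Proof.
move=> Gn; have Gi i : exists n, fdim setT (ideal2 (hs i) (cpsX ^+ kf i * fs i)) n.
  have [//|ninf] := pselect (exists n, fdim setT (ideal2 (hs i) (cpsX ^+ kf i * fs i)) n).
  move: Gn; rewrite /G.
  rewrite (@edim_prod _ _ _ _ (fun i => ideal2 (hs i) (cpsX ^+ kf i * fs i))); last first.
    by move=> j; exact: submod_ideal2.
  rewrite (bigD1 i)//= (edim_infty ninf) addye//.
  by rewrite gt_eqF// (lt_le_trans ltNy0)// sume_ge0// => j _; exact: edim_ge0.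
have reg v : H (act f v) -> H v.
  move=> Hv i; have [n' fn] := Gi i; have [q qE] := Hv i.
  by apply: (regular_mod (hs_order i) fn (p := q)); rewrite -fsE.
apply/esym/(@edim_transport _ _ _ _ (act f)).
- exact: submod_image.
- by move=> w _ i; apply/ideal2P; exists 0, (w i); rewrite mul0r add0r -fsE mulrC.
- move=> w Gw; have [p pP] := choice (fun i => (ideal2P _ _ _).1 (Gw i)).
  have [q qP] := choice pP; exists q => //; apply: H_sub_image => i; exists (p i).
  by rewrite -[LHS]/(w i - pi_ i f * q i) qP fsE (mulrC (q i)) addrK.
- exact: submodT.
- exact: submod_image.
- exact: sG.
move=> v _; split=> [[u Hu]|[u Hu]]; exists u.
  rewrite mulrC pullbackM -linearB; apply: H_act.
  by move: Hu; rewrite mulr1.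
by rewrite mulr1; apply: reg; rewrite linearB/= -pullbackM mulrC.
Qed.

Theorem codim_strict_transforms :
  codim (ideal2 f h) =
  (\sum_(i < t) ((kf i * ds i)%:R%:E + codim (ideal2 (fs i) (hs i))) : \bar R)%E.
Proof.
have GE : edim setT G = (\sum_(i < t) ((kf i * ds i)%:R%:E + edim setT (ideal2 (fs i) (hs i))))%E.
  rewrite (@edim_prod _ _ _ _ (fun i => ideal2 (hs i) (cpsX ^+ kf i * fs i))) => [|i]; last first.
    exact: submod_ideal2.
  apply: eq_bigr => i _; rewrite (edim_idealXM _ _ (hs_order i)).
  by rewrite (edim_idealX _ (hs_order i)) ideal2C.
rewrite edim_codim; under eq_bigr do rewrite edim_codim.
rewrite -GE edim_ideal_image.
have [c cE] := coker_finite; have {}cE := edim_fin (R := R) (submod_image 1) cE.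
have E1 := @edim_chain R _ _ setT (image_mod 1) (image_mod f) (@submodT _ _)
  (submod_image 1) (submod_image f) image_sub_image1 (@subsetT _ _).
have E2 := @edim_chain R _ _ setT G (image_mod f) (@submodT _ _)
  sG (submod_image f) image_sub_G (@subsetT _ _).
rewrite E1 cE in E2.
have [[n Gn]|ninf] := pselect (exists n, fdim setT G n).
  have {}Gn := edim_fin (R := R) sG Gn.
  move: E2; rewrite (edim_coker_mul Gn) Gn cE.
  by rewrite addeC => /(congr1 (fun x => x - c%:R%:E)%E); rewrite !addeK.
(* In the infinite case [E2] says that a finite number plus the left side is infinite. *)
move: E2; rewrite (edim_infty ninf) addye; last first.
  by rewrite gt_eqF// (lt_le_trans ltNy0)// edim_ge0.
by case: (edim (image_mod 1) _).
Qed.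

End Core.

(** * Weights, edges and quasi-tangents *)

Section Weights.
Context {R : realType}.
Local Notation C := R[i].
Implicit Types (f h u : cps C) (e w : nat * nat) (L : seq (nat * nat)).

Lemma weight_min_weight n m f k : is_weight n m f k -> min_weight n m (diagram f) k.
Proof.
move=> [[i [j [fij ->]]] kmin]; apply: min_weight_nd => [[a b]|]; first exact: kmin.
by exists (i, j).
Qed.

Definition decomposes f (a0 b0 : nat) L : Prop :=
  diagram f = Defs.msum (newton_diagram [set (a0, b0)]) (edge_sum L).

Lemma weight_decomposition f a0 b0 L n m k : decomposes f a0 b0 L ->
  is_weight n m f k ->
  k = (n * a0 + m * b0 + \sum_(e <- L) minn (n * e.1) (m * e.2))%N.
Proof.
move=> dec /weight_min_weight; rewrite dec => /min_weight_uniq; apply.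
by apply: min_weight_msum; [exact: min_weight_point|exact: min_weight_edge_sum].
Qed.

(* The extreme exponents of the initial form along [(n, m)] are read off the   *)
(* support function at the nearby directions [(N n, N m + 1)] and             *)
(* [(N n, N m - 1)], N large.                                                 *)
Lemma slice_width f a0 b0 L n m k c lo rs : decomposes f a0 b0 L ->
  (0 < n)%N -> (0 < m)%N -> is_weight n m f k ->
  slice_factor n (slice n m f k) c lo rs ->
  (n * size rs = \sum_(e <- L | n * e.1 == m * e.2) e.2)%N.
Proof.
move=> dec n0 m0 fk sf; have [slo shi sbetween] := slice_factor_ends n0 sf.
have [_ kmin] := fk; set hi := (lo + n * size rs)%N in shi sbetween.
(* [N] exceeds [k], [lo] and the height of every edge, so perturbing [N (n, m)] by one in the second
   coordinate only decides ties. *)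
pose N := (k + lo + \sum_(e <- L) e.2).+2.
have on_line i j : f i j != 0 -> (n * i + m * j)%N = k -> (lo <= j <= hi)%N.
  by move=> fij E; apply: sbetween; rewrite -E coef_slice.
have wlo : is_weight (N * n) (N * m + 1) f (N * k + lo).
  split=> [|i j fij].
    have [i kE fi] := coef_slice_neq0 n0 slo; exists i, lo; split=> //; nia.
  have := kmin i j fij; rewrite leq_eqVlt => /orP[/eqP/esym E|lt].
    by have /andP[lj _] := on_line _ _ fij E; nia.
  have NL : (lo <= N)%N by rewrite /N; lia.
  nia.
have whi : is_weight (N * n) (N * m - 1) f (N * k - hi).
  have Nm : (0 < N * m)%N by rewrite muln_gt0.
  split=> [|i j fij].
    have [i kE fi] := coef_slice_neq0 n0 shi; exists i, hi; split=> //.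
    by rewrite mulnBl mul1n kE; nia.
  rewrite mulnBl mul1n.
  have := kmin i j fij; rewrite leq_eqVlt => /orP[/eqP/esym E|lt].
    have /andP[_ jh] := on_line _ _ fij E; nia.
  have NL : (k.+1 <= N)%N by rewrite /N; lia.
  have jm : (j <= m * j)%N by rewrite leq_pmull.
  nia.
have eN e : e \in L -> (e.2 <= N)%N.
  by move=> eL; rewrite /N (big_rem e eL)/=; lia.
have klo := weight_decomposition dec wlo.
have khi := weight_decomposition dec whi.
have kk := weight_decomposition dec fk.
have Slo : (\sum_(e <- L) minn (N * n * e.1) ((N * m + 1) * e.2) =
   N * (\sum_(e <- L) minn (n * e.1) (m * e.2)) +
   \sum_(e <- L | m * e.2 < n * e.1) e.2)%N.
  rewrite (big_mkcond (fun e => (m * e.2 < n * e.1)%N)) big_distrr -big_split/= !big_seq.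
  apply: eq_bigr => e /eN eNN; case: ltnP => H; nia.
have Shi : (\sum_(e <- L) minn (N * n * e.1) ((N * m - 1) * e.2) +
   \sum_(e <- L | m * e.2 <= n * e.1) e.2 =
   N * (\sum_(e <- L) minn (n * e.1) (m * e.2)))%N.
  rewrite (big_mkcond (fun e => (m * e.2 <= n * e.1)%N)) big_distrr -big_split/= !big_seq.
  have Nm : (0 < N * m)%N by rewrite muln_gt0.
  apply: eq_bigr => e /eN eNN; rewrite mulnBl mul1n; case: leqP => H; nia.
have Seq : (\sum_(e <- L | m * e.2 <= n * e.1) e.2 =
   \sum_(e <- L | m * e.2 < n * e.1) e.2 + \sum_(e <- L | n * e.1 == m * e.2) e.2)%N.
  rewrite (big_mkcond (fun e => (m * e.2 <= n * e.1)%N)).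
  rewrite (big_mkcond (fun e => (m * e.2 < n * e.1)%N)).
  rewrite (big_mkcond (fun e => n * e.1 == m * e.2)%N) -big_split.
  by apply: eq_bigr => e _ /=; case: ltngtP; rewrite ?addn0.
have kpos : (hi <= N * k)%N.
  have [i kE _] := coef_slice_neq0 n0 shi.
  apply: leq_trans (leq_pmull _ (_ : 0 < N)%N) => //.
  by rewrite kE; apply: leq_trans (leq_addl _ _); rewrite leq_pmull.
have Nm : (0 < N * m)%N by rewrite muln_gt0.
move: klo khi kk Slo Shi Seq; rewrite /hi.
set S := \sum_(e <- L) minn (n * _) _; set S1 := \sum_(e <- L) minn _ ((_ + 1) * _).
set S2 := \sum_(e <- L) minn _ ((_ - 1) * _).
set A := \sum_(e <- L | (_ < _)%N) _; set B := \sum_(e <- L | (_ <= _)%N) _.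
set D := \sum_(e <- L | _ == _) _ => klo khi kk Slo Shi Seq.
have loE : lo = (b0 + A)%N.
  have : (N * k + lo = N * k + (b0 + A))%N.
    by rewrite klo Slo kk; ring.
  by move/addnI.
have hiE : hi = (b0 + B)%N.
  have : (N * k = hi + (N * n * a0 + (N * m - 1) * b0 + S2))%N by rewrite -khi subnKC.
  rewrite {1}kk mulnBl mul1n => E.
  have : (b0 <= N * m * b0)%N by rewrite leq_pmull.
  nia.
by move: hiE; rewrite /hi loE Seq; lia.
Qed.


End Weights.

(** * Arguments and roots of complex numbers *)

Section RootArg.
Context {R : realType}.
Local Notation C := R[i].
Local Open Scope complex_scope.
Implicit Types (z : C) (x y : R).

Lemma unit_circle_arg x y : x ^+ 2 + y ^+ 2 = 1 ->
  exists t : R, [/\ 0 <= t < 2 * pi, cos t = x & sin t = y].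
Proof.
move=> xy; have x2 : x ^+ 2 <= 1 by rewrite -xy lerDl sqr_ge0.
have x1 : -1 <= x <= 1 by rewrite -ler_norml -(expr_le1 (n := 2))// real_normK ?num_real.
have y2 : 1 - x ^+ 2 = y ^+ 2 by rewrite -xy addrC addKr.
have pi0 := pi_gt0 R; have a0 := acos_ge0 x1; have api := acos_lepi x1.
have ca : cos (acos x) = x by rewrite acosK// in_itv/=.
have sa : sin (acos x) = `|y| by rewrite sin_acos// y2 sqrtr_sqr.
have [y0|y0] := leP 0 y.
  by exists (acos x); split=> //; [lra|rewrite sa ger0_norm].
have ap : 0 < acos x.
  apply: acos_gt0; case/andP: x1 => -> x1 /=; rewrite lt_neqAle x1 andbT.
  by apply: contraTneq y0 => x1'; move: y2; rewrite x1' expr1n subrr => /esym/eqP;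
     rewrite sqrf_eq0 => /eqP ->; rewrite ltxx.
(* In the lower half plane the angle is reflected; [0 < acos x] keeps it below [2 * pi]. *)
exists (2 * pi - acos x); split; first by apply/andP; split; lra.
  by rewrite cosB mulr_natl cos2pi sin2pi mul1r mul0r addr0.
rewrite sinB mulr_natl cos2pi sin2pi mul1r mul0r add0r sa ltr0_norm//.
by rewrite opprK.
Qed.

Lemma argCP z : z != 0 -> z = `|z| * (cos (argC z) +i* sin (argC z)).
Proof.
case: z => x y z0; set z := x +i* y in z0 *.
suff : exists t : R, 0 <= t < 2 * pi /\ z = `|z| * (cos t +i* sin t).
  by move/(@xgetPex _ 0) => -[].
pose r := Num.sqrt (x ^+ 2 + y ^+ 2).
have zr : `|z| = r%:C by rewrite normc_def.
have r0 : r != 0.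
  by apply: contraNneq z0 => r0; rewrite -normr_eq0 zr r0.
have r2 : r ^+ 2 = x ^+ 2 + y ^+ 2 by rewrite sqr_sqrtr// addr_ge0// sqr_ge0.
have [|t [tI ct st]] := @unit_circle_arg (x / r) (y / r).
  by rewrite !expr_div_n -mulrDl -r2 divff// sqrf_eq0.
exists t; split=> //; rewrite zr ct st /z; apply/eqP; rewrite eq_complex /=.
by rewrite !mul0r subr0 addr0 !(mulrC r) !divfK// !eqxx.
Qed.

Lemma de_moivre x n : (cos x +i* sin x) ^+ n = cos (n%:R * x) +i* sin (n%:R * x) :> C.
Proof.
elim: n => [|n IHn]; first by rewrite expr0 mul0r cos0 sin0.
rewrite exprSr IHn -natr1 mulrDl mul1r cosD sinD; apply/eqP.
by rewrite eq_complex /= eqxx /= addrC mulrC eqxx.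
Qed.

Lemma root_argX n (a : C) : (0 < n)%N -> a != 0 -> root_arg n a ^+ n = a.
Proof.
move=> n0 a0; rewrite [RHS]argCP// /root_arg exprMn de_moivre; congr (_ * _).
  have a_real : `|a| \is Num.real by exact: normr_real.
  rewrite -[RHS](RRe_real a_real) -rmorphXn/= -powR_mulrn ?powR_ge0// -powRrM.
  rewrite mulVf ?pnatr_eq0 -?lt0n// powRr1// -lecR.
  by rewrite (RRe_real a_real) normr_ge0.
by rewrite mulrC divfK// pnatr_eq0 -lt0n.
Qed.

Lemma root_arg_neq0 n (a : C) : (0 < n)%N -> a != 0 -> root_arg n a != 0.
Proof.
move=> n0 a0; apply/eqP => r0; move/eqP: (a0); apply.
by rewrite -(root_argX n0 a0) r0 expr0n -[n == 0%N]negbK -lt0n n0.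
Qed.

End RootArg.

(** * Faces of the diagram and factors of initial forms *)

Section Faces.
Context {R : realType}.
Local Notation C := R[i].
Local Notation plane := (R^o * R^o)%type.

Lemma segmentP (n m k : nat) (p q : nat * nat) (x : plane) : (0 < n)%N -> (q.2 < p.2)%N ->
  (n * p.1 + m * p.2)%N = k -> (n * q.1 + m * q.2)%N = k ->
  @segment R (lattice p) (lattice q) x <->
  n%:R * x.1 + m%:R * x.2 = k%:R /\ q.2%:R <= x.2 <= p.2%:R.
Proof.
move=> n0 qp pk qk; have n0' : 0 < n%:R :> R by rewrite ltr0n.
have qpR : 0 < p.2%:R - q.2%:R :> R by rewrite subr_gt0 ltr_nat.
have pkR : n%:R * p.1%:R + m%:R * p.2%:R = k%:R :> R by rewrite -pk natrD !natrM.
have qkR : n%:R * q.1%:R + m%:R * q.2%:R = k%:R :> R by rewrite -qk natrD !natrM.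
split=> [[t /andP[t0 t1] <-] | [xk /andP[qx xp]]].
  have E1 : (t *: lattice p + (1 - t) *: lattice q : plane).1 =
    t * p.1%:R + (1 - t) * q.1%:R by [].
  have E2 : (t *: lattice p + (1 - t) *: lattice q : plane).2 =
    t * p.2%:R + (1 - t) * q.2%:R by [].
  rewrite E1 E2; split; last by apply/andP; split; nra.
  transitivity (t * (n%:R * p.1%:R + m%:R * p.2%:R) +
    (1 - t) * (n%:R * q.1%:R + m%:R * q.2%:R) : R); first by ring.
  by rewrite pkR qkR; ring.
pose t : R := (x.2 - q.2%:R) / (p.2%:R - q.2%:R).
have tE : t * (p.2%:R - q.2%:R) = x.2 - q.2%:R by rewrite mulfVK// gt_eqF.
have x2 : t * p.2%:R + (1 - t) * q.2%:R = x.2.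
  transitivity (t * (p.2%:R - q.2%:R) + q.2%:R : R); first by ring.
  by rewrite tE subrK.
exists t.
  apply/andP; split.
    by apply: divr_ge0; [rewrite subr_ge0|exact: ltW].
  by rewrite /t ler_pdivrMr// mul1r lerD2r.
have x1 : t * p.1%:R + (1 - t) * q.1%:R = x.1.
  have n00 : n%:R != 0 :> R by rewrite gt_eqF.
  apply: (mulfI n00).
  apply: (addIr (m%:R * x.2)); rewrite xk -x2.
  transitivity (t * (n%:R * p.1%:R + m%:R * p.2%:R) +
    (1 - t) * (n%:R * q.1%:R + m%:R * q.2%:R) : R); first by ring.
  by rewrite pkR qkR; ring.
by rewrite [x]surjective_pairing -x1 -x2.
Qed.

(** The segment is the locus where the weight [W] attains its minimum [k] on the diagram, and a
    proper convex combination reaches the minimum only if both points do. *)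
Lemma face_of_weight (h : cps C) n m k (p q : nat * nat) : (0 < n)%N -> (0 < m)%N ->
  (q.2 < p.2)%N -> (n * p.1 + m * p.2)%N = k -> (n * q.1 + m * q.2)%N = k ->
  h p.1 p.2 != 0 -> h q.1 q.2 != 0 ->
  (forall i j, h i j != 0 -> (k <= n * i + m * j)%N) ->
  (forall i j, h i j != 0 -> (n * i + m * j)%N = k -> (q.2 <= j <= p.2)%N) ->
  is_face (diagram h) (@segment R (lattice p) (lattice q)).
Proof.
move=> n0 m0 qp pk qk hp hq kmin kbetween.
have n0' : 0 < n%:R :> R by rewrite ltr0n.
have m0' : 0 < m%:R :> R by rewrite ltr0n.
have segP x := segmentP x n0 qp pk qk.
pose W (x : plane) : R := n%:R * x.1 + m%:R * x.2.
have Wcomb (x y : plane) (t : R) :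
    W (t * x.1 + (1 - t) * y.1, t * x.2 + (1 - t) * y.2) = t * W x + (1 - t) * W y.
  by rewrite /W /=; ring.
have comb (x y : plane) (t : R) : 0 < t -> t < 1 -> k%:R <= W x -> k%:R <= W y ->
    t * W x + (1 - t) * W y = k%:R -> W x = k%:R /\ W y = k%:R.
  move=> t0 t1 kx ky E.
  have xy : t * (W x - k%:R) + (1 - t) * (W y - k%:R) = 0.
    transitivity (t * W x + (1 - t) * W y - k%:R); first by ring.
    by rewrite E subrr.
  have A1 : 0 <= t * (W x - k%:R) by rewrite mulr_ge0 ?subr_ge0// ltW.
  have A2 : 0 <= (1 - t) * (W y - k%:R) by rewrite mulr_ge0 ?subr_ge0// ltW.
  have /eqP B1 : t * (W x - k%:R) = 0 by lra.
  have /eqP B2 : (1 - t) * (W y - k%:R) = 0 by lra.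
  have u0 : (1 - t == 0) = false by apply: gt_eqF; rewrite subr_gt0.
  move: B1 B2; rewrite !mulf_eq0 (gt_eqF t0) u0 /=.
  by rewrite !subr_eq0 => /eqP -> /eqP ->.
(* The bound on heights along the line is carried through [nd_ind] together with the bound on the
   weight. *)
have DW : diagram h `<=`
    [set x | k%:R <= W x /\ (W x = k%:R -> q.2%:R <= x.2 <= p.2%:R)].
  apply: nd_ind => [x y t t0 t1 [kx xk] [ky yk]|x a b [kx xk] xa xb|a b hab /=].
  - move: t0 t1; rewrite le_eqVlt => /orP[/eqP <-|t0].
      by rewrite /= !mul0r !add0r subr0 !mul1r -surjective_pairing.
    rewrite le_eqVlt => /orP[/eqP ->|t1].
      by rewrite /= subrr !mul0r !addr0 !mul1r -surjective_pairing.
    have t1' : 0 < 1 - t by rewrite subr_gt0.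
    split; rewrite Wcomb.
      have A1 : 0 <= t * (W x - k%:R) by rewrite mulr_ge0 ?subr_ge0// ltW.
      have A2 : 0 <= (1 - t) * (W y - k%:R) by rewrite mulr_ge0 ?subr_ge0// ltW.
      lra.
    move=> /(comb _ _ _ t0 t1 kx ky)[/xk /andP[H1 H2] /yk /andP[H3 H4]] /=.
    by apply/andP; split; nra.
  - have WW : W x <= W (a, b) by apply: lerD; apply: ler_wpM2l => //; exact: ltW.
    split=> [|E]; first exact: le_trans WW.
    have Wx : W x = k%:R by apply/eqP; rewrite eq_le kx -E WW.
    have b2 : b = x.2.
      apply/eqP; rewrite eq_le xb andbT -(ler_pM2l m0') -(lerD2l (n%:R * x.1)).
      rewrite [leRHS]Wx -E /W /= lerD2r ler_pM2l//.
    by rewrite /= b2; exact: xk.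
  - split; first by rewrite /W /= -!natrM -natrD ler_nat; exact: kmin.
    rewrite /W /= -!natrM -natrD => /eqP; rewrite eqr_nat => /eqP E.
    by have := kbetween _ _ hab E; rewrite !ler_nat.
have segD : @segment R (lattice p) (lattice q) `<=` diagram h.
  move=> _ [t /andP[t0 t1] <-].
  by apply: (cvx_nd t0 t1 (nd_mem (a := p.1) (b := p.2) _) (nd_mem (a := q.1) (b := q.2) _)).
split=> //.
- exists (lattice p); exists 1; first by rewrite /= ler01 lexx.
  by rewrite scale1r subrr scale0r addr0.
- apply/convex_setE => x y t t0 t1 /segP[xk /andP[x1 x2]] /segP[yk /andP[y1 y2]].
  apply/segP; split; first by rewrite -[LHS]/(W _) Wcomb /W xk yk; ring.
  by apply/andP; split => /=; nra.
move=> x y t Dx Dy /andP[t0 t1] /segP[E _].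
have [kx xk] := DW x Dx; have [ky yk] := DW y Dy.
have [] := comb x y t t0 t1 kx ky.
  by rewrite -Wcomb; exact: E.
by move=> Ex Ey; split; apply/segP; split=> //; [exact: xk|exact: yk].
Qed.

Definition monomial2 (i j : nat) : {poly {poly C}} := 'X^i * ('X^j)%:P.

Lemma coef_monomial2 (c : C) i j x y :
  (c%:P%:P * monomial2 i j)`_x`_y = if (x == i) && (y == j) then c else 0.
Proof.
rewrite /monomial2 (mulrC 'X^i) mulrA -polyCM coefMXn.
case: ltnP => [xi|ix]; first by rewrite coef0 ltn_eqF.
rewrite coefC subn_eq0.
have -> : (x <= i)%N = (x == i) by rewrite eqn_leq ix andbT.
by case: eqP => _ /=; rewrite ?coef0// coefCM coefXn; case: eqP; rewrite ?mulr1 ?mulr0.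
Qed.

(** With [A = Y^n] and [B = X^m], each [A^l - (a B)^l] is divisible by [A - a B]; the terms left
    over add up to [G(a) B^r = 0]. *)
Lemma binomial_dvd_homogeneous (G : {poly C}) (a : C) (r n m : nat) : (size G <= r.+1)%N ->
  root G a -> exists q : {poly {poly C}},
  \sum_(l < r.+1) (G`_l)%:P%:P * monomial2 (m * (r - l)) (n * l) =
  binomial_poly (n, m, a) * q.
Proof.
move=> sG Ga; pose A : {poly {poly C}} := 'Y ^+ n; pose B : {poly {poly C}} := 'X ^+ m.
pose q l := \sum_(i < l) A ^+ (l.-1 - i) * (a%:P%:P * B) ^+ i.
exists (\sum_(l < r.+1) (G`_l)%:P%:P * B ^+ (r - l) * q l).
have AB l : A ^+ l - (a%:P%:P * B) ^+ l = (A - a%:P%:P * B) * q l by exact: subrXX.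
have G0 : \sum_(l < r.+1) G`_l * a ^+ l = 0.
  by rewrite -(horner_coef_wide _ sG); apply/eqP.
rewrite mulr_sumr [binomial_poly _]/(A - a%:P%:P * B).
have -> : \sum_(l < r.+1) (A - a%:P%:P * B) * ((G`_l)%:P%:P * B ^+ (r - l) * q l) =
    \sum_(l < r.+1) (G`_l)%:P%:P * B ^+ (r - l) * A ^+ l -
    \sum_(l < r.+1) (G`_l * a ^+ l)%:P%:P * B ^+ r.
  rewrite -sumrB; apply: eq_bigr => l _; rewrite mulrCA -AB mulrBr; congr (_ - _).
  rewrite exprMn -!rmorphXn/= mulrACA -exprD subnK ?(leq_ord l)//.
  by rewrite -!polyCM.
rewrite -mulr_suml -!rmorph_sum/= G0 !polyC0 mul0r subr0.
apply: eq_bigr => l _; rewrite /monomial2 -mulrA /A /B; congr (_ * (_ * _)).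
  by rewrite exprM.
by rewrite -exprM rmorphXn.
Qed.

Lemma weight_shift n m i j l r : (l <= r)%N ->
  (n * (i + m * (r - l)) + m * (j + n * l) = n * i + m * (j + n * r))%N.
Proof. by move=> lr; rewrite -{2}(subnKC lr); move: (r - l)%N => d; ring. Qed.

(** The extreme exponents of the slice are the ends of an edge, and homogenising the factorisation
    of the slice exhibits the binomial as a factor of the initial form. *)
Lemma quasi_tangent_of_root (h : cps C) n m a k c lo rs : (0 < n)%N -> (0 < m)%N ->
  coprime n m -> a != 0 -> is_weight n m h k ->
  slice_factor n (slice n m h k) c lo rs -> a \in rs ->
  quasi_tangents h (n, m, a).
Proof.
move=> n0 m0 nm a0 [_ kmin] sf ars; have [slo shi sbetween] := slice_factor_ends n0 sf.
set r := size rs in shi sbetween *.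
have r0 : (0 < r)%N by rewrite /r; case: (rs) ars.
have [ilo kEl hlo] := coef_slice_neq0 n0 slo.
have [ihi kEh hhi] := coef_slice_neq0 n0 shi.
have iE : ilo = (ihi + m * r)%N.
  apply/eqP; rewrite -(eqn_pmul2l n0); apply/eqP; move: kEl; rewrite kEh; lia.
have lohi : (lo < lo + n * r)%N by rewrite -{1}[lo]addn0 ltn_add2l muln_gt0 n0.
have mr0 : (0 < m * r)%N by rewrite muln_gt0 m0.
have on_line i j : h i j != 0 -> (n * i + m * j)%N = k -> (lo <= j <= lo + n * r)%N.
  by move=> hij E; apply: sbetween; rewrite -E coef_slice.
pose S := ((ihi, lo + n * r), (ilo, lo))%N.
split; first by split.
exists S.
  split => /=; [lia|by []|].
  exact: (@face_of_weight h n m k (ihi, lo + n * r)%N (ilo, lo)).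
case: sf => c0 rs0 sE.
pose G : {poly C} := c *: \prod_(b <- rs) ('X - b%:P).
have sG : (size G <= r.+1)%N.
  by apply: leq_trans (size_scale_leq _ _) _; rewrite size_prod_XsubC.
have Ga : root G a by rewrite rootZ// root_prod_XsubC.
have sGE : slice n m h k = 'X^lo * (G \Po 'X^n).
  rewrite sE comp_polyZ -scalerAr; congr (_ *: (_ * _)).
  rewrite /binomials rmorph_prod/=; apply: eq_bigr => b _.
  by rewrite comp_polyB comp_polyX comp_polyC.
have [q qE] := @binomial_dvd_homogeneous G a r n m sG Ga.
exists (monomial2 ihi lo * q); rewrite mulrCA -qE mulr_sumr.
apply/polyP => x; apply/polyP => y; rewrite !coef_sum.
have E (l : 'I_r.+1) : (monomial2 ihi lo *
    ((G`_l)%:P%:P * monomial2 (m * (r - l)) (n * l)))`_x`_y =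
    if (x == ihi + m * (r - l))%N && (y == lo + n * l)%N then G`_l else 0.
  rewrite mulrCA (_ : monomial2 ihi lo * _ = monomial2 (ihi + m * (r - l)) (lo + n * l)).
    exact: coef_monomial2.
  by rewrite /monomial2 mulrACA -exprD -polyCM -exprD.
transitivity (\sum_(l < r.+1)
    if (x == ihi + m * (r - l))%N && (y == lo + n * l)%N then G`_l else 0); last first.
  by apply: eq_bigr => l _; rewrite E.
have segE : `[< @segment R (lattice S.1) (lattice S.2) (lattice (x, y)) >] =
    ((n * x + m * y == k) && (lo <= y <= lo + n * r))%N.
  have P := @segmentP n m k S.1 S.2 (lattice (x, y)) n0 lohi (esym kEh) (esym kEl).
  apply/asboolP/andP => [/P|[/eqP xk xy]].
    rewrite /= -!natrM -natrD !ler_nat => -[/eqP + ->].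
    by rewrite eqr_nat => ->.
  by apply/P; rewrite /= -!natrM -natrD xk !ler_nat.
rewrite coef_poly -[LHS]/((if (x < ilo.+1)%N then \poly_(j < (lo + n * r).+1)
  (if `[< @segment R (lattice S.1) (lattice S.2) (lattice (x, j)) >] then h x j else 0)
  else 0)`_y).
have -> : (if (x < ilo.+1)%N then \poly_(j < (lo + n * r).+1)
    (if `[< @segment R (lattice S.1) (lattice S.2) (lattice (x, j)) >] then h x j else 0)
    else 0)`_y = if ((n * x + m * y == k) && (lo <= y <= lo + n * r))%N then h x y else 0.
  case: ltnP => xl; rewrite ?coef_poly ?coef0 ?segE.
    case: ltnP => yl //; rewrite ifN// !negb_and; apply/orP; right.
    by apply/orP; right; rewrite -ltnNge.
  rewrite ifN//; apply/negP => /andP[/eqP xk /andP[loy _]].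
  have H1 : (n * ilo < n * x)%N by rewrite ltn_pmul2l.
  have H2 : (m * lo <= m * y)%N by rewrite leq_mul2l loy orbT.
  by move: xk; rewrite kEl; clear -H1 H2; lia.
case: ifP => [/andP[/eqP xk /andP[loy yhi]]|off]; last first.
  rewrite big1// => l _; case: ifP => // /andP[/eqP xE /eqP yE].
  move: off; rewrite xE yE => /negP[]; have lr := leq_ord l.
  have nl : (n * l <= n * r)%N by rewrite leq_mul2l lr orbT.
  rewrite leq_addr leq_add2l nl !andbT kEh; apply/eqP.
  exact: weight_shift.
have -> : h x y = (slice n m h k)`_y by rewrite -xk coef_slice.
rewrite sGE coefXnM ltnNge loy/= coef_comp_poly_Xn//; case: ifP => [/dvdnP[l lE]|nd].
  have yE : y = (lo + n * l)%N by rewrite mulnC -lE subnKC.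
  have lr : (l < r.+1)%N by move: yhi; rewrite yE leq_add2l leq_pmul2l.
  rewrite lE mulnK// (bigD1 (Ordinal lr))//= big1 ?addr0 => [|l' ll'].
    rewrite yE eqxx andbT; case: eqP => // -[]; apply/eqP.
    rewrite -(eqn_pmul2l n0) -(eqn_add2r (m * y)) xk kEh yE eq_sym.
    by apply/eqP/weight_shift; rewrite -ltnS.
  case: ifP => // /andP[_]; rewrite yE eqn_add2l eqn_pmul2l// => /eqP l'E.
  by case/eqP: ll'; apply: val_inj.
rewrite big1// => l _; case: ifP => // /andP[_ /eqP yE].
by move: nd; rewrite yE addKn dvdn_mulr.
Qed.


End Faces.

(** * The intersection formula *)

Section EdgeClasses.
Implicit Types (e w : nat * nat) (L : seq (nat * nat)) (F : nat * nat -> nat).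

Definition edge_positive L := all (fun e => (0 < e.1) && (0 < e.2))%N L.

(** The pair [(n_S, m_S)], a primitive normal of the edge with legs [e]. *)
Definition edge_class e : nat * nat :=
  (e.2 %/ gcdn e.1 e.2, e.1 %/ gcdn e.1 e.2)%N.

Lemma edge_classP e : (0 < e.1)%N -> (0 < e.2)%N ->
  [/\ (0 < (edge_class e).1)%N, (0 < (edge_class e).2)%N,
      coprime (edge_class e).1 (edge_class e).2,
      e.1 = (gcdn e.1 e.2 * (edge_class e).2)%N &
      e.2 = (gcdn e.1 e.2 * (edge_class e).1)%N].
Proof.
move=> e1 e2; have g0 : (0 < gcdn e.1 e.2)%N by rewrite gcdn_gt0 e1.
have E1 : e.1 = (gcdn e.1 e.2 * (edge_class e).2)%N.
  by rewrite /= mulnC divnK// dvdn_gcdl.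
have E2 : e.2 = (gcdn e.1 e.2 * (edge_class e).1)%N.
  by rewrite /= mulnC divnK// dvdn_gcdr.
split=> //.
- by rewrite divn_gt0// dvdn_leq// dvdn_gcdr.
- by rewrite divn_gt0// dvdn_leq// dvdn_gcdl.
rewrite /coprime -(eqn_pmul2l g0) muln1 muln_gcdr -E1 -E2.
by rewrite gcdnC.
Qed.

Lemma edge_class_eq e n m : (0 < e.1)%N -> (0 < e.2)%N -> (0 < n)%N -> (0 < m)%N ->
  coprime n m -> (n * e.1 == m * e.2)%N = (edge_class e == (n, m)).
Proof.
move=> e1 e2 n0 m0 nm; have [c1 c2 cop E1 E2] := edge_classP e1 e2.
have g0 : (0 < gcdn e.1 e.2)%N by rewrite gcdn_gt0 e1.
move: (gcdn e.1 e.2) g0 E1 E2 => g g0 -> ->; rewrite mulnCA (mulnCA m) eqn_pmul2l//.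
move: c1 c2 cop; case: (edge_class e) => a b /= a0 b0 ab.
apply/eqP/eqP => [E|[-> ->]]; last by rewrite mulnC.
have na : (n %| a)%N by rewrite -(Gauss_dvdr _ nm) -E dvdn_mulr.
have an : (a %| n)%N by rewrite -(Gauss_dvdl _ ab) E dvdn_mull.
have an' : a = n by apply/eqP; rewrite eqn_dvd an.
by congr (_, _) => //; apply/eqP; rewrite -(eqn_pmul2l n0) E an' mulnC.
Qed.

Lemma sum_uniq_eq W w c : uniq W -> (\sum_(w' <- W | w == w') c = (w \in W) * c)%N.
Proof.
move=> uW; rewrite big_const_seq iter_addn_0 mulnC -(count_uniq_mem w uW).
by congr (_ * _)%N; apply: eq_count => w'; rewrite /= eq_sym.
Qed.

Lemma sum_edge_class_le W L F : uniq W ->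
  (\sum_(w <- W) \sum_(e <- L | edge_class e == w) F e <= \sum_(e <- L) F e)%N.
Proof.
move=> uW; rewrite (exchange_big_dep xpredT)//=; apply: leq_sum => e _.
by rewrite sum_uniq_eq//; case: (_ \in _); rewrite ?mul1n.
Qed.

Lemma sum_edge_class W L F : uniq W -> {in L, forall e, edge_class e \in W} ->
  (\sum_(w <- W) \sum_(e <- L | edge_class e == w) F e = \sum_(e <- L) F e)%N.
Proof.
move=> uW LW; rewrite (exchange_big_dep xpredT)//= !big_seq.
by apply: eq_bigr => e /LW eW; rewrite sum_uniq_eq// eW mul1n.
Qed.

Lemma sum_count_undup (T : eqType) (s : seq T) :
  (\sum_(a <- undup s) count_mem a s = size s)%N.
Proof.
rewrite -[RHS](perm_size (perm_count_undup s)) size_flatten sumnE /shape.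
by rewrite !big_map; apply: eq_bigr => a _; rewrite size_nseq.
Qed.

End EdgeClasses.

(** * Chosen strict transforms, convenient series and injectivity *)

Section Final.
Context {R : realType}.
Local Notation C := R[i].
Implicit Types (f g h u : cps C) (w : nat * nat).

(** Shows that the [xget] in [strict_transform] has a witness; the exponent of [X] is positive
    because [f] has no constant term. *)
Lemma strict_transformP f n m (a : C) (n0 : (0 < n)%N) (m0 : (0 < m)%N) :
  f != 0 -> f 0%N 0%N = 0 -> exists2 k,
    pi_tau n0 m0 (root_arg n a) f = cpsX ^+ k * strict_transform (n, m, a) f &
    exists j, strict_transform (n, m, a) f 0%N j != 0.
Proof.
move=> f0 f00; have [k fk] := weight_exists n m f0.
have [g gE gj] := pi_tau_strict n0 m0 (root_arg n a) fk.
have ex : exists g, is_strict_transform (n, m, a) f g.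
  exists g, k; last by split=> //; exact: (congr1 (@coefs _) gE).
  have [[i [j [fij ->]]] _] := fk.
  case: i fij => [|i] fij; last by nia.
  by case: j fij => [|j]; [rewrite f00 eqxx|nia].
have [k' _ [gE' gj']] := xgetPex 0 ex.
by exists k' => //; apply: val_inj.
Qed.

Lemma weight_factor_exists h n m : h != 0 -> (0 < n)%N -> (0 < m)%N -> coprime n m ->
  exists k c lo rs, is_weight n m h k /\ slice_factor n (slice n m h k) c lo rs.
Proof.
move=> h0 n0 m0 nm; have [k hk] := weight_exists n m h0.
have [c [lo [rs sf]]] := slice_factor_exists n0 (slice_weight n0 m0 hk).1
  (fun b b' => @slice_mod _ n m h k b b' n0 nm).
by exists k, c, lo, rs.
Qed.

(** The weights [(1, 0)] and [(0, 1)] measure the distances to the axes. Both vanish, so only edges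
    remain, and the leftmost vertex [(0, b)] gives the order of [h(0, Y)]. *)
Lemma convenient_decomposition h : convenient h -> exists b L,
  [/\ yorder (h 0%N) b, edge_positive L, b = (\sum_(e <- L) e.2)%N,
      decomposes h 0 0 L & diagram h = edge_sum L].
Proof.
move=> [h0 ah bh].
have supp0 : [set P : nat * nat | h P.1 P.2 != 0] !=set0.
  by have [i [[j hij] _]] := low_row h0; exists (i, j).
have [[a b] [b0 [L [/= hab lexmin [e he eb0] Lpos [bE dE]]]]] := @nd_decomposition R _ supp0.
have ma : min_weight 1 0 (diagram h) a.
  apply: min_weight_nd => [[a' b'] /lexmin /=|]; first by rewrite mul1n mul0n; lia.
  by exists (a, b); rewrite // mul1n mul0n addn0.
have mb : min_weight 0 1 (diagram h) b0.
  rewrite /diagram dE.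
  have := min_weight_msum (@min_weight_point R 0 1 a b0) (@min_weight_edge_sum R 0 1 L).
  by rewrite mul0n mul1n add0n big1 ?addn0// => x _; rewrite mul0n min0n.
have D0 : diagram h !=set0 by exists (lattice (a, b)); exact: nd_mem.
have a0 : a = 0%N.
  apply/eqP; rewrite -leqn0 -(ler_nat R) -[leRHS]ah.
  apply: lb_le_inf; first by case: D0 => p Dp; exists p.1; exists p.
  by move=> _ [p Dp <-]; have := ma.1 p Dp; rewrite mulr1n mulr0n mul1r mul0r addr0.
have b00 : b0 = 0%N.
  apply/eqP; rewrite -leqn0 -(ler_nat R) -[leRHS]bh.
  apply: lb_le_inf; first by case: D0 => p Dp; exists p.2; exists p.
  by move=> _ [p Dp <-]; have := mb.1 p Dp; rewrite mulr1n mulr0n mul1r mul0r add0r.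
move: hab lexmin dE bE; rewrite {}a0 {}b00 /= add0n => hab lexmin dE bE.
exists b, L; split=> //.
  split=> // j jb; apply/eqP/negPn/negP => hj.
  by have := lexmin (0%N, j) hj => /=; lia.
by rewrite /diagram dE -quadrantE msum_quadrant//; elim: (L) => [|x L' IH];
  [exact: upward_quadrant|exact: upward_msum].
Qed.

Lemma slice_width_class h a0 b0 L n m k c lo rs : decomposes h a0 b0 L ->
  edge_positive L -> (0 < n)%N -> (0 < m)%N -> coprime n m -> is_weight n m h k ->
  slice_factor n (slice n m h k) c lo rs ->
  (n * size rs = \sum_(e <- L | edge_class e == (n, m)) e.2)%N.
Proof.
move=> dec Lpos n0 m0 nm hk sf; rewrite (slice_width dec n0 m0 hk sf).
rewrite big_seq_cond [RHS]big_seq_cond; apply: eq_bigl => e.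
case eL: (e \in L) => //=; have /andP[e1 e2] := allP Lpos e eL.
exact: edge_class_eq.
Qed.

Lemma i0_unit f g : g 0%N 0%N != 0 -> i0 f g = 0%E.
Proof.
move=> g0; rewrite /i0 edim_codim (@edim_fin _ _ _ _ _ 0)//.
  exact: submod_ideal2.
exists (fun=> 0); split=> // [c _ []//|v _]; exists (fun=> 0); rewrite big_ord0 subr0.
by apply/ideal2P; exists 0, (v * g^-1); rewrite mul0r add0r mulrVK.
Qed.

Lemma card_pairs t (n_ d_ : 'I_t -> nat) :
  #|{: {i : 'I_t & ('I_(n_ i) * 'I_(d_ i))%type}}| = (\sum_(i < t) n_ i * d_ i)%N.
Proof.
rewrite card_tagged sumnE big_map big_enum; apply: eq_bigr => i _.
by rewrite card_prod !card_ord.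
Qed.

Lemma is_weight_scale f n m d k : is_weight n m f k ->
  is_weight (d * n) (d * m) f (d * k).
Proof.
move=> [[i [j [fij ->]]] kmin]; split=> [|i' j' /kmin kij].
  by exists i, j; split=> //; ring.
by rewrite -!mulnA -mulnDr leq_mul2l kij orbT.
Qed.

(* A series that vanishes modulo all strict transforms of [h] has, along each  *)
(* edge of [h], an initial form at least as wide as that of [h]; so its Newton *)
(* diagram is too high for a polynomial of degree less than [b] in [Y].       *)
Lemma low_degree_zero b (W : seq (nat * nat)) (rs : nat * nat -> seq C)
    u :
  b = (\sum_(w <- W) w.1 * size (rs w))%N -> uniq W ->
  {in W, forall w, [/\ (0 < w.1)%N, (0 < w.2)%N & coprime w.1 w.2]} ->
  {in W, forall w k, is_weight w.1 w.2 u k -> forall a, a \in rs w ->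
    (count_mem a (rs w) <= mup (root_arg w.1 a) (slice w.1 w.2 u k))%N} ->
  {in W, forall w, all (predC1 0) (rs w)} ->
  (forall i j, (b <= j)%N -> u i j = 0) -> u = 0.
Proof.
move=> bE uW Wpos mult rs0 ub; apply/eqP/negPn/negP => u0.
have supp0 : [set P : nat * nat | u P.1 P.2 != 0] !=set0.
  by have [i [[j uij] _]] := low_row u0; exists (i, j).
have [P [b0 [Lu [uP _ _ Lupos [PE dec]]]]] := @nd_decomposition R _ supp0.
have Pb : (P.2 < b)%N by rewrite ltnNge; apply: contra uP => /ub ->; rewrite eqxx.
move: Pb; rewrite ltnNge => /negP; apply.
rewrite PE; apply: leq_trans (leq_addl _ _).
rewrite bE; apply: leq_trans (sum_edge_class_le Lu (fun e => e.2) uW).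
rewrite !big_seq; apply: leq_sum => -[n m] wW.
have [/= n0 m0 nm] := Wpos _ wW.
have [k [c [lo [rsu [uk sf]]]]] := weight_factor_exists u0 n0 m0 nm.
rewrite -(slice_width_class dec Lupos n0 m0 nm uk sf) leq_mul2l.
apply/orP; right; have /count_subseqP[s sub /perm_size ->] : forall a,
    (count_mem a (rs (n, m)) <= count_mem a rsu)%N.
  move=> a; have [ars|/count_memPn -> //] := boolP (a \in rs (n, m)).
  have a0 : a != 0 by have /allP/(_ _ ars) := rs0 _ wW.
  apply: leq_trans (mult _ wW _ uk _ ars) _ => /=.
  by rewrite (mup_slice_factor n0 (root_arg_neq0 n0 a0) sf) root_argX.
exact: size_subseq.
Qed.

End Final.

Theorem theorem5p3 (R : realType) (f : cps R[i]) (f_neq0 : f != 0)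
    (f_const : f 0%N 0%N = 0) (h : cps R[i]) (h_conv : convenient h)
    (h_const : h 0%N 0%N = 0) :
  i0 f h = (double_area (diagram f) (diagram h) +
            \sum_(tau \in quasi_tangents h)
              i0 (strict_transform tau f) (strict_transform tau h))%E.
Proof.
have h_neq0 : h != 0 by case: h_conv.
have [b [L [hb Lpos bE dec DE]]] := convenient_decomposition h_conv.
(* For every primitive direction: the weight of [h] and the roots of its slice. Elsewhere the values
   are dummies. *)
have dat_ex (w : nat * nat) : exists p : nat * seq R[i],
    [&& 0 < w.1, 0 < w.2 & coprime w.1 w.2]%N -> is_weight w.1 w.2 h p.1 /\
      exists c lo, slice_factor w.1 (slice w.1 w.2 h p.1) c lo p.2.
  have [/and3P[n0 m0 nm]|nw] := boolP [&& 0 < w.1, 0 < w.2 & coprime w.1 w.2]%N; last first.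
    by exists (0%N, [::]).
  have [k [c [lo [rs [hk sf]]]]] := weight_factor_exists h_neq0 n0 m0 nm.
  by exists (k, rs) => _; split=> //; exists c, lo.
have [dat datP] := choice dat_ex.
have [kf kfP] := choice (fun w : nat * nat => weight_exists w.1 w.2 f_neq0).
pose rs w := (dat w).2; pose W := undup (map edge_class L).
have uW : uniq W by exact: undup_uniq.
have LW : {in L, forall e, edge_class e \in W}.
  by move=> e eL; rewrite mem_undup map_f.
have Wand w : w \in W -> [&& 0 < w.1, 0 < w.2 & coprime w.1 w.2]%N.
  rewrite mem_undup => /mapP[e eL ->]; have /andP[e1 e2] := allP Lpos e eL.
  by have [-> -> ->] := edge_classP e1 e2.
have width w : w \in W -> (w.1 * size (rs w) = \sum_(e <- L | edge_class e == w) e.2)%N.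
  move=> wW; have /and3P[n0 m0 nm] := Wand w wW.
  have [hk [c [lo sf]]] := datP w (Wand w wW).
  by rewrite (slice_width_class dec Lpos n0 m0 nm hk sf) -surjective_pairing.
have rs0 : {in W, forall w, all (predC1 0) (rs w)}.
  by move=> w wW; have [_ [c [lo []]]] := datP w (Wand w wW).
(* The relevant quasi-tangents, each listed once; [ds] will hold the multiplicities. The existential
   keeps the list opaque. *)
have [T TE] : exists T : seq (nat * nat * R[i]), T = [seq (w, a) | w <- W, a <- undup (rs w)].
  by eexists.
have TP tau : tau \in T -> tau.1 \in W /\ tau.2 \in rs tau.1.
  by rewrite TE => /allpairsPdep[w [a [wW + ->]]]; rewrite mem_undup.
have Tmem w a : w \in W -> a \in rs w -> (w, a) \in T.
  by move=> wW ars; rewrite TE; apply/allpairsPdep; exists w, a; rewrite mem_undup.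
have uT : uniq T.
  rewrite TE; apply: allpairs_uniq_dep => //; first by move=> w _; exact: undup_uniq.
  by move=> [w a] [w' a'] _ _ /= [-> ->].
have [tau tauE] : exists tau : 'I_(size T) -> nat * nat * R[i], tau =1 tnth (in_tuple T).
  by exists (tnth (in_tuple T)).
have tauT i : tau i \in T by rewrite tauE; exact: mem_tnth.
pose n_ i := (tau i).1.1; pose m_ i := (tau i).1.2.
have n0 i : (0 < n_ i)%N by have /and3P[] := Wand _ (TP _ (tauT i)).1.
have m0 i : (0 < m_ i)%N by have /and3P[] := Wand _ (TP _ (tauT i)).1.
have a0 i : (tau i).2 != 0.
  by have [wW ars] := TP _ (tauT i); have /allP/(_ _ ars) := rs0 _ wW.
pose al i := root_arg (n_ i) (tau i).2.
pose st (u : cps R[i]) i := strict_transform (n_ i, m_ i, (tau i).2) u.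
pose ds i := count_mem (tau i).2 (rs (tau i).1).
have kh_ex i : exists k, pi_tau (n0 i) (m0 i) (al i) h = cpsX ^+ k * st h i /\
    exists j, st h i 0%N j != 0.
  have [k hE hj] := strict_transformP (tau i).2 (n0 i) (m0 i) h_neq0 h_const.
  by exists k.
have [kh khP] := choice kh_ex.
have mup_ds i k : is_weight (n_ i) (m_ i) h k ->
    mup (al i) (slice (n_ i) (m_ i) h k) = ds i.
  move=> hk; have [wW ars] := TP _ (tauT i).
  have [hk' [c [lo sf]]] := datP _ (Wand _ wW).
  have kk : k = (dat (tau i).1).1 := min_weight_uniq (weight_min_weight hk) (weight_min_weight hk').
  by rewrite kk (mup_slice_factor (n0 i) (root_arg_neq0 (n0 i) (a0 i)) sf) root_argX.
have hs_order i : yorder (st h i 0%N) (ds i).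
  have [k hk] := weight_exists (n_ i) (m_ i) h_neq0.
  by have [_] := pi_tau_strict_uniq hk (khP i).1 (khP i).2; rewrite mup_ds.
have fsE i : pi_tau (n0 i) (m0 i) (al i) f = cpsX ^+ (kf (tau i).1) * st f i.
  have [k fE fj] := strict_transformP (tau i).2 (n0 i) (m0 i) f_neq0 f_const.
  by have [<- _] := pi_tau_strict_uniq (kfP (tau i).1) fE fj.
have sumT (F : nat * nat * R[i] -> nat) :
    (\sum_(i < size T) F (tau i) = \sum_(w <- W) \sum_(a <- undup (rs w)) F (w, a))%N.
  transitivity (\sum_(ta <- T) F ta)%N.
    by rewrite [RHS]big_tnth; apply: eq_bigr => i _; rewrite tauE.
  by rewrite TE big_allpairs_dep.
have sumW : (\sum_(w <- W) w.1 * size (rs w) = b)%N.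
  rewrite bE -(sum_edge_class (fun e => e.2) uW LW) !big_seq.
  by apply: eq_bigr => w wW; exact: width.
(* The [n * d_tau] add up to the order of [h(0, Y)], which makes the matrix of the comparison map
   square. *)
have card_b : #|{: {i : 'I_(size T) & ('I_(n_ i) * 'I_(ds i))%type}}| = b.
  rewrite card_pairs (sumT (fun ta => ta.1.1 * count_mem ta.2 (rs ta.1))%N) -sumW.
  by apply: eq_bigr => w _; rewrite -big_distrr /= sum_count_undup.
have low_inj (u : cps R[i]) :
    (forall i j, (#|{: {i : 'I_(size T) & ('I_(n_ i) * 'I_(ds i))%type}}| <= j)%N ->
    u i j = 0) -> (forall i, exists q, pi_tau (n0 i) (m0 i) (al i) u = q * st h i) -> u = 0.
  rewrite card_b => ub uq; apply: (low_degree_zero (esym sumW) uW) rs0 ub.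
    by move=> w /Wand/and3P[].
  move=> w wW k uk a ars; have /tnthP[i iE] : (w, a) \in in_tuple T by exact: Tmem.
  have [q qE] := uq i.
  have H k' : is_weight (n_ i) (m_ i) u k' ->
      (ds i <= mup (al i) (slice (n_ i) (m_ i) u k'))%N.
    by move=> uk'; exact: mup_of_multiple uk' qE (hs_order i).
  have E : tau i = (w, a) by rewrite tauE iE.
  by move: H; rewrite /al /ds /n_ /m_ E => H; exact: H uk.
have hb' : yorder (h 0%N) #|{: {i : 'I_(size T) & ('I_(n_ i) * 'I_(ds i))%type}}|.
  by rewrite card_b.
have := @codim_strict_transforms R _ _ n_ m_ n0 m0 al h (st h) ds kh
  (fun i => (khP i).1) hs_order hb' low_inj f (st f) (fun i => kf (tau i).1) fsE.
rewrite -/(i0 f h) => ->; rewrite big_split /=; congr (_ + _)%E.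
  rewrite sumEFin -natr_sum (sumT (fun ta => kf ta.1 * count_mem ta.2 (rs ta.1))%N).
  (* An edge is [gcd] times its primitive normal turned by a quarter, so it contributes [gcd] times
     the weight of [f]; the gcds over one class add up to the number of roots of the slice of
     [h]. *)
  rewrite DE (double_area_edge_sum (k := fun e => gcdn e.1 e.2 * kf (edge_class e))%N) //.
  - congr (_%:R%:E); rewrite -(sum_edge_class _ uW LW) !big_seq.
    apply: eq_bigr => w wW /=; rewrite -big_distrr /= sum_count_undup.
    have /and3P[w0 _ _] := Wand w wW.
    have -> : size (rs w) = (\sum_(e <- L | edge_class e == w) gcdn e.1 e.2)%N.
      apply/eqP; rewrite -(eqn_pmul2l w0) (width w wW) big_distrr/= big_seq_cond.
      rewrite [X in _ == X]big_seq_cond; apply/eqP/eq_bigr => e /andP[eL /eqP <-].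
      have /andP[e1 e2] := allP Lpos e eL; have [_ _ _ _ E2] := edge_classP e1 e2.
      by rewrite {1}E2 mulnC.
    by rewrite big_distrr/=; apply: eq_bigr => e /eqP <-; rewrite mulnC.
  - have [i [[j fij] _]] := low_row f_neq0.
    by eexists; last reflexivity; exists (i, j).
  - move=> e eL; have /andP[e1 e2] := allP Lpos e eL.
    have [_ _ _ E1 E2] := edge_classP e1 e2.
    by rewrite {1}E2 {2}E1; apply/weight_min_weight/is_weight_scale/kfP.
transitivity (\sum_(ta <- T) i0 (strict_transform ta f) (strict_transform ta h))%E.
  rewrite [RHS]big_tnth; apply: eq_bigr => i _.
  by rewrite /st /n_ /m_ -!surjective_pairing tauE.
have TQ : [set` T] `<=` quasi_tangents h.
  move=> [[n m] a] /= /TP[/= wW ars]; have /and3P[/= w1 w2 cop] := Wand _ wW.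
  have [hk [c [lo sf]]] := datP _ (Wand _ wW).
  apply: (quasi_tangent_of_root w1 w2 cop _ hk sf ars).
  by have /allP/(_ _ ars) := rs0 _ wW.
rewrite (fsbigE T) //.
  rewrite big_seq [RHS]big_seq_cond; apply: eq_bigl => ta.
  by case taT: (ta \in T) => //=; apply/esym/mem_set/TQ.
(* For a binomial curve outside [T], [a] is not a root of the slice, so [h_tau] is a unit and the
   term is zero. *)
move=> [[n m] a] [[w1 w2 cop a1] _] aT.
have W3 : [&& 0 < (n, m).1, 0 < (n, m).2 & coprime (n, m).1 (n, m).2]%N by rewrite /= w1 w2.
have [hk [c [lo sf]]] := datP (n, m) W3.
have ars : a \notin rs (n, m).
  apply: contra aT => ars; apply: Tmem => //.
  have := slice_width_class dec Lpos w1 w2 cop hk sf.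
  (* A direction normal to no edge has a slice of width zero, hence no roots at all. *)
  have [[e eL /eqP ew]|none E] := pselect (exists2 e, e \in L & edge_class e == (n, m)).
    by move=> _; rewrite -ew; exact: LW.
  move: E; rewrite big_seq_cond big_pred0 => [/eqP|e]; last first.
    by apply/negP => /andP[eL ew]; apply: none; exists e.
  by rewrite muln_eq0 gtn_eqF//= size_eq0 => /eqP rs_nil; move: ars; rewrite /rs rs_nil.
apply: i0_unit.
have [k hE hj] := strict_transformP a w1 w2 h_neq0 h_const.
have [_ [_]] := pi_tau_strict_uniq hk hE hj.
rewrite (mup_slice_factor w1 (root_arg_neq0 w1 a1) sf) root_argX//.
by rewrite (count_memPn ars).
Qed.
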